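(* Let $d\ge1$ be an integer. There exists a constant $C>0$ depending only on $d$ such that the following holds. Let $m\ge0$ be an integer, let $\mathcal{J}\subset\mathbb{Z}^d$ be finite and nonempty, and let $\{X_i: i\in\mathcal{J}\}$ be an $m$-dependent random field with $\mathbb{E}X_i=0$ and $\mathbb{E}|X_i|^3<\infty$ for all $i\in\mathcal{J}$. Let $A_i=\{j\in\mathcal{J}:|i-j|\le m\}$ and $Y_i=\sum_{j\in A_i}X_j$, and assume $\sigma^2:=\sum_{i\in\mathcal{J}}\mathbb{E}\{X_iY_i\}>0$. Let $W$ be the self-normalized sum defined in the context. Then $$\sup_{z\in\mathbb{R}}\bigl|\mathbb{P}(W\le z)-\Phi(z)\bigr|\le C(m+1)^{3d}\bigl(1+(m+1)^d|\mathcal{J}|^{1/3}\gamma^{2/3}\bigr)\bigl(\gamma+|\mathcal{J}|^{-1/2}\bigr),$$ where $\gamma=\sum_{i\in\mathcal{J}}\mathbb{E}|X_i|^3/\sigma^3$ and $\Phi$ is the standard normal distribution function.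
   Context: For $i=(i_1,\dots,i_d),j=(j_1,\dots,j_d)\in\mathbb{Z}^d$ put $|i-j|=\max_{1\le k\le d}|i_k-j_k|$, and for $A,B\subset\mathbb{Z}^d$ put $\rho(A,B)=\inf\{|i-j|: i\in A,\ j\in B\}$. A field $\{X_i:i\in\mathcal{J}\}$ of real random variables is $m$-dependent if $\{X_i,i\in A\}$ and $\{X_j,j\in B\}$ are independent whenever $A,B\subset\mathcal{J}$ and $\rho(A,B)>m$. $|\mathcal{J}|$ is the cardinality of $\mathcal{J}$. Define $S=\sum_{i\in\mathcal{J}}X_i$, $\bar X=\sum_{i\in\mathcal{J}}X_i/|\mathcal{J}|$, $\bar Y=\sum_{j\in\mathcal{J}}Y_j/|\mathcal{J}|$, $$V=\sqrt{\Bigl(\sum_{i\in\mathcal{J}}(X_iY_i-\bar X\bar Y)\Bigr)_+},\qquad W=S/V,$$ where $(x)_+=\max(x,0)$ (and $W:=0$ on the event $\{V=0\}$). *)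

(* Defs.v *)
From mathcomp Require Import all_boot all_order all_algebra.
From mathcomp Require Import finmap.
From mathcomp Require Import all_classical all_reals all_analysis.

Set Implicit Arguments.
Unset Strict Implicit.
Unset Printing Implicit Defensive.

Import Order.TTheory GRing.Theory Num.Theory.
Import numFieldNormedType.Exports.

Local Open Scope classical_set_scope.
Local Open Scope ring_scope.

Definition zdist (d : nat) (i j : 'rV[int]_d) : nat :=
  \max_(k < d) `|i ord0 k - j ord0 k|%N.

(* Valued in \bar R, so that the distance to the empty set is +oo. *)
Definition rho (R : realType) (d : nat) (A B : set 'rV[int]_d) : \bar R :=
  ereal_inf [set ((zdist i j)%:R : R)%:E | i in A & j in B].

Definition std_normal_cdf (R : realType) (z : R) : \bar R :=
  normal_prob 0 1 `]-oo, z].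

Section random_field.
Context (R : realType) (disp : measure_display) (T : measurableType disp)
  (P : probability T R).

Definition sigma_generated (I : Type) (X : I -> {RV P >-> R}) (A : set I) :
    set_system T :=
  <<s \bigcup_(i in A) preimage_set_system setT (X i) measurable >>.

Definition independent_families (I : Type) (X : I -> {RV P >-> R})
    (A B : set I) : Prop :=
  forall E F : set T, sigma_generated X A E -> sigma_generated X B F ->
    P (E `&` F) = (P E * P F)%E.

Context (d : nat) (J : {fset 'rV[int]_d}) (X : J -> {RV P >-> R}).

Definition m_dependent (m : nat) : Prop :=
  forall A B : set J,
    ((m%:R : R)%:E < rho R (val @` A) (val @` B))%E ->
    independent_families X A B.

Definition nbhd_sum (m : nat) (i : J) (t : T) : R :=
  \sum_(j : J | (zdist (val i) (val j) <= m)%N) X j t.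

(* The expectations below are finite as soon as the X i have finite third
   moments; [fine] only moves them from \bar R to R. *)
Definition sigma2 (m : nat) : R :=
  \sum_(i : J) fine ('E_P[fun t => (X i t * nbhd_sum m i t)%R])%E.

Definition gamma (m : nat) : R :=
  (\sum_(i : J) fine ('E_P[fun t => (`|X i t| ^+ 3)%R])%E)
    / Num.sqrt (sigma2 m) ^+ 3.

Definition Ssum (t : T) : R := \sum_(i : J) X i t.

Definition Xbar (t : T) : R := Ssum t / #|` J|%:R.

Definition Ybar (m : nat) (t : T) : R :=
  (\sum_(j : J) nbhd_sum m j t) / #|` J|%:R.

Definition Vnorm (m : nat) (t : T) : R :=
  Num.sqrt (Num.max
    (\sum_(i : J) (X i t * nbhd_sum m i t - Xbar t * Ybar m t)) 0).

Definition Wstat (m : nat) (t : T) : R :=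
  if Vnorm m t == 0 then 0 else Ssum t / Vnorm m t.

End random_field.

(* Main.v *)
(* Stein's method for local dependence.  After rescaling by sigma and truncating
   the summands at 1/(4K), where K bounds the size of the 4m-neighbourhoods, the
   event {S <= z V} is replaced by {S / psi(U) <= z}: U = sum_i xi_i Y_i, and psi is
   the square root of a clamped argument, hence bounded, Lipschitz and bounded away
   from 0.  Stein's equation for a ramp of width al = 200 K^2 (gamma + n^(-1/2)) is
   applied to S / psi(U), removing the neighbourhood of i from both S and psi(U).
   The only error that is not directly of third order is the second-order term of
   the ramp, controlled by the probability that S - z psi(U) lies within O(al) of 0,
   weighted by |xi_i Y_i|.
   That probability is bounded by a weighted concentration inequality: with
   T = S - a psi(U) and phi = 1/(1 + x^2) = atan', expand
   E[zeta S atan((T - t)/al)], for zeta depending on one neighbourhood only, over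
   the summands of S.  The first-order term produces al^-1 E[zeta phi((T - t)/al)];
   the higher-order terms involve phi at shifted levels and are absorbed, since q(t)
   = E[zeta phi((T - t)/al)] satisfies q <= C + (1/2) sup q in the norm weighted by
   1 + |t|.  The centering term Xbar Ybar is removed at the end by Markov's
   inequality. *)

Require Import Defs.
From mathcomp Require Import all_boot all_order all_algebra.
From mathcomp Require Import finmap.
From mathcomp Require Import all_classical all_reals all_analysis.
From mathcomp Require Import measurable_realfun measurable_fun_approximation ring lra zify.

Set Implicit Arguments.
Unset Strict Implicit.
Unset Printing Implicit Defensive.

Import Order.TTheory GRing.Theory Num.Theory.
Import numFieldNormedType.Exports.

Local Open Scope classical_set_scope.
Local Open Scope ring_scope.

(** Two constraints shape the argument. The constants must not depend on the level z, although z
    multiplies psi(U) in S - z psi(U). Where this gap equals u, psi >= 1/2 gives |z| <= 2 |S - u|,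
    so the decay of phi pays for the factor z; what is left is a term in |t|, whence the weight 1 +
    |t|. Moreover every error made on phi has to be a multiple of phi itself, or it could not be
    absorbed: this is why a heavy-tailed kernel, which varies by a bounded factor over unit shifts,
    replaces an indicator.

    The truncation level bounds each neighbourhood sum by 1/4; some summand is cut with probability
    at most 64 K^3 gamma, the origin of (m+1)^(3d). The weights |xi_i Y_i| are only of second order:
    their total mass is at most K times the sum of the second moments of the xi_i, which is of order
    n^(1/3) gamma^(2/3). This is the other factor of the bound. The constant 200 in the width makes
    the third-order remainders, once divided by al, small against the leading coefficient, which is
    at least 11/16. *)

Definition bmeas d (T : measurableType d) (R : realType) (f : T -> R) : Prop :=
  measurable_fun setT f /\ exists M, forall t, `|f t| <= M.

(** * Bounded random variables *)

Section bounded_measurable.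
Context d (T : measurableType d) (R : realType).
Implicit Types f g : T -> R.

Lemma mb_cst c : bmeas (fun _ : T => c : R).
Proof. by split; [exact: measurable_cst | exists `|c|]. Qed.

Lemma mbD f g : bmeas f -> bmeas g -> bmeas (fun t => f t + g t).
Proof.
move=> [mf [M fM]] [mg [N gN]]; split; first exact: measurable_funD.
by exists (M + N) => t; rewrite (le_trans (ler_normD _ _))// lerD.
Qed.

Lemma mbN f : bmeas f -> bmeas (fun t => - f t).
Proof.
move=> [mf [M fM]]; split; first exact: measurable_funN.
by exists M => t; rewrite normrN.
Qed.

Lemma mbB f g : bmeas f -> bmeas g -> bmeas (fun t => f t - g t).
Proof. by move=> mf mg; apply: mbD => //; exact: mbN. Qed.

Lemma mbM f g : bmeas f -> bmeas g -> bmeas (fun t => f t * g t).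
Proof.
move=> [mf [M fM]] [mg [N gN]]; split; first exact: measurable_funM.
by exists (M * N) => t; rewrite normrM ler_pM.
Qed.

Lemma mb_norm f : bmeas f -> bmeas (fun t => `|f t|).
Proof.
move=> [mf [M fM]]; split; first exact: measurableT_comp.
by exists M => t; rewrite normr_id.
Qed.

Lemma mbX f n : bmeas f -> bmeas (fun t => f t ^+ n).
Proof.
move=> mf; elim: n => [|n ih]; first exact: mb_cst.
by under eq_fun do rewrite exprS; exact: mbM.
Qed.

Lemma mb_sum (I : Type) (s : seq I) (p : pred I) (F : I -> T -> R) :
  (forall i, p i -> bmeas (F i)) -> bmeas (fun t => \sum_(i <- s | p i) F i t).
Proof.
move=> mF; elim: s => [|i s ih].
  by under eq_fun do rewrite big_nil; exact: mb_cst.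
under eq_fun do rewrite big_cons.
by case: (boolP (p i)) => // pi; apply: mbD => //; exact: mF.
Qed.

Lemma mb_le f g : bmeas f -> bmeas g -> bmeas (fun t => (f t <= g t)%R%:R : R).
Proof.
move=> [mf _] [mg _]; split; last first.
  by exists 1 => t; case: (f t <= g t); rewrite ?normr1 ?normr0.
rewrite (_ : (fun t => _) = (fun t => if f t <= g t then 1 else 0)); last first.
  by apply/funext => t; case: ifP.
by apply: measurable_fun_ifT; [exact: measurable_fun_ler| |].
Qed.

Lemma mb_comp (F : R -> R) (M : R) f : continuous F -> (forall x, `|F x| <= M) ->
  bmeas f -> bmeas (fun t => F (f t)).
Proof.
move=> cF FM [mf _]; split; last by exists M.
by apply: measurableT_comp => //; exact: continuous_measurable_fun.
Qed.

End bounded_measurable.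

Definition Ex d (T : measurableType d) (R : realType) (P : probability T R)
  (f : T -> R) : R := \int[P]_t f t.

Section expectation.
Context d (T : measurableType d) (R : realType) (P : probability T R).
Implicit Types f g : T -> R.

Lemma mb_integrable f : bmeas f -> P.-integrable setT (EFin \o f).
Proof.
move=> [mf [M fM]]; apply: measurable_bounded_integrable => //.
  by rewrite (le_lt_trans (probability_le1 _ _)) ?ltry.
exists M; split; first exact: num_real.
by move=> x Mx t _; exact: le_trans (fM t) (ltW Mx).
Qed.

Lemma eq_Ex f g : f =1 g -> Ex P f = Ex P g.
Proof. by move=> fg; apply: eq_Rintegral => t _; rewrite fg. Qed.

Lemma ExD f g : bmeas f -> bmeas g ->
  Ex P (fun t => f t + g t) = Ex P f + Ex P g.
Proof. by move=> mf mg; rewrite /Ex RintegralD//; exact: mb_integrable. Qed.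

Lemma ExB f g : bmeas f -> bmeas g ->
  Ex P (fun t => f t - g t) = Ex P f - Ex P g.
Proof. by move=> mf mg; rewrite /Ex RintegralB//; exact: mb_integrable. Qed.

Lemma ExZ c f : bmeas f -> Ex P (fun t => c * f t) = c * Ex P f.
Proof. by move=> mf; rewrite /Ex RintegralZl//; exact: mb_integrable. Qed.

Lemma ExZr c f : bmeas f -> Ex P (fun t => f t * c) = Ex P f * c.
Proof. by move=> mf; rewrite /Ex RintegralZr//; exact: mb_integrable. Qed.

Lemma Ex_cst c : Ex P (fun=> c) = c.
Proof.
by transitivity (c * fine (P setT)); [exact: Rintegral_cst|rewrite probability_setT/= mulr1].
Qed.

Lemma Ex_le f g : bmeas f -> bmeas g -> (forall t, f t <= g t) -> Ex P f <= Ex P g.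
Proof. by move=> mf mg fg; apply: le_Rintegral => //; exact: mb_integrable. Qed.

Lemma Ex_ge0 f : (forall t, 0 <= f t) -> 0 <= Ex P f.
Proof. by move=> f0; exact: Rintegral_ge0. Qed.

Lemma Ex_abs f : bmeas f -> `|Ex P f| <= Ex P (fun t => `|f t|).
Proof. by move=> mf; apply: le_normr_Rintegral => //; exact: mb_integrable. Qed.

Lemma Ex_sum (I : Type) (s : seq I) (p : pred I) (F : I -> T -> R) :
  (forall i, p i -> bmeas (F i)) ->
  Ex P (fun t => \sum_(i <- s | p i) F i t) = \sum_(i <- s | p i) Ex P (F i).
Proof.
move=> mF; elim: s => [|i s ih].
  by rewrite big_nil; under eq_Ex do rewrite big_nil; rewrite Ex_cst.
under eq_Ex do rewrite big_cons.
rewrite big_cons -ih; case: (boolP (p i)) => // pi; rewrite ExD//; first exact: mF.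
exact: mb_sum.
Qed.

Lemma Ex_indic (A : set T) : measurable A -> Ex P (\1_A) = fine (P A).
Proof.
by move=> mA; rewrite /Ex /Rintegral integral_indic// setIT.
Qed.

End expectation.

(** * Product formula for independent bounded functions *)

Section independence.
Context d (T : measurableType d) (R : realType) (P : probability T R).
Implicit Types f g : T -> R.

Lemma staircase_full (N : nat) (x : R) : N%:R <= x ->
  \sum_(k < N) (k.+1%:R <= x)%R%:R = N%:R :> R.
Proof.
move=> Nx; rewrite -[RHS](_ : \sum_(k < N) 1 = _); last by rewrite sumr_const card_ord.
by apply: eq_bigr => k _; rewrite (le_trans _ Nx)// ler_nat.
Qed.

(** On [0, N] the sum is the integer part of [x]. It serves to write a bounded function, up to a
    uniform error, as a finite combination of indicators of half-lines. *)
Lemma staircase_approx (N : nat) (x : R) : 0 <= x -> x <= N%:R ->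
  `|x - \sum_(k < N) (k.+1%:R <= x)%R%:R| <= 1.
Proof.
move=> x0; elim: N => [|N ih] xN.
  by rewrite big_ord0 subr0 ger0_norm// (le_trans xN).
have [Nx|/ltW/ih xN'] := leP N%:R x; last first.
  rewrite big_ord_recr/=; case: (leP N.+1%:R x) => [Nx|_]; last by rewrite addr0.
  have -> : x = N.+1%:R by apply/eqP; rewrite eq_le xN.
  rewrite (staircase_full (N := N)) ?ler_nat//.
  by rewrite -natr1 subrr normr0.
rewrite big_ord_recr/= staircase_full//.
case: (leP N.+1%:R x) => [Nx'|_].
  have -> : x = N.+1%:R by apply/eqP; rewrite eq_le xN.
  by rewrite -natr1 subrr normr0.
rewrite addr0 ger0_norm ?subr_ge0//.
by rewrite lerBlDr nat1r.
Qed.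

Definition indep_fun f g := forall A B : set R, measurable A -> measurable B ->
  P (f @^-1` A `&` g @^-1` B) = (P (f @^-1` A) * P (g @^-1` B))%E.

Lemma Ex_indep_indic f g (a b : R) : bmeas f -> bmeas g -> indep_fun f g ->
  Ex P (fun t => (a <= f t)%R%:R * (b <= g t)%R%:R) =
  Ex P (fun t => (a <= f t)%R%:R) * Ex P (fun t => (b <= g t)%R%:R).
Proof.
move=> [mf _] [mg _] fg.
have e (h : T -> R) (c : R) : (fun t : T => (c <= h t)%R%:R : R) = \1_(h @^-1` `[c, +oo[%classic).
  apply/funext => t; rewrite indicE; congr ((nat_of_bool _)%:R); apply/idP/idP.
    by move=> ct; rewrite inE/= in_itv/= andbT.
  by rewrite inE/= in_itv/= andbT.
have m (h : T -> R) (c : R) : measurable_fun setT h -> measurable (h @^-1` `[c, +oo[%classic).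
  by move=> mh; rewrite -[X in measurable X]setTI; exact: mh.
rewrite !e !Ex_indic; [|exact: m|exact: m].
rewrite -fineM ?fin_num_measure//; [|exact: m|exact: m].
rewrite -fg// -Ex_indic; last by apply: measurableI; exact: m.
apply: eq_Ex => t.
by rewrite (congr1 (fun h => h t) (e f a)) (congr1 (fun h => h t) (e g b)) indicI.
Qed.

(** Both functions are replaced by staircases [ap] within [1/n] of them uniformly. For staircases
    the formula is a finite sum of instances of [Ex_indep_indic], and uniform closeness carries it
    over as n grows; no monotone class argument enters. *)
Lemma Ex_indep f g : bmeas f -> bmeas g -> indep_fun f g ->
  Ex P (fun t => f t * g t) = Ex P f * Ex P g.
Proof.
move=> bf bg fg.
have [m [M [m0 fM gM]]] : exists m : nat, exists M : R, [/\ M = m%:R,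
    forall t, `|f t| <= M & forall t, `|g t| <= M].
  case: (bf) => _ [A fA]; case: (bg) => _ [B gB].
  exists (Num.truncn (`|A| + `|B|)).+1, (Num.truncn (`|A| + `|B|)).+1%:R.
  have /ltW h := truncnS_gt (`|A| + `|B|); split => // t.
    by apply: le_trans h; rewrite (le_trans (fA t))// ler_wpDr// ler_norm.
  by apply: le_trans h; rewrite (le_trans (gB t))// ler_wpDl// ler_norm.
have M0 : 0 <= M by rewrite m0.
apply/eqP; rewrite -subr_eq0 -normr_le0; apply/ler_addgt0Pl => e e0; rewrite addr0.
(* Passing to staircases costs at most [(2 * M + 1) / n] on each side of the product formula, hence
   [(4 * M + 2) / n] in all. *)
pose n := (Num.truncn ((4 * M + 2) / e)).+1.
have n0 : (0 : R) < n%:R by [].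
have ne : (4 * M + 2) / n%:R <= e.
  by rewrite ler_pdivrMr// [leRHS]mulrC -ler_pdivrMr//; exact: ltW (truncnS_gt _).
(* After the shift by [M] the values lie in [0, 2m], which is covered by 2mn steps of height
   [1/n]. *)
pose N := (n * (m + m))%N.
pose st (h : T -> R) t := \sum_(k < N) (k.+1%:R / n%:R - M <= h t)%R%:R : R.
have stM (h : T -> R) : (forall t, `|h t| <= M) -> forall t,
    `|h t - (st h t / n%:R - M)| <= n%:R^-1.
  move=> hM t; have := hM t; rewrite ler_norml => /andP[h1 h2].
  have -> : st h t = \sum_(k < N) (k.+1%:R <= n%:R * (h t + M))%R%:R.
    apply: eq_bigr => k _.
    by rewrite lerBlDr ler_pdivrMr// [X in _ <= X]mulrC.
  set s := \sum_(k < N) _.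
  have -> : h t - (s / n%:R - M) = (n%:R * (h t + M) - s) / n%:R.
    by field; rewrite gt_eqF.
  rewrite normrM [X in _ * X <= _]ger0_norm ?invr_ge0//.
  rewrite ler_piMl ?invr_ge0//; apply: staircase_approx.
    by rewrite mulr_ge0// -lerBlDr sub0r.
  by rewrite /N natrM natrD -m0 ler_pM2l// lerD2r.
have bst (h : T -> R) : bmeas h -> bmeas (st h).
  by move=> bh; apply: mb_sum => k _; apply: mb_le => //; exact: mb_cst.
pose ap (h : T -> R) t := st h t / n%:R - M.
have bap (h : T -> R) : bmeas h -> bmeas (ap h).
  move=> bh; apply: mbB; last exact: mb_cst.
  by apply: mbM; [exact: bst|exact: mb_cst].
have stE : Ex P (fun t => st f t * st g t) = Ex P (st f) * Ex P (st g).
  under eq_Ex do rewrite /st mulr_suml.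
  have bi (h : T -> R) c : bmeas h -> bmeas (fun t => (c <= h t)%R%:R : R).
    by move=> bh; apply: mb_le => //; exact: mb_cst.
  rewrite Ex_sum; last by move=> k _; apply: mbM; [exact: bi|exact: bst].
  rewrite [X in _ = X * _]Ex_sum; last by move=> k _; exact: bi.
  rewrite mulr_suml; apply: eq_bigr => k _.
  under eq_Ex do rewrite mulr_sumr.
  rewrite Ex_sum; last by move=> l _; apply: mbM; exact: bi.
  rewrite [X in _ = _ * X]Ex_sum; last by move=> l _; exact: bi.
  by rewrite mulr_sumr; apply: eq_bigr => l _; exact: Ex_indep_indic.
have apE : Ex P (fun t => ap f t * ap g t) = Ex P (ap f) * Ex P (ap g).
  have eap h : bmeas h -> Ex P (ap h) = Ex P (st h) / n%:R - M.
    move=> bh; rewrite ExB ?ExZr ?Ex_cst//; [exact: bst| |exact: mb_cst].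
    by apply: mbM; [exact: bst|exact: mb_cst].
  rewrite !eap//.
  transitivity (Ex P (fun t => (n%:R ^- 2) * (st f t * st g t) +
     (- M / n%:R) * (st f t + st g t) + M ^+ 2)).
    by apply: eq_Ex => t; rewrite /ap; field; rewrite gt_eqF.
  have b1 := bst _ bf; have b2 := bst _ bg.
  have b3 : bmeas (fun t => st f t * st g t) by exact: mbM.
  have b4 : bmeas (fun t => st f t + st g t) by exact: mbD.
  have bZ c h : bmeas h -> bmeas (fun t : T => c * h t).
    by move=> bh; apply: mbM => //; exact: mb_cst.
  rewrite ExD; [|by apply: mbD; exact: bZ|exact: mb_cst].
  rewrite ExD; [|exact: bZ|exact: bZ].
  rewrite Ex_cst !ExZ// ExD// stE; field; by rewrite gt_eqF.
have apM (h : T -> R) : (forall t, `|h t| <= M) -> forall t, `|ap h t| <= M + 1.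
  move=> hM t; have -> : ap h t = h t - (h t - ap h t) by ring.
  rewrite (le_trans (ler_normB _ _))// lerD// (le_trans (stM h hM t))//.
  by rewrite invf_le1// ler1n.
have d1 : `|Ex P (fun t => f t * g t) - Ex P (fun t => ap f t * ap g t)| <=
   (2 * M + 1) / n%:R.
  rewrite -ExB; [|exact: mbM|by apply: mbM; exact: bap].
  apply: le_trans (Ex_abs _ _) _.
    by apply: mbB; apply: mbM => //; exact: bap.
  rewrite -[leRHS](Ex_cst P); apply: Ex_le.
  - by apply: mb_norm; apply: mbB; apply: mbM => //; exact: bap.
  - exact: mb_cst.
  move=> t; have -> : f t * g t - ap f t * ap g t =
     f t * (g t - ap g t) + (f t - ap f t) * ap g t by ring.
  rewrite (le_trans (ler_normD _ _))// !normrM.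
  have -> : (2 * M + 1) / n%:R = M * n%:R^-1 + n%:R^-1 * (M + 1) by ring.
  by apply: lerD; apply: ler_pM => //; [exact: stM|exact: stM|exact: apM].
have d2 (h : T -> R) : bmeas h -> (forall t, `|h t| <= M) ->
    `|Ex P h - Ex P (ap h)| <= n%:R^-1.
  move=> bh hM; rewrite -ExB//; last exact: bap.
  apply: le_trans (Ex_abs _ _) _; first by apply: mbB => //; exact: bap.
  rewrite -[leRHS](Ex_cst P); apply: Ex_le => //.
  - by apply: mb_norm; apply: mbB => //; exact: bap.
  - exact: mb_cst.
  - exact: stM.
have exM (h : T -> R) C : bmeas h -> (forall t, `|h t| <= C) -> `|Ex P h| <= C.
  move=> bh hM; apply: le_trans (Ex_abs _ bh) _.
  by rewrite -[leRHS](Ex_cst P); apply: Ex_le => //; [exact: mb_norm|exact: mb_cst].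
rewrite [X in `|X|](_ : _ =
   (Ex P (fun t => f t * g t) - Ex P (fun t => ap f t * ap g t)) -
   (Ex P f * (Ex P g - Ex P (ap g)) + (Ex P f - Ex P (ap f)) * Ex P (ap g))); last first.
  by rewrite apE; ring.
apply: le_trans ne.
have -> : (4 * M + 2) / n%:R = (2 * M + 1) / n%:R + (M * n%:R^-1 + n%:R^-1 * (M + 1)).
  by ring.
rewrite (le_trans (ler_normB _ _))// lerD//.
rewrite (le_trans (ler_normD _ _))// !normrM.
apply: lerD; apply: ler_pM => //; [exact: exM|exact: d2|exact: d2|].
by apply: exM; [exact: bap|exact: apM].
Qed.

End independence.

(** * Bounded functions of a subfamily of the variables *)

Section dependence.
Context d (T : measurableType d) (R : realType) (P : probability T R).
Context (I : finType) (X : I -> {RV P >-> R}).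
Implicit Types (A B : {set I}) (f g : T -> R).

Definition gen_sets A : set_system T :=
  \bigcup_(i in [set i | i \in A]) preimage_set_system setT (X i) measurable.

(* Bounded and measurable with respect to the sigma-algebra generated by [X i], [i \in A]. *)
Definition dep A f : Prop := @bmeas _ (g_sigma_algebraType (gen_sets A)) R f.

Lemma gen_setsS A B : A \subset B -> gen_sets A `<=` gen_sets B.
Proof. by move=> AB E [i /= iA Ei]; exists i => //=; exact: (fintype.subsetP AB). Qed.

Lemma gen_sets_measurable A : <<s gen_sets A >> `<=` @measurable _ T.
Proof.
apply: smallest_sub; first exact: sigma_algebra_measurable.
by move=> E [i _ [C mC <-]]; exact: measurable_funPT.
Qed.

Lemma depS A B f : A \subset B -> dep A f -> dep B f.
Proof.
move=> AB [mf fM]; split => // _ C mC.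
have := mf measurableT C mC; rewrite !setTI.
by apply: sub_sigma_algebra2; exact: gen_setsS.
Qed.

Lemma dep_mb A f : dep A f -> bmeas f.
Proof.
move=> [mf fM]; split => // _ C mC.
by have := mf measurableT C mC; rewrite !setTI; exact: gen_sets_measurable.
Qed.

Lemma dep_comp (i : I) (F : R -> R) M : measurable_fun setT F ->
  (forall x, `|F x| <= M) -> dep [set i]%SET (fun t => F (X i t)).
Proof.
move=> mF FM; split; last by exists M.
apply: measurableT_comp => // _ C mC; rewrite setTI.
by apply: sub_sigma_algebra; exists i => /=; [rewrite inE|exists C; rewrite ?setTI].
Qed.

(** [dep A] is [bmeas] on the same set with a smaller sigma-algebra, so the closure properties of
    [bmeas] apply to it verbatim. *)
Lemma dep_cst A (c : R) : dep A (fun=> c). Proof. exact: mb_cst. Qed.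
Lemma depD A f g : dep A f -> dep A g -> dep A (fun t => f t + g t).
Proof. exact: mbD. Qed.
Lemma depN A f : dep A f -> dep A (fun t => - f t). Proof. exact: mbN. Qed.
Lemma depM A f g : dep A f -> dep A g -> dep A (fun t => f t * g t).
Proof. exact: mbM. Qed.
Lemma depX A f n : dep A f -> dep A (fun t => f t ^+ n). Proof. exact: mbX. Qed.
Lemma dep_norm A f : dep A f -> dep A (fun t => `|f t|). Proof. exact: mb_norm. Qed.
Lemma dep_le A f g : dep A f -> dep A g -> dep A (fun t => (f t <= g t)%R%:R).
Proof. exact: mb_le. Qed.
Lemma dep_sum A (J : Type) (s : seq J) (p : pred J) (F : J -> T -> R) :
  (forall j, p j -> dep A (F j)) -> dep A (fun t => \sum_(j <- s | p j) F j t).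
Proof. exact: mb_sum. Qed.
Lemma dep_cont A (F : R -> R) (M : R) f : continuous F ->
  (forall x, `|F x| <= M) -> dep A f -> dep A (fun t => F (f t)).
Proof. exact: mb_comp. Qed.

Lemma Ex_dep A B f g :
  independent_families X [set i | i \in A] [set i | i \in B] ->
  dep A f -> dep B g ->
  Ex P (fun t => f t * g t) = Ex P f * Ex P g.
Proof.
move=> AB df dg; apply: Ex_indep => //; try exact: dep_mb; first exact: (dep_mb df).
  exact: (dep_mb dg).
move=> C D mC mD; apply: AB.
  by case: df => mf _; have := mf measurableT C mC; rewrite setTI.
by case: dg => mg _; have := mg measurableT D mD; rewrite setTI.
Qed.

End dependence.

(** * Smoothing with the arctangent *)

Section atan_estimates.
Context (R : realType).
Implicit Types x y : R.

Lemma mean_value (f df : R -> R) (a b : R) :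
  (forall x, is_derive x 1 f (df x)) ->
  exists c, (a <= c <= b \/ b <= c <= a) /\ f b - f a = df c * (b - a).
Proof.
move=> fd.
have cf : continuous f.
  by move=> x; apply: differentiable_continuous; apply/derivable1_diffP; case: (fd x).
have [ab|ba] := leP a b.
  have [|c] := @MVT_segment R f df a b ab (fun x _ => fd x).
    exact: continuous_subspaceT.
  by rewrite in_itv/= => cab ->; exists c; split; [left|].
have [|c] := @MVT_segment R f df b a (ltW ba) (fun x _ => fd x).
  exact: continuous_subspaceT.
rewrite in_itv/= => cab e; exists c; split; first by right.
by rewrite -opprB e; ring.
Qed.

Definition phi x : R := (1 + x ^+ 2)^-1.

Lemma phi_den_gt0 x : 0 < 1 + x ^+ 2.
Proof. by rewrite ltr_pwDl// sqr_ge0. Qed.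

Lemma phi_gt0 x : 0 < phi x.
Proof. by rewrite invr_gt0 phi_den_gt0. Qed.

Lemma phi_le1 x : phi x <= 1.
Proof. by rewrite invf_le1 ?phi_den_gt0// lerDl sqr_ge0. Qed.

Lemma phiN x : phi (- x) = phi x. Proof. by rewrite /phi sqrrN. Qed.

Lemma phi_mulK x : phi x * (1 + x ^+ 2) = 1.
Proof. by rewrite mulVf// gt_eqF// phi_den_gt0. Qed.

Lemma phi_continuous : continuous phi.
Proof.
move=> x; apply: cvgV; first by rewrite gt_eqF// phi_den_gt0.
by apply: cvgD; [exact: cvg_cst|exact: exprn_continuous].
Qed.

Lemma phi_ge_half x : `|x| <= 1 -> 1 <= 2 * phi x.
Proof.
move=> x1; have := phi_mulK x; have := phi_gt0 x.
have : x ^+ 2 <= 1 by rewrite -real_normK ?num_real// exprn_ile1.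
nra.
Qed.

Lemma norm_mul_phi x : 2 * (`|x| * phi x) <= 1.
Proof.
have := phi_mulK x; have := phi_gt0 x; rewrite -real_normK ?num_real//.
have := sqr_ge0 (`|x| - 1); set a := `|x|; set p := phi x; nra.
Qed.

Lemma atan_abs_le2 x : `|atan x| <= 2.
Proof.
rewrite ler_norml; have := atan_gtNpi2 x; have := atan_ltpi2 x.
have /andP[_ h] := pihalf_02 R; lra.
Qed.

Lemma atan_mvt x y : exists c, [/\ `|c - x| <= `|y| &
  atan x - atan (x - y) = y * phi c].
Proof.
have [c [cb ->]] := mean_value (x - y) x (@is_derive1_atan R).
exists c; split; last by rewrite /phi mulrC; congr (_ * _); ring.
case: cb => /andP[c1 c2].
  have y0 : 0 <= y by lra.
  by rewrite (ger0_norm y0) ler_norml; lra.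
have y0 : y <= 0 by lra.
by rewrite (ler0_norm y0) ler_norml; lra.
Qed.

(** The polynomial tail makes this possible: [1 + x^2 <= 3 (1 + c^2)] as soon as [c] is within 1 of
    [x]. *)
Lemma phi_shift x c : `|c - x| <= 1 -> phi c <= 3 * phi x.
Proof.
move=> cx; have := phi_mulK x; have := phi_mulK c; have := phi_gt0 x.
have := phi_gt0 c; set p := phi c; set q := phi x => p0 q0 pc qx.
have h : 1 + x ^+ 2 <= 3 * (1 + c ^+ 2).
  have : (c - x) ^+ 2 <= 1 by rewrite -real_normK ?num_real// exprn_ile1.
  have := sqr_ge0 (2 * c - x); nra.
have : p * (q * (1 + x ^+ 2)) <= 3 * (p * (1 + c ^+ 2)) * q.
  have -> : p * (q * (1 + x ^+ 2)) = (p * q) * (1 + x ^+ 2) by ring.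
  have -> : 3 * (p * (1 + c ^+ 2)) * q = (p * q) * (3 * (1 + c ^+ 2)) by ring.
  by rewrite ler_pM2l// mulr_gt0.
by rewrite qx pc !mulr1.
Qed.

Lemma atan_step x y : `|y| <= 1 -> `|atan x - atan (x - y)| <= 3 * phi x.
Proof.
move=> y1; have [c [cx ->]] := atan_mvt x y.
rewrite normrM (gtr0_norm (phi_gt0 c)).
apply: le_trans (phi_shift (le_trans cx y1)).
by rewrite ler_piMl// ltW// phi_gt0.
Qed.

(** The difference factors as [(x - c) (x + c) phi c phi x], and [|x + c| phi c] is bounded. The
    error thus keeps the factor [phi x], which is what lets the remainder in [atan_linear] be
    absorbed later. *)
Lemma phi_diff x c : `|c - x| <= 1 -> `|phi c - phi x| <= 2 * `|c - x| * phi x.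
Proof.
move=> cx.
have -> : phi c - phi x = (x - c) * (x + c) * phi c * phi x.
  by rewrite /phi; field; rewrite !gt_eqF// phi_den_gt0.
rewrite !normrM (gtr0_norm (phi_gt0 c)) (gtr0_norm (phi_gt0 x)) distrC.
rewrite ler_pM2r ?phi_gt0// -mulrA [leRHS]mulrC ler_wpM2l//.
have h : `|x + c| <= 2 * `|c| + `|c - x|.
  have -> : x + c = c + c - (c - x) by ring.
  rewrite (le_trans (ler_normB _ _))// lerD2r (le_trans (ler_normD _ _))//.
  by rewrite mulr_natl mulr2n.
have := norm_mul_phi c; have := phi_gt0 c; have := phi_le1 c.
set a := `|x + c| in h *; set b := `|c| in h *; set e := `|c - x| in cx h *; move=> p1 p0 bp.
have : a * phi c <= (2 * b + 1) * phi c by rewrite ler_pM2r//; lra.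
by move/le_trans; apply; lra.
Qed.

Lemma atan_linear x y : `|y| <= 1 ->
  `|atan x - atan (x - y) - y * phi x| <= 2 * y ^+ 2 * phi x.
Proof.
move=> y1; have [c [cx ->]] := atan_mvt x y.
rewrite -mulrBr normrM -real_normK ?num_real//.
have := phi_diff (le_trans cx y1); have := phi_gt0 x; have := normr_ge0 y.
move=> a0 p0 h.
have : `|y| * `|phi c - phi x| <= `|y| * (2 * `|c - x| * phi x) by rewrite ler_wpM2l.
move/le_trans; apply.
have -> : 2 * `|y| ^+ 2 * phi x = `|y| * (2 * `|y| * phi x) by ring.
by rewrite ler_wpM2l// ler_wpM2r ?(ltW p0)// ler_wpM2l.
Qed.

(** An increment longer than 1 is cut into unit steps, each costing 3 [phi] at its own starting
    point by [atan_step]. The indicators keep only the steps that actually occur, so that their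
    number stays comparable to [y]. *)
Let atan_tele_pos n x y : 0 <= y -> y <= n%:R ->
  `|atan x - atan (x - y)| <= 3 * \sum_(k < n) (k%:R <= y)%R%:R * phi (x - k%:R).
Proof.
elim: n x y => [|n ih] x y y0 yn.
  have -> : y = 0 by apply/eqP; rewrite eq_le y0 yn.
  by rewrite subr0 subrr normr0 big_ord0 mulr0.
have t0 m z w : 0 <= \sum_(k < m) (k.+1%:R <= z)%R%:R * phi (w - k.+1%:R).
  by apply: sumr_ge0 => k _; rewrite mulr_ge0// ltW// phi_gt0.
rewrite big_ord_recl/= y0 mul1r subr0.
have [y1|y1] := leP y 1.
  rewrite (le_trans (atan_step _ _)) ?ger0_norm//.
  by rewrite ler_wpM2l// lerDl; exact: t0.
have -> : atan x - atan (x - y) =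
  (atan x - atan (x - 1)) + (atan (x - 1) - atan (x - 1 - (y - 1))).
  have -> : x - 1 - (y - 1) = x - y by ring.
  by ring.
rewrite (le_trans (ler_normD _ _))// mulrDr lerD//.
  by rewrite atan_step// normr1.
apply: le_trans (ih _ _ _ _) _; [lra|by rewrite lerBlDr natr1|].
rewrite ler_wpM2l// le_eqVlt; apply/orP; left; apply/eqP; apply: eq_bigr => k _.
rewrite /bump/= add1n lerBrDr natr1; congr (_ * phi _).
by rewrite -natr1; ring.
Qed.

Lemma atan_tele n x y : `|y| <= n%:R -> `|atan x - atan (x - y)| <=
  3 * \sum_(k < n) (k%:R <= `|y|)%R%:R * (phi (x - k%:R) + phi (x + k%:R)).
Proof.
move=> yn.
have p0 (z : R) : 0 <= phi z by rewrite ltW// phi_gt0.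
have [y0|y0] := leP 0 y.
  rewrite ger0_norm// in yn *.
  apply: le_trans (atan_tele_pos _ y0 yn) _; rewrite ler_wpM2l//.
  by apply: ler_sum => k _; rewrite ler_wpM2l// lerDl.
have -> : atan x - atan (x - y) = - (atan (- x) - atan (- x - - y)).
  by rewrite -opprD !atanN; ring.
rewrite normrN ltr0_norm// in yn *.
apply: le_trans (atan_tele_pos _ _ yn) _; first by rewrite oppr_ge0 ltW.
rewrite ler_wpM2l//; apply: ler_sum => k _; rewrite ler_wpM2l//.
by rewrite -opprD phiN lerDr.
Qed.

Lemma count_le n y : 0 <= y -> \sum_(k < n) (k%:R <= y)%R%:R <= y + 1.
Proof.
move=> y0; elim: n => [|n ih]; first by rewrite big_ord0; lra.
rewrite big_ord_recr/=; case: (leP n%:R y) => [ny|_]; last by rewrite addr0.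
rewrite lerD2r (le_trans _ ny)// -[leRHS](_ : \sum_(k < n) 1 = _).
  by apply: ler_sum => k _; case: (k%:R <= y).
by rewrite sumr_const card_ord.
Qed.

(** With [k] the integer part of [|x|], one of [x - k], [x + k] lies in [-1, 1], where [phi] is at
    least 1/2. An interval is thereby dominated by kernels at integer levels. *)
Lemma indic_le_phi n x r : `|x| <= r -> r < n%:R ->
  1 <= 2 * \sum_(k < n) (k%:R <= r)%R%:R * (phi (x - k%:R) + phi (x + k%:R)).
Proof.
move=> xr rn.
have p0 (z : R) : 0 <= phi z by rewrite ltW// phi_gt0.
have /andP[k1 k2] := truncn_itv (normr_ge0 x).
set k := Num.truncn `|x| in k1 k2.
have kn : (k < n)%N by rewrite -(ltr_nat R) (le_lt_trans k1)// (le_lt_trans xr).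
rewrite (bigD1 (Ordinal kn))//= (le_trans k1 xr) mul1r.
have h : 1 <= 2 * (phi (x - k%:R) + phi (x + k%:R)).
  rewrite -natr1 in k2.
  have [x0|x0] := leP 0 x.
    rewrite ger0_norm// in k1 k2.
    have := @phi_ge_half (x - k%:R); rewrite ler_norml => /(_ _); have := p0 (x + k%:R).
    by move=> ? /(_ ltac:(lra)); lra.
  rewrite ltr0_norm// in k1 k2.
  have := @phi_ge_half (x + k%:R); rewrite ler_norml => /(_ _); have := p0 (x - k%:R).
  by move=> ? /(_ ltac:(lra)); lra.
rewrite mulrDr (le_trans h)// lerDl mulr_ge0// sumr_ge0// => j _.
by rewrite mulr_ge0// addr_ge0.
Qed.

(* The factor [a] is harmless: [phi] is evaluated at a point of size about
   [(s - a v - t) / al], so [|a| phi] is controlled by [|s| + |t|]. *)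
Lemma atan_drift (al a s t v w : R) : 0 < al -> 2^-1 <= v -> 2^-1 <= w ->
  `|al * atan ((s - a * v - t) / al) - al * atan ((s - a * w - t) / al)| <=
  `|v - w| * (2 * (`|s| + `|t|) + al).
Proof.
move=> al0 v0 w0.
have [c [cb e]] := mean_value ((s - a * w - t) / al) ((s - a * v - t) / al)
  (@is_derive1_atan R).
rewrite -mulrBr e -/(phi c).
have -> : al * (phi c * ((s - a * v - t) / al - (s - a * w - t) / al)) =
  (w - v) * (a * phi c) by field; rewrite gt_eqF.
rewrite normrM distrC ler_wpM2l// normrM (gtr0_norm (phi_gt0 c)).
pose u := al * c + t.
have cu : (s - a * w <= u <= s - a * v \/ s - a * v <= u <= s - a * w).
  by case: cb => /andP[]; rewrite ler_pdivrMr// ler_pdivlMr// => h1 h2; [left|right];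
    rewrite /u; lra.
(* [s - u] lies between [a * v] and [a * w], and both [v] and [w] are at least 1/2. *)
have au : `|a| <= 2 * `|s - u|.
  have [a0|a0] := leP 0 a.
    rewrite ger0_norm//; apply: le_trans (_ : 2 * (s - u) <= _); last first.
      by rewrite ler_pM2l// ler_norm.
    by case: cu => /andP[c1 c2]; nra.
  rewrite ltr0_norm//; apply: le_trans (_ : 2 * - (s - u) <= _); last first.
    by rewrite ler_pM2l// -normrN ler_norm.
  by case: cu => /andP[c1 c2]; nra.
have su : `|s - u| <= `|s| + `|t| + al * `|c|.
  have -> : s - u = s - t - al * c by rewrite /u; ring.
  rewrite (le_trans (ler_normB _ _))// normrM (gtr0_norm al0) lerD2r.
  exact: ler_normB.
have := norm_mul_phi c; have := phi_gt0 c; have := phi_le1 c.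
have := normr_ge0 s; have := normr_ge0 t.
set A := `|a| in au *; set Su := `|s - u| in au su *; set p := phi c.
set S := `|s| in su *; set Tt := `|t| in su *; set C := `|c| in su * => t0 s0 p1 p0 pc.
have h1 : A * p <= 2 * (S + Tt + al * C) * p by rewrite ler_pM2r//; lra.
apply: le_trans h1 _.
have -> : 2 * (S + Tt + al * C) * p = 2 * (S + Tt) * p + al * (2 * (C * p)) by ring.
by apply: lerD; [rewrite ler_piMr//; lra|rewrite ler_piMr// ltW].
Qed.

End atan_estimates.

(** * Stein's equation *)

Section stein_equation.
Context (R : realType).
Local Notation mu := (@lebesgue_measure R).
Local Notation p := (normal_pdf 0 1 : R -> R).

Lemma gauss_densE x : p x = normal_peak 1 * expR (- (x ^+ 2 / 2)).
Proof. by rewrite normal_pdfE ?oner_eq0// /normal_fun subr0 expr1n mulNr. Qed.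

Lemma normal_peak1_gt0 : 0 < (normal_peak 1 : R).
Proof. exact: normal_peak_gt0 (oner_neq0 _). Qed.

Lemma gauss_dens_gt0 x : 0 < p x.
Proof. by rewrite gauss_densE mulr_gt0 ?expR_gt0 ?normal_peak1_gt0. Qed.

Lemma normal_peak1_bounds : 3^-1 <= (normal_peak 1 : R) <= 1.
Proof.
have /andP[h1 h2] := pihalf_02 R; have hp := pi_ge2 R.
rewrite /normal_peak expr1n mul1r.
have s0 : 0 < Num.sqrt (pi *+ 2 : R) by rewrite sqrtr_gt0 mulrn_wgt0// pi_gt0.
have sq : Num.sqrt (pi *+ 2 : R) ^+ 2 = pi *+ 2 by rewrite sqr_sqrtr// mulrn_wge0// ltW// pi_gt0.
rewrite mulr2n in sq s0 *.
set s := Num.sqrt _ in sq s0 *.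
by rewrite lef_pV2 ?posrE// invf_le1//; apply/andP; split; nra.
Qed.

Lemma gauss_dens_le1 x : p x <= 1.
Proof.
rewrite (le_trans (normal_pdf_ub _ _ _)) ?oner_eq0//.
by case/andP: normal_peak1_bounds.
Qed.

Lemma gauss_dens_lb x : `|x| <= 1 -> 6^-1 <= p x.
Proof.
move=> x1; rewrite gauss_densE.
have /andP[q0 q1] := normal_peak1_bounds.
have e0 : 2^-1 <= expR (- (x ^+ 2 / 2)).
  apply: le_trans (expR_ge1Dx _).
  have : x ^+ 2 <= 1 by rewrite -real_normK ?num_real// exprn_ile1.
  lra.
nra.
Qed.

Lemma gauss_densN x : p (- x) = p x. Proof. by rewrite !gauss_densE sqrrN. Qed.

Lemma is_derive_gauss_dens (x : R) : is_derive x (1 : R) p (- (x * p x)).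
Proof.
have -> : p = (fun x => normal_peak 1 * expR (- (x ^+ 2 / 2))).
  by apply/funext => y; rewrite gauss_densE.
apply: is_derive_eq; rewrite /= !scaler1 /GRing.scale/=.
by field.
Qed.

Lemma integrable_gauss_dens : mu.-integrable setT (EFin \o p).
Proof. exact: integrable_normal_pdf. Qed.

Lemma gauss_dens_cvgy : p x @[x --> +oo] --> (0 : R).
Proof.
have : (fun x : R => 2 * x^-1) @ +oo --> (2 * 0 : R).
  apply: cvgM; first exact: cvg_cst.
  apply: (gtr0_cvgV0 (f := idfun) _).2; last exact: cvg_id.
  by near=> x; near: x; exact: nbhs_pinfty_gt.
rewrite mulr0; apply: squeeze_cvgr; [|exact: cvg_cst].
near=> x; have x0 : 0 < x by near: x; exact: nbhs_pinfty_gt.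
rewrite (ltW (gauss_dens_gt0 _))/= gauss_densE.
have /andP[q0 q1] := normal_peak1_bounds.
have e1 := expR_ge1Dx (x ^+ 2 / 2).
have e2 : expR (- (x ^+ 2 / 2)) * expR (x ^+ 2 / 2) = 1.
  by rewrite -expRD addNr expR0.
have e0 := expR_gt0 (- (x ^+ 2 / 2)).
have : expR (- (x ^+ 2 / 2)) <= 2 * x^-1.
  rewrite ler_pdivlMr//.
  set A := expR (- _) in e2 e0 *; set B := expR _ in e1 e2 *.
  have xB : x <= 2 * B by have := sqr_ge0 (x - 1); nra.
  have : A * x <= A * (2 * B) by rewrite ler_pM2l.
  lra.
have := normal_peak1_gt0; nra.
Unshelve. all: by end_near. Qed.

(** Mills' bound: on [a, +oo[ the density is at most [(x / a) p x], and [x p x] is the derivative of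
    [- p]. *)
Lemma gauss_tail (a : R) : 0 < a ->
  (\int[mu]_(x in `[a, +oo[) (p x)%:E <= (p a / a)%:E)%E.
Proof.
move=> a0.
have cp : continuous (fun x : R => x * p x).
  by move=> x; apply: cvgM; [exact: cvg_id|exact: continuous_normal_pdf (oner_neq0 _) _].
have e : (\int[mu]_(x in `[a, +oo[) (x * p x)%:E = (0 : R)%:E - (- p a)%:E)%E.
  apply: (@ge0_continuous_FTC2y R (fun x => x * p x) (fun x => - p x)).
  - by move=> x ax; rewrite mulr_ge0// ?(ltW (gauss_dens_gt0 _))//; lra.
  - exact: continuous_subspaceT.
  - by rewrite -[X in _ --> X]oppr0; apply: cvgN; exact: gauss_dens_cvgy.
  - by move=> x _; have := is_derive_gauss_dens x; move=> dx; exact: derivableN.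
  - apply: cvg_at_right_filter; apply: cvgN.
    exact: (continuous_normal_pdf (oner_neq0 _)).
  - move=> x _; have dx := is_derive_gauss_dens x.
    by rewrite derive1E derive_val opprK.
rewrite -EFinB sub0r opprK in e.
have -> : (p a / a)%:E = (\int[mu]_(x in `[a, +oo[) ((a^-1)%:E * (x * p x)%:E))%E.
  rewrite ge0_integralZl//= ?e ?lee_fin ?invr_ge0 ?(ltW a0)//.
  - by rewrite -EFinM mulrC.
  - by apply/measurable_EFinP; apply: measurable_funTS; exact: continuous_measurable_fun.
  - move=> x; rewrite in_itv/= andbT => ax.
    by rewrite lee_fin mulr_ge0 ?(ltW (gauss_dens_gt0 _))//; lra.
apply: ge0_le_integral => //.
- by move=> x _; rewrite lee_fin ltW// gauss_dens_gt0.
- by apply/measurable_EFinP; apply: measurable_funTS; exact: measurable_normal_pdf.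
- apply: measurable_funTS; apply/measurable_EFinP.
  apply: continuous_measurable_fun => x.
  by apply: cvgM; [exact: cvg_cst|exact: cp].
- move=> x; rewrite /= in_itv/= andbT => ax; rewrite -EFinM lee_fin mulrA.
  rewrite ler_peMl ?(ltW (gauss_dens_gt0 _))// mulrC ler_pdivlMr//; lra.
Qed.

Lemma gauss_tailN (a : R) : 0 < a ->
  (\int[mu]_(x in `]-oo, (- a)%R]) (p x)%:E <= (p a / a)%:E)%E.
Proof.
move=> a0; rewrite ge0_integration_by_substitutionNy.
- under eq_integral do rewrite /= gauss_densN; exact: gauss_tail.
- apply: continuous_subspaceT; exact: continuous_normal_pdf (oner_neq0 _).
- by move=> x _; rewrite ltW// gauss_dens_gt0.
Qed.

Section solution.
Variables (h : R -> R).
Hypotheses (ch : continuous h) (h01 : forall x, 0 <= h x <= 1).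

Definition gauss_mean : R := \int[mu]_x (h x * p x).

Let integrable_le (A : set R) (g : R -> R) : measurable A ->
  continuous g -> (forall x, `|g x| <= p x) -> mu.-integrable A (EFin \o g).
Proof.
move=> mA cg gp; apply: (@integrableS _ _ _ _ setT) => //.
apply: (@le_integrable _ _ _ mu setT measurableT _ (EFin \o p)) => //; last exact: integrable_gauss_dens.
  by apply/measurable_EFinP; exact: continuous_measurable_fun.
by move=> x _; rewrite /= lee_fin (le_trans (gp x))// ler_norm.
Qed.

Let cont_p : continuous p. Proof. exact: continuous_normal_pdf (oner_neq0 _). Qed.

Let Rint_p : \int[mu]_x (p x) = 1.
Proof. by rewrite /Rintegral integral_normal_pdf. Qed.

Let int_hp : mu.-integrable setT (EFin \o (fun x => h x * p x)).
Proof.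
apply: integrable_le => //.
  by move=> x; apply: cvgM; [exact: ch|exact: cont_p].
move=> x; have /andP[h0 h1] := h01 x.
by rewrite normrM (ger0_norm h0) ger0_norm ?ler_piMl// ltW// gauss_dens_gt0.
Qed.

Lemma gauss_mean_ge0 : 0 <= gauss_mean.
Proof.
apply: Rintegral_ge0 => x _; have /andP[h0 _] := h01 x.
by rewrite mulr_ge0// ltW// gauss_dens_gt0.
Qed.

Lemma gauss_mean_le1 : gauss_mean <= 1.
Proof.
rewrite -Rint_p; apply: le_Rintegral => //; first exact: integrable_gauss_dens.
move=> x _; have /andP[_ h1] := h01 x.
by rewrite ler_piMl// ltW// gauss_dens_gt0.
Qed.

Let H x := (h x - gauss_mean) * p x.

Let cont_H : continuous H.
Proof.
move=> x; apply: cvgM; last exact: cont_p.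
by apply: cvgB; [exact: ch|exact: cvg_cst].
Qed.

Let H_le x : `|H x| <= p x.
Proof.
have /andP[h0 h1] := h01 x; have c0 := gauss_mean_ge0; have c1 := gauss_mean_le1.
rewrite normrM (ger0_norm (ltW (gauss_dens_gt0 x))) ler_piMl ?(ltW (gauss_dens_gt0 _))//.
by rewrite ler_norml; lra.
Qed.

Let int_H A : measurable A -> mu.-integrable A (EFin \o H).
Proof. by move=> mA; exact: integrable_le. Qed.

Let RintH : \int[mu]_x (H x) = 0.
Proof.
transitivity (\int[mu]_x (h x * p x - gauss_mean * p x)).
  by apply: eq_Rintegral => x _; rewrite /H mulrBl.
have ip := integrable_gauss_dens.
rewrite RintegralB//; last first.
  apply: integrable_le => //.
    by move=> x; apply: cvgM; [exact: cvg_cst|exact: cont_p].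
  move=> x; rewrite normrM (ger0_norm gauss_mean_ge0).
  by rewrite (gtr0_norm (gauss_dens_gt0 x)) ler_piMl ?gauss_mean_le1// ltW// gauss_dens_gt0.
by rewrite RintegralZl// Rint_p mulr1 subrr.
Qed.

Let G w := \int[mu]_(x in `]-oo, w]) (H x).

Let is_derive_G w : is_derive w (1 : R) G (H w).
Proof.
have [] := @continuous_FTC1 R H -oo%O w (w + 1) _ _ _ _.
- by rewrite ltrDl.
- exact: int_H.
- by rewrite ltNyr.
- exact: cont_H.
move=> dG G'; split; first exact: dG.
by rewrite -derive1E.
Qed.

Let norm_Rint_H A : measurable A ->
  (`|\int[mu]_(x in A) (H x)|%:E <= \int[mu]_(x in A) (p x)%:E)%E.
Proof.
move=> mA; rewrite EFin_normr_Rintegral//; last exact: int_H.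
apply: le_trans (le_abse_integral _ _ _) _ => //.
  by apply/measurable_EFinP/measurable_funTS; exact: continuous_measurable_fun.
apply: ge0_le_integral => //.
- apply: measurableT_comp => //; apply/measurable_EFinP/measurable_funTS.
  exact: continuous_measurable_fun.
- by apply/measurable_EFinP/measurable_funTS; exact: continuous_measurable_fun.
- by move=> x _; rewrite /= lee_fin.
Qed.

(** The integral of [H] over the line vanishes because [gauss_mean] is subtracted; for positive [w]
    the right tail can therefore be used in place of the left one. *)
Let G_opp w : G w = - \int[mu]_(x in `]w, +oo[) (H x).
Proof.
have U : `]-oo, w] `|` `]w, +oo[ = [set: R].
  apply/seteqP; split => // x _ /=; rewrite !in_itv/= andbT.
  by have [] := leP x w; [left|right].
apply/eqP; rewrite -addr_eq0 -Rintegral_setU// ?U ?RintH//.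
- exact: int_H.
- rewrite disj_set2E; apply/eqP; rewrite -subset0 => x [] /=.
  by rewrite !in_itv/= andbT => /le_lt_trans/[apply]; rewrite ltxx.
Qed.

Let G_le1 w : `|G w| <= 1.
Proof.
rewrite -lee_fin (le_trans (norm_Rint_H _))//.
rewrite -(@integral_normal_pdf R 0 1); apply: ge0_subset_integral => //.
  by apply/measurable_EFinP; exact: continuous_measurable_fun.
by move=> x _; rewrite lee_fin ltW// gauss_dens_gt0.
Qed.

Let G_tail w : `|w| * `|G w| <= p w.
Proof.
have [w0|w0|->] := ltgtP w 0; last by rewrite normr0 mul0r ltW// gauss_dens_gt0.
- rewrite (ltr0_norm w0) mulrC -ler_pdivlMr ?oppr_gt0// -gauss_densN.
  rewrite -lee_fin (le_trans (norm_Rint_H _))//.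
  have := @gauss_tailN (- w); rewrite oppr_gt0 opprK; exact.
- rewrite (gtr0_norm w0) mulrC -ler_pdivlMr//.
  rewrite -lee_fin G_opp normrN (le_trans (norm_Rint_H _))//.
  apply: le_trans (gauss_tail w0).
  apply: ge0_subset_integral => //.
  + by apply/measurable_EFinP/measurable_funTS; exact: continuous_measurable_fun.
  + by move=> x _; rewrite lee_fin ltW// gauss_dens_gt0.
  + by apply: subset_itv; rewrite ?bnd_simp.
Qed.

(** The solution is the classical [G w / p w], with [G] the integral of [(h - gauss_mean) p] up to
    [w]. The bound on [w f w] is Mills' bound. The bound 6 on [f] follows from it outside [-1, 1],
    and inside from [p >= 1/6] and [|G| <= 1]. *)
Lemma stein_solution : exists f : R -> R,
  [/\ forall w, is_derive w (1 : R) f (w * f w + (h w - gauss_mean)),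
      forall w, `|f w| <= 6 & forall w, `|w * f w| <= 1].
Proof.
exists (fun w => G w / p w).
have p0 w := gauss_dens_gt0 w.
have wf w : `|w * (G w / p w)| <= 1.
  rewrite !normrM normfV (gtr0_norm (p0 w)) mulrA ler_pdivrMr// mul1r.
  exact: G_tail.
split => //.
- move=> w; have dG := is_derive_G w; have dp := is_derive_gauss_dens w.
  have dV : is_derive w (1 : R) (fun x => (p x)^-1) (- (p w) ^- 2 *: (- (w * p w))).
    by apply: is_deriveV; rewrite gt_eqF.
  apply: is_derive_eq; rewrite /GRing.scale/= /H; field.
  by rewrite gt_eqF.
- move=> w; have [w1|w1] := leP `|w| 1.
    rewrite normrM normfV (gtr0_norm (p0 w)) ler_pdivrMr//.
    have := gauss_dens_lb w1; have := G_le1 w; lra.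
  have := wf w; rewrite normrM.
  have := normr_ge0 (G w / p w); nra.
Qed.

End solution.

End stein_equation.

(** * Normal distribution function and ramps *)

Section normal_cdf.
Context (R : realType).
Local Notation mu := (@lebesgue_measure R).
Local Notation p := (normal_pdf 0 1 : R -> R).

Definition Phi (z : R) : R := \int[mu]_(x in `]-oo, z]) p x.

Let int_p (A : set R) : measurable A -> mu.-integrable A (EFin \o p).
Proof. by move=> mA; apply: integrableS (integrable_gauss_dens R). Qed.

Lemma std_normal_cdfE z : std_normal_cdf z = (Phi z)%:E.
Proof.
rewrite /std_normal_cdf /normal_prob /Phi /Rintegral fineK//.
by apply: integrable_fin_num => //; exact: int_p.
Qed.

Lemma is_derive_Phi (z : R) : is_derive z (1 : R) Phi (p z).
Proof.
have [] := @continuous_FTC1 R p -oo%O z (z + 1) _ _ _ _.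
- by rewrite ltrDl.
- exact: int_p.
- by rewrite ltNyr.
- exact: (continuous_normal_pdf (oner_neq0 _)).
move=> dG G'; split; first exact: dG.
by rewrite -derive1E.
Qed.

Lemma Phi_lip a b : `|Phi b - Phi a| <= `|b - a|.
Proof.
have [c [_ ->]] := mean_value a b is_derive_Phi.
rewrite normrM (gtr0_norm (gauss_dens_gt0 c)).
by rewrite ler_piMl// gauss_dens_le1.
Qed.

Lemma norm_mul_gauss_dens c : `|c| * p c <= 1.
Proof.
rewrite gauss_densE.
have /andP[q0 q1] := normal_peak1_bounds R.
have e1 := expR_ge1Dx (c ^+ 2 / 2).
have e2 : expR (- (c ^+ 2 / 2)) * expR (c ^+ 2 / 2) = 1.
  by rewrite -expRD addNr expR0.
have e0 := expR_gt0 (- (c ^+ 2 / 2)).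
rewrite -real_normK ?num_real// in e1 e2 e0 *.
set C := `|c| in e0 e1 e2 *; have C0 : 0 <= C by exact: normr_ge0.
set A := expR (- _) in e2 e0 *; set B := expR _ in e1 e2 *.
have CB : C <= B by have := sqr_ge0 (C - 1); nra.
have CA : A * C <= A * B by rewrite ler_pM2l.
have p0 := normal_peak1_gt0 R; nra.
Qed.

(** A relative change of [z] costs the same for all [z]: the intermediate point [c] satisfies
    [|z| <= 2 |c|], and [|c| p c <= 1]. This is the form in which an error on the normaliser reaches
    [Phi]. *)
Lemma Phi_scale (z s : R) : `|s| <= 2^-1 -> `|Phi (z * (1 + s)) - Phi z| <= 2 * `|s|.
Proof.
move=> s1; have [c [cb ->]] := mean_value z (z * (1 + s)) is_derive_Phi.
have -> : z * (1 + s) - z = z * s by ring.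
rewrite !normrM mulrA ler_wpM2r// (gtr0_norm (gauss_dens_gt0 c)).
have zc : `|z| <= 2 * `|c|.
  move: s1; rewrite ler_norml => /andP[s1 s2].
  have [z0|z0] := leP 0 z.
    have : z <= 2 * c by case: cb => /andP[c1 c2]; nra.
    by rewrite ger0_norm// => /le_trans; apply; rewrite ler_pM2l// ler_norm.
  have : - z <= 2 * - c by case: cb => /andP[c1 c2]; nra.
  by rewrite ltr0_norm// => /le_trans; apply; rewrite ler_pM2l// -normrN ler_norm.
have := norm_mul_gauss_dens c; have := gauss_dens_gt0 c; nra.
Qed.

(** The value [u = (z + al - w) / al] clipped to [0, 1]: 1 up to [z], 0 from [z + al] on, affine in
    between. Writing the clipping with absolute values makes continuity immediate. *)
Definition ramp (z al w : R) : R :=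
  (`|(z + al - w) / al| - `|(z + al - w) / al - 1| + 1) / 2.

Section ramp_properties.
Variables (z al : R).
Hypothesis al0 : 0 < al.

Lemma ramp_continuous : continuous (ramp z al).
Proof.
have cu : continuous (fun w : R => (z + al - w) / al).
  move=> w; apply: cvgM; last exact: cvg_cst.
  by apply: cvgB; [exact: cvg_cst|exact: cvg_id].
move=> w; apply: cvgM; last exact: cvg_cst.
apply: cvgD; last exact: cvg_cst.
apply: cvgB; apply: cvg_norm; first exact: cu.
by apply: cvgB; [exact: cu|exact: cvg_cst].
Qed.

Lemma ramp_itv w : 0 <= ramp z al w <= 1.
Proof.
rewrite /ramp; set u := _ / al.
by case: (ger0P u) => ?; case: (ger0P (u - 1)) => ?; lra.
Qed.

Lemma ramp_one w : w <= z -> ramp z al w = 1.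
Proof.
move=> wz; rewrite /ramp; set u := _ / al.
have u1 : 1 <= u by rewrite ler_pdivlMr//; lra.
by rewrite !ger0_norm; lra.
Qed.

Lemma ramp_zero w : z + al <= w -> ramp z al w = 0.
Proof.
move=> wz; rewrite /ramp; set u := _ / al.
have u1 : u <= 0 by rewrite ler_pdivrMr//; lra.
by rewrite !ler0_norm; lra.
Qed.

Let int_rp (A : set R) : measurable A -> mu.-integrable A (EFin \o (fun x => ramp z al x * p x)).
Proof.
move=> mA; apply: (@integrableS _ _ _ _ setT) => //.
apply: (@le_integrable _ _ _ mu setT measurableT _ (EFin \o p)) => //.
- apply/measurable_EFinP; apply: continuous_measurable_fun => x.
  by apply: cvgM; [exact: ramp_continuous|exact: (continuous_normal_pdf (oner_neq0 _))].
- move=> x _; have /andP[h0 h1] := ramp_itv x.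
  rewrite /= lee_fin normrM (ger0_norm h0).
  by rewrite ler_piMl.
- exact: int_p.
Qed.

Let mean_split (a : R) : gauss_mean (ramp z al) =
  \int[mu]_(x in `]-oo, a]) (ramp z al x * p x) +
  \int[mu]_(x in `]a, +oo[) (ramp z al x * p x).
Proof.
have U : `]-oo, a] `|` `]a, +oo[ = [set: R].
  apply/seteqP; split => // x _ /=; rewrite !in_itv/= andbT.
  by have [] := leP x a; [left|right].
rewrite -Rintegral_setU// ?U//; first exact: int_rp.
rewrite disj_set2E; apply/eqP; rewrite -subset0 => x [] /=.
by rewrite !in_itv/= andbT => /le_lt_trans/[apply]; rewrite ltxx.
Qed.

Lemma gauss_mean_ramp : Phi z <= gauss_mean (ramp z al) <= Phi z + al.
Proof.
apply/andP; split.
  rewrite (mean_split z) -[leLHS]addr0; apply: lerD.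
    rewrite le_eqVlt; apply/orP; left; apply/eqP; apply: eq_Rintegral => x.
    by rewrite inE/= in_itv/= => xz; rewrite ramp_one// mul1r.
  apply: Rintegral_ge0 => x _; have /andP[h0 _] := ramp_itv x.
  by rewrite mulr_ge0// ltW// gauss_dens_gt0.
have : gauss_mean (ramp z al) <= Phi (z + al).
  rewrite (mean_split (z + al)) -[leRHS]addr0; apply: lerD.
    apply: le_Rintegral => //; [exact: int_rp|exact: int_p|].
    move=> x _; have /andP[_ h1] := ramp_itv x.
    by rewrite ler_piMl// ltW// gauss_dens_gt0.
  rewrite le_eqVlt; apply/orP; left; apply/eqP.
  rewrite -[RHS](mul0r (fine (mu `]z + al, +oo[))) -Rintegral_cst//.
  apply: eq_Rintegral => x.
  by rewrite inE/= in_itv/= andbT => /ltW xz; rewrite ramp_zero// mul0r.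
have := Phi_lip z (z + al); have -> : z + al - z = al by ring.
rewrite (gtr0_norm al0).
have := ler_norm (Phi (z + al) - Phi z); lra.
Qed.

End ramp_properties.

End normal_cdf.

(** * Clamped square root *)

Section normaliser.
Context (R : realType).
Implicit Types u v : R.

(** The projection onto [1/4, 4], again written with absolute values. *)
Definition clamp u : R := (`|u - 4^-1| - `|u - 4| + 17 / 4) / 2.

Lemma clamp_itv u : 4^-1 <= clamp u <= 4.
Proof.
by rewrite /clamp; case: (ger0P (u - 4^-1)) => ?; case: (ger0P (u - 4)) => ?; lra.
Qed.

Lemma clamp_id u : 4^-1 <= u <= 4 -> clamp u = u.
Proof.
by rewrite /clamp; case: (ger0P (u - 4^-1)) => ?; case: (ger0P (u - 4)) => ?; lra.
Qed.

Lemma clamp_lip u v : `|clamp u - clamp v| <= `|u - v|.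
Proof.
rewrite /clamp ler_norml; case: (ger0P (u - 4^-1)) => ?; case: (ger0P (u - 4)) => ?;
case: (ger0P (v - 4^-1)) => ?; case: (ger0P (v - 4)) => ?; case: (ger0P (u - v)) => ?; lra.
Qed.

Lemma clamp_continuous : continuous clamp.
Proof.
move=> u; apply: cvgM; last exact: cvg_cst.
apply: cvgD; last exact: cvg_cst.
by apply: cvgB; apply: cvg_norm; apply: cvgB; [exact: cvg_id|exact: cvg_cst|
  exact: cvg_id|exact: cvg_cst].
Qed.

(** Outside [1/4, 4] the point [u] is at distance at least 1/2 from [e], so
    [|u - clamp u| <= |u - e| <= 2 (u - e)^2]. With [e] the mean of [u], clamping costs no more than
    a variance. *)
Lemma clamp_dist_sq u (e : R) : `|e - 1| <= 4^-1 ->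
  `|u - clamp u| <= 2 * (u - e) ^+ 2.
Proof.
rewrite ler_norml => /andP[e1 e2].
have [ul|ul] := leP 4^-1 u; last first.
  have -> : clamp u = 4^-1.
    by rewrite /clamp !ler0_norm; lra.
  by rewrite ler0_norm; [nra|lra].
have [ur|ur] := leP u 4.
  by rewrite clamp_id ?ul// subrr normr0 mulr_ge0// sqr_ge0.
have -> : clamp u = 4.
  by rewrite /clamp !ger0_norm; lra.
by rewrite ger0_norm; [nra|lra].
Qed.

Definition psi u : R := Num.sqrt (clamp u).

Lemma psi_sqr u : psi u ^+ 2 = clamp u.
Proof. by rewrite sqr_sqrtr//; have /andP[h _] := clamp_itv u; lra. Qed.

Lemma psi_itv u : 2^-1 <= psi u <= 2.
Proof.
have /andP[h1 h2] := clamp_itv u; have := psi_sqr u.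
have : 0 <= psi u by exact: sqrtr_ge0.
set s := psi u => s0 e; apply/andP; split.
  by rewrite leNgt; apply/negP => s1; nra.
by rewrite leNgt; apply/negP => s1; nra.
Qed.

(** The lower clamp 1/4 makes [psi u + psi v >= 1], so differences of [psi] are at most those of its
    square. *)
Lemma psi_lip u v : `|psi u - psi v| <= `|u - v|.
Proof.
apply: le_trans (clamp_lip u v); rewrite -!psi_sqr.
have /andP[a1 _] := psi_itv u; have /andP[b1 _] := psi_itv v.
rewrite subr_sqr normrM ler_peMr// ger0_norm; lra.
Qed.

Lemma psi_continuous : continuous psi.
Proof.
by move=> u; apply: (@continuous_comp _ _ _ clamp); [exact: clamp_continuous|exact: sqrt_continuous].
Qed.

Lemma invpsi_continuous : continuous (fun u => (psi u)^-1).
Proof.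
move=> u; apply: cvgV; last exact: psi_continuous.
by have /andP[h _] := psi_itv u; rewrite gt_eqF//; lra.
Qed.

Lemma psi_norm_le u : `|psi u| <= 2.
Proof. by have /andP[h h'] := psi_itv u; rewrite ger0_norm; lra. Qed.

Lemma invpsi_norm_le u : `|(psi u)^-1| <= 2.
Proof.
have /andP[h h'] := psi_itv u; have p0 : 0 < psi u by lra.
rewrite gtr0_norm ?invr_gt0// -[leRHS]invrK lef_pV2//.
by rewrite posrE invr_gt0.
Qed.

End normaliser.

Section bounded_functions.
Context d (T : measurableType d) (R : realType).
Implicit Types f : T -> R.

Lemma mb_phi f : bmeas f -> bmeas (fun t => phi (f t)).
Proof.
apply: (@mb_comp _ _ _ (@phi R) 1); first exact: phi_continuous.
by move=> x; rewrite gtr0_norm ?phi_gt0 ?phi_le1.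
Qed.

Lemma mb_atan f : bmeas f -> bmeas (fun t => atan (f t)).
Proof. by apply: (@mb_comp _ _ _ (@atan R) 2); [exact: continuous_atan|exact: atan_abs_le2]. Qed.

Lemma mb_psi f : bmeas f -> bmeas (fun t => psi (f t)).
Proof. by apply: (@mb_comp _ _ _ (@psi R) 2); [exact: psi_continuous|exact: psi_norm_le]. Qed.

Lemma mb_invpsi f : bmeas f -> bmeas (fun t => (psi (f t))^-1).
Proof.
by apply: (@mb_comp _ _ _ (fun u => (psi u)^-1) 2); [exact: invpsi_continuous|exact: invpsi_norm_le].
Qed.

End bounded_functions.

(* The infimum of the admissible [M] is again admissible. *)
Lemma weighted_fixpoint (R : realType) (q : R -> R) (c M0 : R) : 0 <= c -> 0 <= M0 ->
  (forall t, q t <= M0 * (1 + `|t|)) ->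
  (forall M, 0 <= M -> (forall t, q t <= M * (1 + `|t|)) ->
     forall t, q t <= (c + M / 2) * (1 + `|t|)) ->
  forall t, q t <= 2 * c * (1 + `|t|).
Proof.
move=> c0 M00 q0 step.
have w0 (t : R) : 0 < 1 + `|t| by rewrite ltr_pwDl.
pose A := [set M : R | 0 <= M /\ forall t, q t <= M * (1 + `|t|)].
have lA : has_inf A by split; [exists M0|exists 0 => M []].
have iA : forall t, q t <= inf A * (1 + `|t|).
  move=> t; rewrite -ler_pdivrMr//; apply: lb_le_inf; first by exists M0.
  by move=> M [_ h]; rewrite ler_pdivrMr.
have i0 : 0 <= inf A by apply: lb_le_inf; [exists M0|move=> M []].
have : inf A <= c + inf A / 2.
  apply: ge_inf; first by exists 0 => M [].
  split; first by rewrite addr_ge0// divr_ge0.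
  exact: step.
move=> h t; apply: le_trans (iA t) _; rewrite ler_wpM2r ?(ltW (w0 t))//; lra.
Qed.

Ltac mbt := lazymatch goal with
  | |- forall _, _ => let x := fresh in intro x; mbt
  | |- bmeas (fun t => @?a t + @?b t) => apply: (@mbD _ _ _ a b); mbt
  | |- bmeas (fun t => - @?a t) => apply: (@mbN _ _ _ a); mbt
  | |- bmeas (fun t => @?a t * @?b t) => apply: (@mbM _ _ _ a b); mbt
  | |- bmeas (fun t => `|@?a t|) => apply: (@mb_norm _ _ _ a); mbt
  | |- bmeas (fun t => @?a t ^+ ?n) => apply: (@mbX _ _ _ a n); mbt
  | |- bmeas (fun t => (nat_of_bool _)%:R) => apply: mb_le; mbt
  | |- bmeas (fun t => \sum_(j <- ?s | @?p j) _) => apply: mb_sum; mbt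
  | |- bmeas (fun t => phi (@?a t)) => apply: (@mb_phi _ _ _ a); mbt
  | |- bmeas (fun t => atan (@?a t)) => apply: (@mb_atan _ _ _ a); mbt
  | |- bmeas (fun t => psi (@?a t)) => apply: (@mb_psi _ _ _ a); mbt
  | |- bmeas (fun t => (psi (@?a t))^-1) => apply: (@mb_invpsi _ _ _ a); mbt
  | |- _ => cbv beta; first [exact: mb_cst | assumption | solve [auto with bmeas]]
  end.

(** * Locally dependent truncated fields *)

Section local_dependence.
Context d (T : measurableType d) (R : realType) (P : probability T R).
Context (I : finType) (X : I -> {RV P >-> R}) (dist : I -> I -> nat) (m : nat).
Hypothesis dist_refl : forall i, dist i i = 0%N.
Hypothesis dist_sym : forall i j, dist i j = dist j i.
Hypothesis dist_tri : forall i j k, (dist i k <= dist i j + dist j k)%N.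
Hypothesis Hind : forall A B : {set I},
  (forall i j, i \in A -> j \in B -> (m < dist i j)%N) ->
  independent_families X [set i | i \in A] [set i | i \in B].

Local Notation E := (Ex P).

(** Radii are counted in units of [m]: [nb 1 i] is the set A_i, and functions of [nb r i] are
    independent of functions of the complement of [nb r.+1 i]. *)
Definition nb (r : nat) (i : I) : {set I} := [set j | (dist i j <= r * m)%N]%SET.

Lemma nb_sub r s i j : (r * m + dist i j <= s * m)%N -> nb r i \subset nb s j.
Proof.
move=> h; apply/fintype.subsetP => k; rewrite !inE => ik.
apply: leq_trans h; apply: leq_trans (dist_tri _ i _) _.
by rewrite addnC (dist_sym j) leq_add2r.
Qed.

Lemma nbS r s i : (r <= s)%N -> nb r i \subset nb s i.
Proof. by move=> rs; apply: nb_sub; rewrite dist_refl addn0 leq_mul2r rs orbT. Qed.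

Lemma nb_self r i : i \in nb r i. Proof. by rewrite inE dist_refl. Qed.

Lemma nb_sym r i j : (i \in nb r j) = (j \in nb r i).
Proof. by rewrite !inE dist_sym. Qed.

Lemma far_nb r s i j : ((r + s + 1) * m < dist i j)%N ->
  forall a b, a \in nb r i -> b \in nb s j -> (m < dist a b)%N.
Proof.
move=> h a b; rewrite !inE => ia jb; rewrite ltnNge; apply/negP => ab.
move: h; apply/negP; rewrite -leqNgt.
apply: leq_trans (dist_tri _ a _) _; rewrite !mulnDl mul1n -addnA leq_add//.
by apply: leq_trans (dist_tri _ b _) _; rewrite addnC leq_add// dist_sym.
Qed.

Lemma far_nbC r i : forall a b, a \in nb r i -> b \in (~: nb r.+1 i)%SET -> (m < dist a b)%N.
Proof.
move=> a b; rewrite !inE -ltnNge => ia ib; rewrite ltnNge; apply/negP => ab.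
move: ib; apply/negP; rewrite -leqNgt (leq_trans (dist_tri _ a _))//.
by rewrite mulSn addnC leq_add.
Qed.

Lemma Ex_far (A B : {set I}) f g :
  (forall i j, i \in A -> j \in B -> (m < dist i j)%N) ->
  dep X A f -> dep X B g -> E (fun t => f t * g t) = E f * E g.
Proof. by move=> AB; apply: Ex_dep; exact: Hind. Qed.

Variables (xi : I -> T -> R) (K be : R).
Hypothesis dxi : forall i, dep X [set i]%SET (xi i).
Hypothesis K1 : 1 <= K.
Hypothesis cardK : forall i, #|nb 4 i|%:R <= K.
Hypothesis xi_le : forall i t, `|xi i t| <= (4 * K)^-1.

Lemma dep_xi (A : {set I}) i : i \in A -> dep X A (xi i).
Proof. by move=> iA; apply: (depS _ (dxi i)); rewrite finset.sub1set. Qed.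

Lemma card_nb r i : (r <= 4)%N -> #|nb r i|%:R <= K.
Proof.
by move=> r4; apply: le_trans (cardK i); rewrite ler_nat subset_leq_card// nbS.
Qed.

(** Double counting: by symmetry of the distance an index lies in at most [K] of the balls. *)
Lemma sum_nb_exchange r (p : pred I) (a : I -> R) : (r <= 4)%N ->
  (forall i, 0 <= a i) ->
  \sum_(i | p i) \sum_(k in nb r i | p k) a k <= K * \sum_(i | p i) a i.
Proof.
move=> r4 a0; rewrite (exchange_big_dep p)/=; last by move=> i k _ /andP[].
rewrite mulr_sumr; apply: ler_sum => k pk.
rewrite sumr_const -mulr_natl ler_wpM2r//.
apply: le_trans (card_nb k r4); rewrite ler_nat subset_leq_card//.
apply/fintype.subsetP => i; rewrite !inE/= => /andP[_ /andP[+ _]].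
by rewrite inE dist_sym.
Qed.

(* With [G] the whole index set these are S, sum_i X_i Y_i, Y_j and a bound for |Y_j| of
   the truncated field; restricting [G] makes them independent of a neighbourhood. *)
Definition Sg (G : {set I}) (t : T) : R := \sum_(j in G) xi j t.
Definition Ug (G : {set I}) (t : T) : R :=
  \sum_(j in G) \sum_(l in nb 1 j | l \in G) xi j t * xi l t.
Definition Yg (j : I) (t : T) : R := Sg (nb 1 j) t.
Definition Bg (j : I) (t : T) : R := \sum_(k in nb 2 j) `|xi k t|.

Lemma dep_Sg (A G : {set I}) : G \subset A -> dep X A (Sg G).
Proof.
move=> GA; apply: dep_sum => j jG; apply: dep_xi; exact: (fintype.subsetP GA).
Qed.

Lemma dep_Ug (A G : {set I}) : G \subset A -> dep X A (Ug G).
Proof.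
move=> /fintype.subsetP GA; apply: dep_sum => j jG; apply: dep_sum => l /andP[_ lG].
by apply: depM; apply: dep_xi; exact: GA.
Qed.

Lemma dep_Yg (A : {set I}) j : nb 1 j \subset A -> dep X A (Yg j).
Proof. exact: dep_Sg. Qed.

Lemma dep_Bg (A : {set I}) j : nb 2 j \subset A -> dep X A (Bg j).
Proof.
move=> /fintype.subsetP jA; apply: dep_sum => k kj; apply: dep_norm.
by apply: dep_xi; exact: jA.
Qed.

Let K0 : 0 < K. Proof. exact: lt_le_trans K1. Qed.

Lemma Bg_ge0 j t : 0 <= Bg j t. Proof. exact: sumr_ge0. Qed.

Lemma sum_abs_le (A : {set I}) t : #|A|%:R <= K -> \sum_(k in A) `|xi k t| <= 4^-1.
Proof.
move=> AK; apply: (@le_trans _ _ (\sum_(k in A) (4 * K)^-1)).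
  by apply: ler_sum => k _; exact: xi_le.
rewrite sumr_const -[leLHS]mulr_natl ler_pdivrMr ?mulr_gt0//.
by rewrite mulrA mulVf ?pnatr_eq0// mul1r.
Qed.

Lemma Bg_le j t : Bg j t <= 4^-1.
Proof. by apply: sum_abs_le; exact: card_nb. Qed.

Lemma Yg_le_Bg j t : `|Yg j t| <= Bg j t.
Proof.
apply: le_trans (ler_norm_sum _ _ _) _.
rewrite /Bg [leRHS](bigID (mem (nb 1 j)))/= -[leLHS]addr0; apply: lerD; last exact: sumr_ge0.
rewrite le_eqVlt; apply/orP; left; apply/eqP; apply: eq_bigl => k.
by apply/idP/andP => [kj|[]//]; split => //; exact: (fintype.subsetP (nbS j (isT : 1 <= 2)%N)).
Qed.

Lemma Sg_split (A : {set I}) t : Sg [set: I]%SET t = Sg A t + Sg (~: A)%SET t.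
Proof.
rewrite /Sg (bigID (mem A))/=; congr (_ + _); apply: eq_bigl => j; by rewrite !inE.
Qed.

Lemma Sg_near (A : {set I}) t : #|A|%:R <= K ->
  `|Sg [set: I]%SET t - Sg (~: A)%SET t| <= 4^-1.
Proof.
move=> AK; rewrite (Sg_split A) addrK (le_trans (ler_norm_sum _ _ _))//.
exact: sum_abs_le.
Qed.

(** A product lost by removing [nb 1 j] has one factor in [nb 1 j] and the other within [m] of it,
    so both indices lie in [nb 2 j]; all products over [nb 2 j] sum to at most [Bg j t ^+ 2] in
    absolute value. *)
Lemma Ug_near j t :
  `|Ug [set: I]%SET t - Ug (~: nb 1 j)%SET t| <= 2 * Bg j t ^+ 2.
Proof.
pose a i := `|xi i t|.
have a0 i : 0 <= a i by exact: normr_ge0.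
pose c := nb 1 j.
have -> : Ug [set: I]%SET t - Ug (~: nb 1 j)%SET t =
  \sum_i \sum_(l in nb 1 i) (((i \in c) || (l \in c))%:R * (xi i t * xi l t)).
  rewrite /Ug; apply/eqP; rewrite subr_eq; apply/eqP.
  under eq_bigl do rewrite finset.in_setT.
  rewrite [X in _ = _ + X]big_mkcond/= -big_split/=; apply: eq_bigr => i _.
  under eq_bigl do rewrite finset.in_setT andbT.
  have [ic|ic] := boolP (i \in ~: c)%SET.
    rewrite [X in _ = _ + X]big_mkcondr/= -big_split/=; apply: eq_bigr => l _.
    by move: ic; rewrite !inE => /negbTE ->/=; case: (_ <= _)%N; rewrite ?mul1r ?mul0r ?addr0 ?add0r.
  rewrite addr0; apply: eq_bigr => l _.
  by move: ic; rewrite !inE negbK => ->; rewrite mul1r.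
have key : \sum_(i in nb 2 j) \sum_(l in nb 2 j) a i * a l = Bg j t ^+ 2.
  rewrite /Bg expr2 mulr_suml; apply: eq_bigr => i _; by rewrite mulr_sumr.
have inc (i l : I) : l \in nb 1 i -> i \in nb 1 j -> (i \in nb 2 j) && (l \in nb 2 j).
  rewrite !inE mul1n => il ji; apply/andP; split.
    by rewrite (leq_trans ji)// mulSn mul1n leq_addr.
  by rewrite (leq_trans (dist_tri _ i _))// mulSn mul1n leq_add.
apply: (@le_trans _ _ (\sum_i \sum_l (((i \in nb 2 j) && (l \in nb 2 j))%:R * (a i * a l) *+ 2))).
  apply: le_trans (ler_norm_sum _ _ _) _; apply: ler_sum => i _.
  rewrite big_mkcond/=; apply: le_trans (ler_norm_sum _ _ _) _; apply: ler_sum => l _.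
  have aa0 : 0 <= a i * a l by rewrite mulr_ge0.
  have r0 : 0 <= ((i \in nb 2 j) && (l \in nb 2 j))%:R * (a i * a l) *+ 2.
    by rewrite mulrn_wge0// mulr_ge0.
  case: (boolP (l \in nb 1 i)) => li; last by rewrite normr0.
  case: (boolP ((i \in c) || (l \in c))) => ilc; last by rewrite mul0r normr0.
  have -> : (i \in nb 2 j) && (l \in nb 2 j).
    case/orP: ilc => hc; first exact: inc.
    by rewrite andbC; apply: inc => //; rewrite nb_sym.
  by rewrite !mul1r normrM mulr2n lerDl.
rewrite -key le_eqVlt; apply/orP; left; apply/eqP.
rewrite [in RHS]big_mkcond/= mulr_sumr; apply: eq_bigr => i _.
case: (boolP (i \in nb 2 j)) => ij; last first.
  by rewrite big1 ?mulr0// => l _; rewrite mul0r mul0rn.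
rewrite [in RHS]big_mkcond/= mulr_sumr; apply: eq_bigr => l _.
by case: (l \in nb 2 j); rewrite /= ?mul1r ?mul0r ?mul0rn ?mulr0// mulr_natl.
Qed.

Lemma Ug_Yg t : Ug [set: I]%SET t = \sum_i xi i t * Yg i t.
Proof.
rewrite /Ug; under eq_bigl do rewrite finset.in_setT.
apply: eq_bigr => i _; under eq_bigl do rewrite finset.in_setT andbT.
by rewrite mulr_sumr.
Qed.

Lemma Sg_Yg i t : Sg [set: I]%SET t - Yg i t = Sg (~: nb 1 i)%SET t.
Proof. by rewrite (Sg_split (nb 1 i)) addrC addKr. Qed.

Lemma Ex_centered f : bmeas f -> E (fun t => f t - E f) = 0.
Proof. by move=> mf; rewrite ExB ?Ex_cst ?subrr//; exact: mb_cst. Qed.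

Lemma Ex_centered_sqr_le f : bmeas f ->
  E (fun t => (f t - E f) ^+ 2) <= E (fun t => f t ^+ 2).
Proof.
move=> mf; have -> : E (fun t => (f t - E f) ^+ 2) =
    E (fun t => f t ^+ 2) - 2 * E f * E f + E f ^+ 2.
  rewrite -[in RHS]ExZ// -ExB; [|exact: mbX|by apply: mbM => //; exact: mb_cst].
  rewrite -[in X in _ = _ + X](Ex_cst P (E f ^+ 2)) -ExD; first last.
  - exact: mb_cst.
  - by apply: mbB; [exact: mbX|apply: mbM => //; exact: mb_cst].
  by apply: eq_Ex => t; ring.
by have := sqr_ge0 (E f); nra.
Qed.

Let K0' : 0 < K. Proof. exact: lt_le_trans K1. Qed.

(** * Variance and decoupling under a local weight *)

Section weighted.
Variables (D G : {set I}) (zeta : T -> R) (n : I -> T -> R).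
Hypothesis DG : forall j a b, j \in G -> a \in nb 1 j -> b \in D -> (m < dist a b)%N.
Hypothesis dz : dep X D zeta.
Hypothesis z0 : forall t, 0 <= zeta t.
Hypothesis dn : forall j, dep X (nb 1 j) (n j).

(** If [k] is outside [nb 3 j], the centred [n j] is independent of the pair ([zeta], [n k]) and the
    covariance vanishes. Near pairs are split into squares, from which [zeta] factors out because it
    is independent of each single term; there are at most [K] near pairs per index. *)
Lemma weighted_variance :
  E (fun t => zeta t * (\sum_(j in G) (n j t - E (n j))) ^+ 2) <=
  E zeta * (K * \sum_(j in G) E (fun t => n j t ^+ 2)).
Proof.
have mz := dep_mb dz.
have mn j := dep_mb (dn j).
pose c j t := n j t - E (n j).
have dc j : dep X (nb 1 j) (c j) by apply: depD => //; exact: dep_cst.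
have mc j := dep_mb (dc j).
have c2 j : E (fun t => c j t ^+ 2) <= E (fun t => n j t ^+ 2).
  exact: Ex_centered_sqr_le.
have zc j : j \in G -> E (fun t => zeta t * c j t ^+ 2) = E zeta * E (fun t => c j t ^+ 2).
  move=> jG; apply: (@Ex_far D (nb 1 j)) => //; last exact: depX.
  by move=> a b aD bj; rewrite dist_sym; exact: (DG jG).
have cov j k : j \in G -> k \in G -> E (fun t => zeta t * (c j t * c k t)) <=
    if k \in nb 3 j then E zeta * (2^-1 * (E (fun t => c j t ^+ 2) + E (fun t => c k t ^+ 2)))
    else 0.
  move=> jG kG; case: ifPn => jk.
    have -> : E zeta * (2^-1 * (E (fun t => c j t ^+ 2) + E (fun t => c k t ^+ 2))) =
       E (fun t => 2^-1 * (zeta t * c j t ^+ 2 + zeta t * c k t ^+ 2)).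
      rewrite ExZ; last by apply: mbD; apply: mbM => //; exact: mbX.
      rewrite ExD; try by apply: mbM => //; exact: mbX.
      by rewrite !zc//; ring.
    apply: Ex_le.
    - by apply: mbM => //; exact: mbM.
    - by apply: mbM; [exact: mb_cst|apply: mbD; apply: mbM => //; exact: mbX].
    - by move=> t; have := z0 t; have := sqr_ge0 (c j t - c k t); nra.
  have -> : E (fun t => zeta t * (c j t * c k t)) = E (c j) * E (fun t => zeta t * c k t).
    rewrite -(@Ex_far (nb 1 j) (D :|: nb 1 k)%SET)//.
    - by apply: eq_Ex => t; ring.
    - move=> a b aj; rewrite finset.in_setU => /orP[bD|bk]; first exact: (DG jG).
      apply: (@far_nb 1 1 j k) => //.
      by move: jk; rewrite inE -ltnNge.
    - apply: depM; first by apply: (depS _ dz); exact: finset.subsetUl.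
      by apply: (depS _ (dc k)); exact: finset.subsetUr.
  by rewrite Ex_centered// mul0r.
have -> : E (fun t => zeta t * (\sum_(j in G) (n j t - E (n j))) ^+ 2) =
    \sum_(j in G) \sum_(k in G) E (fun t => zeta t * (c j t * c k t)).
  have mzc j k : bmeas (fun t => zeta t * (c j t * c k t)).
    by apply: mbM => //; exact: mbM.
  transitivity (\sum_(j in G) E (fun t => \sum_(k in G) zeta t * (c j t * c k t))); last first.
    by apply: eq_bigr => j _; rewrite Ex_sum.
  rewrite -Ex_sum; last by move=> j _; apply: mb_sum.
  apply: eq_Ex => t; rewrite expr2 -/(c _ _) mulr_suml mulr_sumr.
  by apply: eq_bigr => j _; rewrite mulr_sumr mulr_sumr.
pose s j := E (fun t => n j t ^+ 2).
have s0 j : 0 <= s j by apply: Ex_ge0 => t; exact: sqr_ge0.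
have Ez0 : 0 <= E zeta by exact: Ex_ge0.
apply: (@le_trans _ _ (\sum_(j in G) \sum_(k in nb 3 j | k \in G)
    E zeta * (2^-1 * (s j + s k)))).
  apply: ler_sum => j jG; rewrite [leRHS]big_mkcondl/=.
  apply: ler_sum => k kG; apply: le_trans (cov j k jG kG) _.
  case: ifP => // _; rewrite ler_wpM2l// ler_wpM2l// lerD//; exact: c2.
have e1 : \sum_(j in G) \sum_(k in nb 3 j | k \in G) s k <= K * \sum_(j in G) s j.
  exact: sum_nb_exchange.
have e2 : \sum_(j in G) \sum_(k in nb 3 j | k \in G) s j <= K * \sum_(j in G) s j.
  rewrite mulr_sumr; apply: ler_sum => j jG.
  rewrite sumr_const -mulr_natl ler_wpM2r//.
  apply: le_trans (card_nb j (isT : (3 <= 4)%N)); rewrite ler_nat subset_leq_card//.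
  by apply/fintype.subsetP => k; rewrite unfold_in => /andP[].
have -> : \sum_(j in G) \sum_(k in nb 3 j | k \in G) E zeta * (2^-1 * (s j + s k)) =
    E zeta * (2^-1 * (\sum_(j in G) \sum_(k in nb 3 j | k \in G) s j +
                      \sum_(j in G) \sum_(k in nb 3 j | k \in G) s k)).
  rewrite -big_split/= !mulr_sumr; apply: eq_bigr => j _.
  by rewrite -big_split/= !mulr_sumr; apply: eq_bigr => k _.
rewrite ler_wpM2l//; lra.
Qed.

(** Replaces a local sum by its mean under the weight [zeta q], through [|C| <= eps + C^2 / eps].
    The first term keeps the factor [q] and can be absorbed; in the second, [q <= 1] is dropped and
    the weighted variance remains. *)
Lemma weighted_decouple (q : T -> R) (eps : R) : 0 < eps -> bmeas q ->
  (forall t, 0 <= q t <= 1) ->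
  `|E (fun t => zeta t * q t * \sum_(j in G) (n j t - E (n j)))| <=
  eps * E (fun t => zeta t * q t) +
  E zeta * (K * \sum_(j in G) E (fun t => n j t ^+ 2)) / eps.
Proof.
move=> e0 mq q01.
have mz := dep_mb dz.
have mC : bmeas (fun t => \sum_(j in G) (n j t - E (n j))).
  by apply: mb_sum => j _; apply: mbB; [exact: (dep_mb (dn j))|exact: mb_cst].
apply: le_trans (Ex_abs _ _) _; first by apply: mbM => //; exact: mbM.
apply: (@le_trans _ _ (E (fun t => eps * (zeta t * q t) +
   eps^-1 * (zeta t * (\sum_(j in G) (n j t - E (n j))) ^+ 2)))).
  apply: Ex_le.
  - by apply: mb_norm; apply: mbM => //; exact: mbM.
  - by apply: mbD; apply: mbM; try exact: mb_cst; apply: mbM => //; exact: mbX.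
  - move=> t; set C := \sum_(j in G) _.
    have /andP[q0 q1] := q01 t.
    rewrite !normrM (ger0_norm (z0 t)) (ger0_norm q0).
    have -> : eps * (zeta t * q t) + eps^-1 * (zeta t * C ^+ 2) =
       zeta t * (eps * q t + eps^-1 * C ^+ 2) by ring.
    rewrite -mulrA ler_wpM2l//.
    have h : `|C| <= eps + eps^-1 * C ^+ 2.
      rewrite -(ler_pM2l e0) mulrDr mulrA mulfV ?gt_eqF// mul1r -[C ^+ 2]real_normK ?num_real//.
      by have := sqr_ge0 (eps - `|C|); have := normr_ge0 C; nra.
    apply: le_trans (ler_wpM2l q0 h) _.
    rewrite mulrDr [q t * eps]mulrC lerD2l ler_piMl// mulr_ge0 ?sqr_ge0//.
    by rewrite invr_ge0 ltW.
rewrite ExD; first last.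
- by apply: mbM; [exact: mb_cst|apply: mbM => //; exact: mbX].
- by apply: mbM; [exact: mb_cst|exact: mbM].
rewrite !ExZ; [|by apply: mbM => //; exact: mbX|exact: mbM].
rewrite lerD2l [leLHS]mulrC ler_wpM2r ?invr_ge0 ?(ltW e0)//.
exact: weighted_variance.
Qed.

End weighted.

(** * Moment bounds for the truncated field *)

Hypothesis be_small : be <= 100^-1.
Hypothesis be_gt0 : 0 < be.
Hypothesis third : K ^+ 2 * \sum_i E (fun t => `|xi i t| ^+ 3) <= be.
Hypothesis small_means : \sum_i `|E (xi i)| <= 16 * be.
Hypothesis EU1 : `|E (Ug [set: I]%SET) - 1| <= 4^-1.

Lemma mb_xi i : bmeas (xi i). Proof. exact: dep_mb (dxi i). Qed.
Lemma mb_Sg A : bmeas (Sg A). Proof. exact: dep_mb (dep_Sg (fintype.subxx A)). Qed.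
Lemma mb_Ug A : bmeas (Ug A). Proof. exact: dep_mb (dep_Ug (fintype.subxx A)). Qed.
Lemma mb_Yg i : bmeas (Yg i). Proof. exact: mb_Sg. Qed.
Lemma mb_Bg i : bmeas (Bg i). Proof. exact: dep_mb (dep_Bg (fintype.subxx _)). Qed.

Let e3 i := E (fun t => `|xi i t| ^+ 3).
Let e3_ge0 i : 0 <= e3 i.
Proof. by apply: Ex_ge0 => t; rewrite exprn_ge0. Qed.
Let mb_e3 i : bmeas (fun t => `|xi i t| ^+ 3).
Proof. by apply: mbX; apply: mb_norm; exact: mb_xi. Qed.

Lemma amgm3 (a b c : R) : 0 <= a -> 0 <= b -> 0 <= c ->
  3 * (a * b * c) <= a ^+ 3 + b ^+ 3 + c ^+ 3.
Proof.
move=> a0 b0 c0; rewrite -subr_ge0.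
have -> : a ^+ 3 + b ^+ 3 + c ^+ 3 - 3 * (a * b * c) =
  2^-1 * (a + b + c) * ((a - b) ^+ 2 + (b - c) ^+ 2 + (a - c) ^+ 2) by field.
by rewrite !mulr_ge0// ?addr_ge0 ?sqr_ge0.
Qed.

(** The AM-GM inequality turns mixed products into pure cubes. Each of the two sums over a
    neighbourhood contributes a factor [K], matched by the [K ^+ 2] in [third]. *)
Lemma sum_xi_Bg2 : \sum_i E (fun t => `|xi i t| * Bg i t ^+ 2) <= be.
Proof.
apply: le_trans third; rewrite -/(e3 _).
have step i : E (fun t => `|xi i t| * Bg i t ^+ 2) <=
   3^-1 * (K ^+ 2 * e3 i + 2 * K * \sum_(k in nb 2 i) e3 k).
  apply: (@le_trans _ _ (E (fun t => 3^-1 * (K ^+ 2 * `|xi i t| ^+ 3 +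
    2 * K * \sum_(k in nb 2 i) `|xi k t| ^+ 3)))); last first.
    have mS : bmeas (fun t => \sum_(k in nb 2 i) `|xi k t| ^+ 3) by exact: mb_sum.
    have mZ c f : bmeas f -> bmeas (fun t : T => (c : R) * f t).
      by move=> mf; apply: mbM => //; exact: mb_cst.
    rewrite ExZ; last by apply: mbD; exact: mZ.
    by rewrite ExD; [|exact: mZ|exact: mZ]; rewrite !ExZ// Ex_sum.
  apply: Ex_le.
  - by apply: mbM; [apply: mb_norm; exact: mb_xi|apply: mbX; exact: mb_Bg].
  - apply: mbM; first exact: mb_cst.
    by apply: mbD; apply: mbM => //; try exact: mb_cst; exact: mb_sum.
  move=> t; rewrite -(ler_pM2l (ltr0n _ 3)) [leRHS]mulrA mulfV ?pnatr_eq0// mul1r.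
  rewrite /Bg; set a := `|xi i t|; pose b k := `|xi k t|.
  have a0 : 0 <= a by exact: normr_ge0.
  have b0 k : 0 <= b k by exact: normr_ge0.
  set N := #|nb 2 i|.
  have NK : N%:R <= K by exact: card_nb.
  have -> : 3 * (a * (\sum_(k in nb 2 i) b k) ^+ 2) =
     \sum_(k in nb 2 i) \sum_(l in nb 2 i) 3 * (a * b k * b l).
    rewrite expr2 mulr_suml !mulr_sumr; apply: eq_bigr => k _.
    by rewrite !mulr_sumr; apply: eq_bigr => l _; ring.
  apply: (@le_trans _ _ (\sum_(k in nb 2 i) \sum_(l in nb 2 i)
     (a ^+ 3 + b k ^+ 3 + b l ^+ 3))).
    by apply: ler_sum => k _; apply: ler_sum => l _; exact: amgm3.
  have -> : \sum_(k in nb 2 i) \sum_(l in nb 2 i) (a ^+ 3 + b k ^+ 3 + b l ^+ 3) =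
     N%:R * (N%:R * a ^+ 3) + 2 * (N%:R * \sum_(k in nb 2 i) b k ^+ 3).
    under eq_bigr do rewrite !big_split/= !sumr_const -/N -mulr_natl -[X in _ + X + _]mulr_natl.
    rewrite !big_split/= !sumr_const -/N -mulr_sumr -mulr_natl -[X in _ + _ + X]mulr_natl.
    by ring.
  have S0 : 0 <= \sum_(k in nb 2 i) b k ^+ 3.
    by apply: sumr_ge0 => k _; rewrite exprn_ge0.
  apply: lerD; last by rewrite mulrA ler_wpM2r// ler_wpM2l.
  rewrite expr2 -mulrA; apply: ler_pM => //; first by rewrite mulr_ge0// exprn_ge0.
  by rewrite ler_wpM2r// exprn_ge0.
apply: le_trans (ler_sum _ (fun i _ => step i)) _.
rewrite -mulr_sumr big_split/= -!mulr_sumr.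
have ex : \sum_i \sum_(k in nb 2 i) e3 k <= K * \sum_i e3 i.
  have := @sum_nb_exchange 2 xpredT e3 isT e3_ge0.
  by under eq_bigr do (under eq_bigl do rewrite andbT).
have : 2 * K * (\sum_i \sum_(k in nb 2 i) e3 k) <= 2 * K * (K * \sum_i e3 i).
  by rewrite ler_wpM2l// mulr_ge0// ltW.
lra.
Qed.

(** Only one neighbourhood sum occurs, so a factor [K] remains available; it is the one produced by
    [weighted_variance]. *)
Lemma sum_xi2_Bg : K * \sum_i E (fun t => `|xi i t| ^+ 2 * Bg i t) <= be.
Proof.
apply: le_trans third; rewrite -/(e3 _) expr2 -mulrA ler_wpM2l ?(ltW K0')//.
have step i : E (fun t => `|xi i t| ^+ 2 * Bg i t) <=
   3^-1 * (2 * K * e3 i + \sum_(k in nb 2 i) e3 k).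
  apply: (@le_trans _ _ (E (fun t => 3^-1 * (2 * K * `|xi i t| ^+ 3 +
    \sum_(k in nb 2 i) `|xi k t| ^+ 3)))); last first.
    have mS : bmeas (fun t => \sum_(k in nb 2 i) `|xi k t| ^+ 3) by exact: mb_sum.
    have mZ c f : bmeas f -> bmeas (fun t : T => (c : R) * f t).
      by move=> mf; apply: mbM => //; exact: mb_cst.
    rewrite ExZ; last by apply: mbD => //; exact: mZ.
    by rewrite ExD; [|exact: mZ|exact: mS]; rewrite !ExZ// Ex_sum.
  apply: Ex_le.
  - by apply: mbM; [apply: mbX; apply: mb_norm; exact: mb_xi|exact: mb_Bg].
  - apply: mbM; first exact: mb_cst.
    by apply: mbD; [apply: mbM => //; exact: mb_cst|exact: mb_sum].
  move=> t; rewrite -(ler_pM2l (ltr0n _ 3)) [leRHS]mulrA mulfV ?pnatr_eq0// mul1r.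
  rewrite /Bg; set a := `|xi i t|; pose b k := `|xi k t|.
  have a0 : 0 <= a by exact: normr_ge0.
  have b0 k : 0 <= b k by exact: normr_ge0.
  set N := #|nb 2 i|.
  have NK : N%:R <= K by exact: card_nb.
  have -> : 3 * (a ^+ 2 * (\sum_(k in nb 2 i) b k)) =
     \sum_(k in nb 2 i) 3 * (a * a * b k).
    by rewrite !mulr_sumr; apply: eq_bigr => k _; ring.
  apply: (@le_trans _ _ (\sum_(k in nb 2 i) (a ^+ 3 + a ^+ 3 + b k ^+ 3))).
    by apply: ler_sum => k _; exact: amgm3.
  rewrite big_split/= sumr_const -/N lerD2r.
  have -> : (a ^+ 3 + a ^+ 3) *+ N = 2 * (N%:R * a ^+ 3) by rewrite -mulr_natl; ring.
  by rewrite -mulrA ler_wpM2l// ler_wpM2r// exprn_ge0.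
apply: le_trans (ler_sum _ (fun i _ => step i)) _.
rewrite -mulr_sumr big_split/= -!mulr_sumr.
have ex : \sum_i \sum_(k in nb 2 i) e3 k <= K * \sum_i e3 i.
  have := @sum_nb_exchange 2 xpredT e3 isT e3_ge0.
  by under eq_bigr do (under eq_bigl do rewrite andbT).
lra.
Qed.

Lemma abs_Ex_Sg A : `|E (Sg A)| <= 16 * be.
Proof.
apply: le_trans small_means; rewrite /Sg Ex_sum; last by move=> i _; exact: mb_xi.
apply: le_trans (ler_norm_sum _ _ _) _.
rewrite [leRHS](bigID (mem A))/= lerDl; exact: sumr_ge0.
Qed.

(** Split [S] as [Y_i] plus the sum off [nb 1 i] in each product [xi_i S]: the first parts add up to
    [U], of mean at most 5/4, and the second factor by independence into products of means, with
    total at most [(16 be)^2 <= 1]. *)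
Lemma Ex_S2 : E (fun t => Sg [set: I]%SET t ^+ 2) <= 9 / 4.
Proof.
have mS := mb_Sg; have mx := mb_xi.
have -> : E (fun t => Sg [set: I]%SET t ^+ 2) =
   E (Ug [set: I]%SET) + \sum_i E (xi i) * E (Sg (~: nb 1 i)%SET).
  have -> : \sum_i E (xi i) * E (Sg (~: nb 1 i)%SET) =
     E (fun t => \sum_i xi i t * Sg (~: nb 1 i)%SET t).
    rewrite Ex_sum; last by move=> i _; exact: mbM.
    apply: eq_bigr => i _; symmetry; apply: (@Ex_far (nb 0 i) (~: nb 1 i)%SET).
    - exact: far_nbC.
    - by apply: dep_xi; exact: nb_self.
    - exact: dep_Sg.
  rewrite -ExD; [|exact: mb_Ug|by apply: mb_sum => i _; exact: mbM].
  apply: eq_Ex => t; rewrite Ug_Yg -big_split/= expr2.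
  under [RHS]eq_bigr do rewrite -mulrDr -Sg_Yg addrC subrK.
  by rewrite -mulr_suml; congr (_ * _); rewrite /Sg; apply: eq_bigl => i; rewrite finset.in_setT.
have h1 : E (Ug [set: I]%SET) <= 5 / 4 by move: EU1; rewrite ler_norml; lra.
have h2 : \sum_i E (xi i) * E (Sg (~: nb 1 i)%SET) <= 16 * be * (16 * be).
  apply: (@le_trans _ _ (\sum_i `|E (xi i)| * (16 * be))).
    apply: ler_sum => i _; rewrite (le_trans (ler_norm _))// normrM.
    by rewrite ler_wpM2l// abs_Ex_Sg.
  by rewrite -mulr_suml ler_wpM2r// mulr_ge0// ltW.
have : 16 * be * (16 * be) <= 1 by move: be_small be_gt0; nra.
lra.
Qed.

Lemma Ex_abs_S : E (fun t => `|Sg [set: I]%SET t|) <= 2.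
Proof.
have mS := mb_Sg [set: I]%SET.
apply: (@le_trans _ _ (E (fun t => 2^-1 * (1 + Sg [set: I]%SET t ^+ 2)))).
  apply: Ex_le; first exact: mb_norm.
    by apply: mbM; [exact: mb_cst|apply: mbD; [exact: mb_cst|exact: mbX]].
  move=> t; rewrite -real_normK ?num_real//.
  by have := sqr_ge0 (`|Sg [set: I]%SET t| - 1); lra.
rewrite ExZ; last by apply: mbD; [exact: mb_cst|exact: mbX].
rewrite ExD; [|exact: mb_cst|exact: mbX].
by rewrite Ex_cst; have := Ex_S2; lra.
Qed.

Lemma Ex_abs_Sg_near (A : {set I}) (c : R) :
  (forall t, `|Sg [set: I]%SET t - Sg A t| <= c) ->
  E (fun t => `|Sg A t|) <= 2 + c.
Proof.
move=> h; apply: (@le_trans _ _ (E (fun t => `|Sg [set: I]%SET t| + c))).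
  apply: Ex_le.
  - by apply: mb_norm; exact: mb_Sg.
  - by apply: mbD; [apply: mb_norm; exact: mb_Sg|exact: mb_cst].
  - move=> t; have -> : Sg A t = Sg [set: I]%SET t - (Sg [set: I]%SET t - Sg A t) by ring.
    by rewrite (le_trans (ler_normB _ _))// lerD2l.
rewrite ExD; [|by apply: mb_norm; exact: mb_Sg|exact: mb_cst].
by rewrite Ex_cst lerD2r Ex_abs_S.
Qed.

#[local] Hint Resolve mb_xi mb_Sg mb_Ug mb_Yg mb_Bg : bmeas.

(** Its sign decides [S / psi(U) <= a]. Multiplying the level into the normaliser avoids division
    and allows [A] to be removed from both terms at once. *)
Definition level_gap (a : R) (A : {set I}) (w : T) : R := Sg A w - a * psi (Ug A w).

Lemma dep_Tst a (A B : {set I}) : A \subset B -> dep X B (level_gap a A).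
Proof.
move=> AB; apply: depD; first exact: dep_Sg.
apply: depN; apply: depM; first exact: dep_cst.
by apply: (@dep_cont _ _ _ _ _ _ _ (@psi R) 2); [exact: psi_continuous|exact: psi_norm_le|exact: dep_Ug].
Qed.

Lemma mb_Tst a A : bmeas (level_gap a A).
Proof. exact: dep_mb (dep_Tst a (fintype.subxx A)). Qed.

#[local] Hint Resolve mb_Tst : bmeas.

Lemma Sg_far2 (A B : {set I}) w : #|A|%:R <= K -> #|B|%:R <= K ->
  `|Sg [set: I]%SET w - Sg (~: (A :|: B))%SET w| <= 2^-1.
Proof.
move=> AK BK; rewrite (Sg_split (A :|: B)) addrK (le_trans (ler_norm_sum _ _ _))//.
have -> : 2^-1 = 4^-1 + 4^-1 :> R by field.
apply: (@le_trans _ _ (\sum_(k in A) `|xi k w| + \sum_(k in B) `|xi k w|)); last first.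
  by rewrite lerD//; exact: sum_abs_le.
rewrite big_mkcond [X in _ <= X + _]big_mkcond [X in _ <= _ + X]big_mkcond/=.
rewrite -big_split/=; apply: ler_sum => k _; rewrite finset.in_setU.
by case: (k \in A); case: (k \in B); rewrite /= ?addr0 ?add0r// lerDl.
Qed.

(** * Weighted concentration inequality *)

Section concentration.
Variables (i0 : I) (zeta : T -> R) (a : R).
Hypothesis dz : dep X (nb 1 i0) zeta.
Hypothesis z0 : forall w, 0 <= zeta w.

(** Radius 4 = 1 + 2 + 1: for [j] in [G], functions of [nb 2 j] such as [Bg j] are independent of
    [zeta], which lives on [nb 1 i0]. *)
Let G : {set I} := (~: nb 4 i0)%SET.
Let al := 200 * be.
Let Ts := level_gap a [set: I]%SET.
Let Ez := E zeta.
Let mz : bmeas zeta. Proof. exact: dep_mb dz. Qed.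
#[local] Hint Resolve mz : bmeas.

Let al0 : 0 < al. Proof. by rewrite /al mulr_gt0 ?ltr0n. Qed.
Let al2 : al <= 2. Proof. by rewrite /al; move: be_small; lra. Qed.
Let Ez0 : 0 <= Ez. Proof. exact: Ex_ge0. Qed.
Let Gdist j : j \in G -> (4 * m < dist j i0)%N.
Proof. by rewrite !inE -ltnNge dist_sym. Qed.

Let DG j b c : j \in G -> b \in nb 1 j -> c \in nb 1 i0 -> (m < dist b c)%N.
Proof.
move=> /Gdist jG; apply: far_nb; apply: leq_ltn_trans jG.
by rewrite leq_mul2r orbT.
Qed.

Let q t := E (fun w => zeta w * phi ((Ts w - t) / al)).

Let mTs : bmeas Ts. Proof. exact: mb_Tst. Qed.
#[local] Hint Resolve mTs : bmeas.

Let q_ge0 t : 0 <= q t.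
Proof. by apply: Ex_ge0 => w; rewrite mulr_ge0// ltW// phi_gt0. Qed.

(** An antiderivative of the kernel [phi ((x - t) / al)], of size at most [2 * al]. The expectation
    of [zeta S hh] is small for this reason, while its expansion over the summands of [S] brings out
    [q t]. *)
Let hh t x := al * atan ((x - t) / al).

Let hh_le t x : `|hh t x| <= 2 * al.
Proof.
by rewrite normrM (gtr0_norm al0) mulrC ler_wpM2r ?(ltW al0)//; exact: atan_abs_le2.
Qed.

Lemma conc_total t : `|E (fun w => zeta w * Sg G w * hh t (Ts w))| <= 9 / 2 * al * Ez.
Proof.
apply: le_trans (Ex_abs _ _) _; first by rewrite /hh; mbt.
apply: (@le_trans _ _ (E (fun w => 2 * al * (zeta w * `|Sg G w|)))).
  apply: Ex_le; [by rewrite /hh; mbt|mbt|move=> w].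
  rewrite normrM [X in X * _ <= _]normrM (ger0_norm (z0 w)) [leLHS]mulrC.
  by rewrite ler_wpM2r// mulr_ge0.
rewrite ExZ; last mbt.
have -> : E (fun w => zeta w * `|Sg G w|) = Ez * E (fun w => `|Sg G w|).
  apply: (@Ex_far (nb 1 i0) G) => //; last by apply: dep_norm; exact: dep_Sg.
  move=> b c b1 cG; apply: (far_nbC b1).
  by move: cG; rewrite !finset.in_setC; apply: contra; apply: (fintype.subsetP (nbS i0 _)).
have := @Ex_abs_Sg_near G 4^-1 (fun w => Sg_near w (cardK i0)).
move=> h; have : Ez * E (fun w => `|Sg G w|) <= Ez * (9 / 4).
  by rewrite ler_wpM2l//; lra.
by move=> h2; have : 2 * al * (Ez * E (fun w => `|Sg G w|)) <= 2 * al * (Ez * (9 / 4));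
  [rewrite ler_wpM2l// mulr_ge0// ltW|lra].
Qed.

(** Once [nb 1 j] is removed from both [S] and [psi(U)], [xi j] is independent of all the rest and
    only its mean, created by the truncation, survives. *)
Lemma conc_indep t :
  \sum_(j in G) `|E (fun w => zeta w * xi j w * hh t (level_gap a (~: nb 1 j)%SET w))| <=
  64 * be * Ez.
Proof.
apply: (@le_trans _ _ (\sum_(j in G) `|E (xi j)| * (2 * al * Ez))).
  apply: ler_sum => j jG.
  have sub : nb 1 i0 \subset (~: nb 1 j)%SET.
    apply/fintype.subsetP => b b0; rewrite finset.in_setC; apply/negP => bj.
    by have := DG jG bj b0; rewrite dist_refl.
  have -> : E (fun w => zeta w * xi j w * hh t (level_gap a (~: nb 1 j)%SET w)) =
     E (xi j) * E (fun w => zeta w * hh t (level_gap a (~: nb 1 j)%SET w)).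
    rewrite -(@Ex_far (nb 0 j) (~: nb 1 j)%SET).
    - by apply: eq_Ex => w; ring.
    - exact: far_nbC.
    - by apply: dep_xi; exact: nb_self.
    - apply: depM; first exact: depS sub dz.
      apply: depM; first exact: dep_cst.
      apply: (@dep_cont _ _ _ _ _ _ _ (@atan R) 2);
        [exact: continuous_atan|exact: atan_abs_le2|].
      apply: depM; last exact: dep_cst.
      by apply: depD; [exact: dep_Tst|exact: dep_cst].
  rewrite normrM ler_wpM2l//.
  apply: le_trans (Ex_abs _ _) _; first by rewrite /hh; mbt.
  rewrite -ExZ//; apply: Ex_le; [by rewrite /hh; mbt|mbt|move=> w].
  by rewrite normrM (ger0_norm (z0 w)) [leLHS]mulrC ler_wpM2r.
rewrite -mulr_suml.
have h : \sum_(j in G) `|E (xi j)| <= 16 * be.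
  apply: le_trans small_means; rewrite [leRHS](bigID (mem G))/= lerDl; exact: sumr_ge0.
have : (\sum_(j in G) `|E (xi j)|) * (2 * al * Ez) <= 16 * be * (2 * al * Ez).
  apply: ler_wpM2r => //; apply: mulr_ge0; last exact: Ez0.
  by apply: mulr_ge0 => //; exact: ltW al0.
have : 2 * al * Ez * (16 * be) <= 2 * 2 * Ez * (16 * be).
  by rewrite ler_wpM2r ?mulr_ge0 ?(ltW be_gt0)// ler_wpM2r// ler_wpM2l.
lra.
Qed.

(** The cost of removing [nb 1 j] from [psi(U)] after it has been removed from [S]. By [Ug_near] it
    is quadratic in [Bg j], and [atan_drift] makes it uniform in [a] at the price of a factor affine
    in [|S|] and [|t|]. *)
Lemma conc_drift t :
  \sum_(j in G) `|E (fun w => zeta w * xi j w *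
     (hh t (Ts w - Yg j w) - hh t (level_gap a (~: nb 1 j)%SET w)))| <=
  17 * be * (1 + `|t|) * Ez.
Proof.
apply: (@le_trans _ _ (\sum_(j in G) E (fun w => `|xi j w| * Bg j w ^+ 2) *
   (17 * (1 + `|t|) * Ez))); last first.
  rewrite -mulr_suml.
  have h : \sum_(j in G) E (fun w => `|xi j w| * Bg j w ^+ 2) <= be.
    apply: le_trans sum_xi_Bg2; rewrite [leRHS](bigID (mem G))/= lerDl.
    by apply: sumr_ge0 => j _; apply: Ex_ge0 => w; rewrite mulr_ge0// sqr_ge0.
  have -> : 17 * be * (1 + `|t|) * Ez = be * (17 * (1 + `|t|) * Ez) by ring.
  by rewrite ler_wpM2r// !mulr_ge0// addr_ge0.
apply: ler_sum => j jG.
(* Outside [nb 3 j] and [nb 4 i0] the sum is independent of [zeta], [xi j] and [Bg j], so [|S|] may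
   be integrated separately. *)
pose F : {set I} := (~: (nb 3 j :|: nb 4 i0))%SET.
have card3 : #|nb 3 j|%:R <= K by exact: card_nb.
apply: le_trans (Ex_abs _ _) _; first by rewrite /hh; mbt.
(* Twice the [atan_drift] factor [2 (|S| + |t|) + al], with [|S| <= |Sg F| + 3/4] and [al <= 2], is
   at most [4 |Sg F| + 4 |t| + 7]. *)
apply: (@le_trans _ _ (E (fun w => zeta w * (`|xi j w| * Bg j w ^+ 2) *
   (4 * `|Sg F w| + (4 * `|t| + 7))))).
  apply: Ex_le; [by rewrite /hh; mbt|mbt|move=> w].
  have -> : Ts w - Yg j w = Sg (~: nb 1 j)%SET w - a * psi (Ug [set: I]%SET w).
    by rewrite -Sg_Yg /Ts /level_gap; ring.
  have uv : `|psi (Ug [set: I]%SET w) - psi (Ug (~: nb 1 j)%SET w)| <= 2 * Bg j w ^+ 2.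
    by apply: le_trans (psi_lip _ _) _; exact: Ug_near.
  have B0 : 0 <= Bg j w ^+ 2 by exact: sqr_ge0.
  move: (Bg j w ^+ 2) uv B0 => b2 uv B0.
  rewrite /level_gap !normrM (ger0_norm (z0 w)) -!mulrA ler_wpM2l// ler_wpM2l//.
  set u := psi (Ug [set: I]%SET w) in uv *; set v := psi (Ug (~: nb 1 j)%SET w) in uv *.
  have /andP[u1 _] := psi_itv (Ug [set: I]%SET w).
  have /andP[v1 _] := psi_itv (Ug (~: nb 1 j)%SET w).
  apply: le_trans (@atan_drift R al a (Sg (~: nb 1 j)%SET w) t u v al0 u1 v1) _.
  have s1 : `|Sg (~: nb 1 j)%SET w| <= `|Sg F w| + 3 / 4.
    have -> : Sg (~: nb 1 j)%SET w = Sg F w + (Sg [set: I]%SET w - Sg F w) -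
      (Sg [set: I]%SET w - Sg (~: nb 1 j)%SET w) by ring.
    rewrite (le_trans (ler_normB _ _))// -[3 / 4](_ : 2^-1 + 4^-1 = _); last by field.
    rewrite [leRHS]addrA; apply: lerD; last exact: Sg_near w (card_nb j (isT : (1 <= 4)%N)).
    by rewrite (le_trans (ler_normD _ _))// lerD2l; exact: Sg_far2.
  apply: le_trans (ler_wpM2r _ uv) _; first by rewrite addr_ge0 ?(ltW al0)// mulr_ge0// addr_ge0.
  rewrite [leLHS](_ : _ = b2 * (2 * (2 * (`|Sg (~: nb 1 j)%SET w| + `|t|) + al)));
    last by ring.
  by rewrite ler_wpM2l//; have := al2; lra.
have mw : bmeas (fun w => `|xi j w| * Bg j w ^+ 2) by mbt.
have e1 : E (fun w => zeta w * (`|xi j w| * Bg j w ^+ 2)) =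
    Ez * E (fun w => `|xi j w| * Bg j w ^+ 2).
  apply: (@Ex_far (nb 1 i0) (nb 2 j)) => //; first last.
    apply: depM; first by apply: dep_norm; apply: dep_xi; exact: nb_self.
    by apply: depX; exact: dep_Bg.
  by apply: far_nb; rewrite dist_sym; exact: Gdist.
have e2 : E (fun w => zeta w * (`|xi j w| * Bg j w ^+ 2) * `|Sg F w|) =
    Ez * E (fun w => `|xi j w| * Bg j w ^+ 2) * E (fun w => `|Sg F w|).
  rewrite -e1; apply: (@Ex_far (nb 1 i0 :|: nb 2 j)%SET F); first last.
  - by apply: dep_norm; exact: dep_Sg.
  - apply: depM; first by apply: depS dz; exact: finset.subsetUl.
    apply: depM; first by apply: dep_norm; apply: dep_xi; rewrite finset.in_setU nb_self orbT.
    by apply: depX; apply: dep_Bg; exact: finset.subsetUr.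
  - move=> b c b12; rewrite finset.in_setC finset.in_setU => /norP[c3 c4].
    move: b12; rewrite finset.in_setU => /orP[b1|b2]; last by apply: (far_nbC b2); rewrite finset.in_setC.
    apply: (far_nbC b1); rewrite finset.in_setC.
    by move: c4; apply: contra; apply: (fintype.subsetP (nbS i0 _)).
have -> : E (fun w => zeta w * (`|xi j w| * Bg j w ^+ 2) * (4 * `|Sg F w| + (4 * `|t| + 7))) =
    E (fun w => `|xi j w| * Bg j w ^+ 2) * Ez * (4 * E (fun w => `|Sg F w|) + (4 * `|t| + 7)).
  transitivity (E (fun w => 4 * (zeta w * (`|xi j w| * Bg j w ^+ 2) * `|Sg F w|) +
      (4 * `|t| + 7) * (zeta w * (`|xi j w| * Bg j w ^+ 2)))).
    by apply: eq_Ex => w; ring.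
  rewrite ExD; [|mbt|mbt]; rewrite !ExZ; [|mbt|mbt].
  by rewrite e1 e2; ring.
have sF : E (fun w => `|Sg F w|) <= 5 / 2.
  have := @Ex_abs_Sg_near F 2^-1 (fun w => Sg_far2 w card3 (cardK i0)); lra.
have x0 : 0 <= E (fun w => `|xi j w| * Bg j w ^+ 2).
  by apply: Ex_ge0 => w; rewrite mulr_ge0// sqr_ge0.
rewrite -mulrA ler_wpM2l// [leRHS]mulrC ler_wpM2l//.
by have := normr_ge0 t; lra.
Qed.

(** Since [|Y_j| <= 1/4], [kap] steps of length [al] cover every jump, while the total length
    [al * kap] stays bounded. *)
Let kap := (Num.truncn ((4 * al)^-1)).+1.

Let kap_gt : (4 * al)^-1 < kap%:R. Proof. exact: truncnS_gt. Qed.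

Let kap_le (k : nat) : (k < kap)%N -> k%:R * al <= 4^-1.
Proof.
rewrite ltnS => kk.
have : k%:R <= (4 * al)^-1.
  apply: (@le_trans _ _ (Num.truncn ((4 * al)^-1))%:R); first by rewrite ler_nat.
  by rewrite truncn_le// invr_ge0 mulr_ge0// ltW.
by rewrite invfM -ler_pdivlMr.
Qed.

Let kap_al : al * kap%:R <= 3.
Proof.
have : kap.-1%:R * al <= 4^-1 by apply: kap_le.
by have := al2; rewrite -[kap in X in _ -> _ -> X]prednK// -natr1; lra.
Qed.

Let phs s w := phi ((Ts w - s) / al).
Let mphs s : bmeas (phs s). Proof. by rewrite /phs; mbt. Qed.
#[local] Hint Resolve mphs : bmeas.
Let phs01 s w : 0 <= phs s w <= 1.
Proof. by rewrite ltW ?phi_gt0//= phi_le1. Qed.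

Let small j w := (`|Yg j w| <= al)%R%:R : R.
Let large j w := (al <= `|Yg j w|)%R%:R : R.
(** Coefficients of the Taylor remainder. [n0] multiplies the kernel at level [t]: the quadratic
    error when [|Y_j| <= al], the subtracted linear term itself when [|Y_j| >= al]. [nk k]
    multiplies the kernels at levels [t] plus or minus [k * al], for the unit steps of a large
    jump. *)
Let n0 j w := `|xi j w| * (small j w * (2 * Yg j w ^+ 2 / al) + large j w * `|Yg j w|).
Let nk (k : nat) j w := `|xi j w| * (large j w * (k%:R * al <= `|Yg j w|)%R%:R).

Let dxi1 j : dep X (nb 1 j) (xi j). Proof. exact: dep_xi (nb_self _ _). Qed.
Let dYg j : dep X (nb 1 j) (Yg j). Proof. exact: dep_Yg. Qed.
Let dlarge j : dep X (nb 1 j) (large j).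
Proof. by apply: dep_le; [exact: dep_cst|exact: dep_norm]. Qed.

Let dn0 j : dep X (nb 1 j) (n0 j).
Proof.
apply: depM; first exact: dep_norm.
apply: depD; last by apply: depM => //; exact: dep_norm.
apply: depM; first by apply: dep_le; [exact: dep_norm|exact: dep_cst].
apply: depM; last exact: dep_cst.
by apply: depM; [exact: dep_cst|exact: depX].
Qed.

Let dnk k j : dep X (nb 1 j) (nk k j).
Proof.
apply: depM; first exact: dep_norm.
by apply: depM => //; apply: dep_le; [exact: dep_cst|exact: dep_norm].
Qed.

Let mn0 j : bmeas (n0 j). Proof. exact: dep_mb (dn0 j). Qed.
Let mnk k j : bmeas (nk k j). Proof. exact: dep_mb (dnk k j). Qed.
Let mlarge j : bmeas (large j). Proof. exact: dep_mb (dlarge j). Qed.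
#[local] Hint Resolve mn0 mnk mlarge : bmeas.

Let Yg_le j w : `|Yg j w| <= 4^-1.
Proof. exact: le_trans (Yg_le_Bg j w) (Bg_le j w). Qed.

(** Small jumps are handled by [atan_linear], large ones by [atan_tele]. *)
Let remainder_pointwise t j w :
  `|xi j w * (hh t (Ts w) - hh t (Ts w - Yg j w)) - xi j w * Yg j w * phs t w| <=
  n0 j w * phs t w +
  3 * al * \sum_(k < kap) nk k j w * (phs (t + k%:R * al) w + phs (t - k%:R * al) w).
Proof.
have -> : xi j w * (hh t (Ts w) - hh t (Ts w - Yg j w)) - xi j w * Yg j w * phs t w =
   xi j w * (hh t (Ts w) - hh t (Ts w - Yg j w) - Yg j w * phs t w) by ring.
have -> : n0 j w * phs t w +
  3 * al * \sum_(k < kap) nk k j w * (phs (t + k%:R * al) w + phs (t - k%:R * al) w) =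
  `|xi j w| * ((small j w * (2 * Yg j w ^+ 2 / al) + large j w * `|Yg j w|) * phs t w +
   3 * al * (large j w * \sum_(k < kap) (k%:R * al <= `|Yg j w|)%R%:R *
      (phs (t + k%:R * al) w + phs (t - k%:R * al) w))).
  have -> : \sum_(k < kap) nk k j w * (phs (t + k%:R * al) w + phs (t - k%:R * al) w) =
    `|xi j w| * (large j w * \sum_(k < kap) (k%:R * al <= `|Yg j w|)%R%:R *
      (phs (t + k%:R * al) w + phs (t - k%:R * al) w)).
    by rewrite mulrA mulr_sumr; apply: eq_bigr => k _; rewrite /nk; ring.
  by rewrite /n0; ring.
rewrite normrM ler_wpM2l//.
set x := (Ts w - t) / al; set y := Yg j w / al.
have hE : hh t (Ts w) - hh t (Ts w - Yg j w) = al * (atan x - atan (x - y)).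
  rewrite /hh -mulrBr; congr (_ * (_ - atan _)); rewrite /x /y; ring.
have aln : al != 0 by rewrite gt_eqF.
have ay : `|y| = `|Yg j w| / al by rewrite normrM normfV (gtr0_norm al0).
have p0 : 0 <= phs t w by case/andP: (phs01 t w).
have sum0 : 0 <= \sum_(k < kap) (k%:R * al <= `|Yg j w|)%R%:R *
      (phs (t + k%:R * al) w + phs (t - k%:R * al) w).
  apply: sumr_ge0 => k _; rewrite mulr_ge0// addr_ge0//.
    by case/andP: (phs01 (t + k%:R * al) w).
  by case/andP: (phs01 (t - k%:R * al) w).
rewrite hE; have [yl|yl] := leP `|Yg j w| al.
  rewrite /small yl mul1r.
  have y1 : `|y| <= 1 by rewrite ay ler_pdivrMr// mul1r.
  have := atan_linear x y1; rewrite -/(phs t w) => h.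
  have -> : al * (atan x - atan (x - y)) - Yg j w * phs t w =
     al * (atan x - atan (x - y) - y * phs t w).
    by rewrite [RHS]mulrBr mulrA /y [al * (_ / _)]mulrC divfK.
  rewrite normrM (gtr0_norm al0); apply: le_trans (ler_wpM2l (ltW al0) h) _.
  have -> : al * (2 * y ^+ 2 * phs t w) = 2 * Yg j w ^+ 2 / al * phs t w.
    by rewrite /y; field.
  rewrite -[leLHS]addr0; apply: lerD.
    by rewrite ler_wpM2r// lerDl mulr_ge0.
  by rewrite !mulr_ge0// ltW.
have -> : small j w = 0 by rewrite /small leNgt yl.
have -> : large j w = 1 by rewrite /large ltW.
rewrite mul0r add0r !mul1r.
have yk : `|y| <= kap%:R.
  rewrite ay ler_pdivrMr//; apply: le_trans (Yg_le j w) _.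
  have := kap_gt; rewrite invfM -ltr_pdivlMr ?invr_gt0// invrK.
  by move/ltW; rewrite -[4^-1]mul1r ler_pdivrMr// mul1r; lra.
apply: le_trans (ler_normB _ _) _; rewrite addrC; apply: lerD.
  by rewrite normrM [X in _ * X](ger0_norm p0).
rewrite normrM (gtr0_norm al0).
apply: le_trans (ler_wpM2l (ltW al0) (atan_tele x yk)) _.
have al3 : 0 <= 3 * al by apply: mulr_ge0 => //; exact: ltW al0.
rewrite mulrA [al * 3]mulrC; apply: ler_wpM2l al3 _ _ _.
rewrite le_eqVlt; apply/orP; left; apply/eqP; apply: eq_bigr => k _.
congr (_ * _); first by rewrite ay ler_pdivlMr.
by congr (phi _ + phi _); rewrite /x; field.
Qed.

Let sumG_le (f : I -> R) : (forall j, 0 <= f j) -> \sum_(j in G) f j <= \sum_j f j.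
Proof. by move=> f0; rewrite [leRHS](bigID (mem G))/= lerDl; exact: sumr_ge0. Qed.

Let small_itv j w : 0 <= small j w <= 1.
Proof. by rewrite /small; case: (_ <= al); rewrite ?lexx ?ler01. Qed.

Let large_itv j w : 0 <= large j w <= 1.
Proof. by rewrite /large; case: (al <= _); rewrite ?lexx ?ler01. Qed.

Let large_Yg j w : large j w * `|Yg j w| <= Yg j w ^+ 2 / al.
Proof.
rewrite /large -real_normK ?num_real//; case: (leP al `|Yg j w|) => h.
  by rewrite mul1r ler_pdivlMr// expr2 ler_wpM2l.
by rewrite mul0r divr_ge0 ?(ltW al0)// sqr_ge0.
Qed.

Let small_Yg j w : small j w * (2 * Yg j w ^+ 2 / al) <= 2 * `|Yg j w|.
Proof.
rewrite /small -real_normK ?num_real//; case: (leP `|Yg j w| al) => h.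
  by rewrite mul1r ler_pdivrMr// -mulrA ler_wpM2l// expr2 ler_wpM2l.
by rewrite mul0r mulr_ge0.
Qed.

Let Yg2_le j w : Yg j w ^+ 2 <= Bg j w ^+ 2.
Proof.
by rewrite -real_normK ?num_real// lerXn2r ?nnegrE ?Yg_le_Bg// Bg_ge0.
Qed.

Let Yg2_le1 j w : Yg j w ^+ 2 <= Bg j w.
Proof.
apply: le_trans (Yg2_le j w) _; rewrite expr2 ler_piMl ?Bg_ge0//.
by apply: le_trans (Bg_le j w) _; rewrite invf_le1// ler1n.
Qed.

Let n0_ge0 j w : 0 <= n0 j w.
Proof.
have /andP[s0 _] := small_itv j w; have /andP[l0 _] := large_itv j w.
by rewrite mulr_ge0// addr_ge0// mulr_ge0// divr_ge0 ?(ltW al0)// mulr_ge0// sqr_ge0.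
Qed.

(** Every part of [n0] is at most [|xi_j| Y_j^2 / al] up to a constant, hence of third order divided
    by [al]. With [al = 200 be] the total is a small absolute constant. *)
Let n0_mean : \sum_(j in G) E (n0 j) <= 3 / 200.
Proof.
have -> : 3 / 200 = 3 / al * be by rewrite /al; field; rewrite gt_eqF.
apply: (@le_trans _ _ (3 / al * \sum_j E (fun w => `|xi j w| * Bg j w ^+ 2))); last first.
  by apply: ler_wpM2l; [apply: divr_ge0 => //; exact: ltW al0|exact: sum_xi_Bg2].
rewrite mulr_sumr; apply: le_trans (sumG_le _) _.
  by move=> j; apply: Ex_ge0 => w; exact: n0_ge0.
apply: ler_sum => j _; rewrite -ExZ; last mbt.
apply: Ex_le; [exact: mn0|mbt|move=> w].
rewrite mulrCA ler_wpM2l//.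
have /andP[s0 s1] := small_itv j w.
have Y0 : 0 <= 2 * Yg j w ^+ 2 / al.
  by apply: divr_ge0; [apply: mulr_ge0 => //; exact: sqr_ge0|exact: ltW al0].
apply: (@le_trans _ _ (3 / al * Yg j w ^+ 2)); last first.
  by apply: ler_wpM2l => //; apply: divr_ge0 => //; exact: ltW al0.
have -> : 3 / al * Yg j w ^+ 2 = 2 * Yg j w ^+ 2 / al + Yg j w ^+ 2 / al by ring.
by apply: lerD => //; exact: ler_piMl.
Qed.

Let n0_sqr : K * \sum_(j in G) E (fun w => n0 j w ^+ 2) <= 9 * be.
Proof.
apply: (@le_trans _ _ (9 * (K * \sum_j E (fun w => `|xi j w| ^+ 2 * Bg j w)))); last first.
  by apply: ler_wpM2l => //; exact: sum_xi2_Bg.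
rewrite mulrCA ler_wpM2l ?(ltW K0')// mulr_sumr.
apply: le_trans (sumG_le _) _; first by move=> j; apply: Ex_ge0 => w; exact: sqr_ge0.
apply: ler_sum => j _; rewrite -ExZ; last mbt.
apply: Ex_le; [mbt|mbt|move=> w].
have h : n0 j w <= `|xi j w| * (3 * `|Yg j w|).
  rewrite ler_wpM2l//.
  have -> : 3 * `|Yg j w| = 2 * `|Yg j w| + `|Yg j w| by ring.
  apply: lerD; first exact: small_Yg.
  by have /andP[_ l1] := large_itv j w; exact: ler_piMl.
apply: (@le_trans _ _ ((`|xi j w| * (3 * `|Yg j w|)) ^+ 2)).
  by rewrite lerXn2r ?nnegrE ?n0_ge0// !mulr_ge0.
have -> : (`|xi j w| * (3 * `|Yg j w|)) ^+ 2 = 9 * (`|xi j w| ^+ 2 * `|Yg j w| ^+ 2) by ring.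
rewrite ler_wpM2l// ler_wpM2l ?sqr_ge0// real_normK ?num_real//.
Qed.

Let count_large j w :
  al * \sum_(k < kap) large j w * (k%:R * al <= `|Yg j w|)%R%:R <=
  large j w * (2 * `|Yg j w|).
Proof.
rewrite -mulr_sumr mulrCA /large; case: (leP al `|Yg j w|) => h; last by rewrite !mul0r.
rewrite !mul1r.
have := @count_le R kap (`|Yg j w| / al) (divr_ge0 (normr_ge0 _) (ltW al0)).
have -> : \sum_(k < kap) (k%:R <= `|Yg j w| / al)%R%:R =
    \sum_(k < kap) (k%:R * al <= `|Yg j w|)%R%:R :> R.
  by apply: eq_bigr => k _; rewrite ler_pdivlMr.
move=> h2; apply: le_trans (ler_wpM2l (ltW al0) h2) _.
by rewrite mulrDr mulr1 mulrCA mulfV ?gt_eqF// mulr1; lra.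
Qed.

(** A large jump takes at most [2 |Y_j| / al] steps, and [|Y_j| <= Y_j^2 / al] on large jumps. The
    sum over all levels is therefore again of third order over [al]. *)
Let nk_mean : al * \sum_(k < kap) \sum_(j in G) E (nk k j) <= 100^-1.
Proof.
have -> : 100^-1 = 2 / al * be by rewrite /al; field; rewrite gt_eqF.
apply: (@le_trans _ _ (2 / al * \sum_j E (fun w => `|xi j w| * Bg j w ^+ 2))); last first.
  by apply: ler_wpM2l; [apply: divr_ge0 => //; exact: ltW al0|exact: sum_xi_Bg2].
rewrite exchange_big/= !mulr_sumr.
apply: (@le_trans _ _ (\sum_(j in G) (2 / al * E (fun w => `|xi j w| * Bg j w ^+ 2)))); last first.
  apply: sumG_le => j; apply: mulr_ge0; first by apply: divr_ge0 => //; exact: ltW al0.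
  by apply: Ex_ge0 => w; rewrite mulr_ge0// sqr_ge0.
apply: ler_sum => j _; rewrite -Ex_sum; last mbt.
rewrite -!ExZ; [|mbt|mbt].
apply: Ex_le; [mbt|mbt|move=> w].
rewrite /nk -mulr_sumr mulrCA [leRHS]mulrCA ler_wpM2l//.
apply: le_trans (count_large j w) _.
rewrite mulrCA -mulrA ler_wpM2l// mulrC.
have al_inv : 0 <= al^-1 by rewrite invr_ge0; exact: ltW al0.
rewrite mulrC; apply: le_trans (large_Yg j w) _.
by rewrite mulrC; apply: ler_wpM2l.
Qed.

Let nk_sqr : al * \sum_(k < kap) (K * \sum_(j in G) E (fun w => nk k j w ^+ 2)) <= 2 * be.
Proof.
apply: (@le_trans _ _ (2 * (K * \sum_j E (fun w => `|xi j w| ^+ 2 * Bg j w)))); last first.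
  by apply: ler_wpM2l => //; exact: sum_xi2_Bg.
rewrite -mulr_sumr mulrCA [leRHS]mulrCA ler_wpM2l ?(ltW K0')//.
rewrite exchange_big/= !mulr_sumr.
apply: (@le_trans _ _ (\sum_(j in G) (2 * E (fun w => `|xi j w| ^+ 2 * Bg j w)))); last first.
  apply: sumG_le => j; apply: mulr_ge0 => //.
  by apply: Ex_ge0 => w; rewrite mulr_ge0 ?sqr_ge0 ?Bg_ge0.
apply: ler_sum => j _; rewrite -Ex_sum; last mbt.
rewrite -!ExZ; [|mbt|mbt].
apply: Ex_le; [mbt|mbt|move=> w].
have -> : \sum_(k < kap) nk k j w ^+ 2 =
    `|xi j w| ^+ 2 * \sum_(k < kap) large j w * (k%:R * al <= `|Yg j w|)%R%:R.
  rewrite mulr_sumr; apply: eq_bigr => k _; rewrite /nk exprMn; congr (_ * _).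
  by rewrite /large; case: (al <= _); case: (_ * al <= _); rewrite ?mulr1 ?mul0r ?mulr0 ?expr1n ?expr0n.
rewrite mulrCA [leRHS]mulrCA ler_wpM2l ?sqr_ge0//.
apply: le_trans (count_large j w) _.
have /andP[l0 l1] := large_itv j w.
apply: le_trans (_ : 2 * `|Yg j w| <= _); first by apply: ler_piMl => //; rewrite mulr_ge0.
by rewrite ler_wpM2l// Yg_le_Bg.
Qed.

Let xiY_sqr : K * \sum_(j in G) E (fun w => (xi j w * Yg j w) ^+ 2) <= be.
Proof.
apply: le_trans sum_xi2_Bg; rewrite ler_wpM2l ?(ltW K0')//.
apply: le_trans (sumG_le _) _; first by move=> j; apply: Ex_ge0 => w; exact: sqr_ge0.
apply: ler_sum => j _; apply: Ex_le; [mbt|mbt|move=> w].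
by rewrite exprMn real_normK ?num_real// ler_wpM2l ?sqr_ge0.
Qed.

(** 11/16 = 3/4 - 1/16: the mean of [U] is at least 3/4, and the indices of [nb 4 i0] left out of
    [G] contribute at most (1/4)^2. *)
Let xiY_mean : 11 / 16 <= \sum_(j in G) E (fun w => xi j w * Yg j w).
Proof.
have h : E (Ug [set: I]%SET) = \sum_(j in nb 4 i0) E (fun w => xi j w * Yg j w) +
    \sum_(j in G) E (fun w => xi j w * Yg j w).
  transitivity (\sum_j E (fun w => xi j w * Yg j w)).
    by rewrite -Ex_sum; [apply: eq_Ex => w; exact: Ug_Yg|mbt].
  rewrite (bigID (mem (nb 4 i0)))/=; congr (_ + _).
  by apply: eq_bigl => j; rewrite !inE.
have h2 : \sum_(j in nb 4 i0) E (fun w => xi j w * Yg j w) <= 16^-1.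
  rewrite -Ex_sum; last mbt.
  rewrite -[leRHS](Ex_cst P); apply: Ex_le; [mbt|mbt|move=> w].
  apply: (@le_trans _ _ (\sum_(j in nb 4 i0) `|xi j w| * 4^-1)).
    apply: ler_sum => j _; apply: le_trans (ler_norm _) _.
    by rewrite normrM ler_wpM2l.
  have := sum_abs_le w (cardK i0); rewrite -mulr_suml; lra.
by move: EU1; rewrite ler_norml h; lra.
Qed.

(** [weighted_decouple] with [eps = 1/200], small enough for all the resulting multiples of [q] to
    be absorbed. *)
Let decouple (n : I -> T -> R) s : (forall j, dep X (nb 1 j) (n j)) ->
  `|E (fun w => zeta w * phs s w * \sum_(j in G) n j w) -
    (\sum_(j in G) E (n j)) * q s| <=
  200^-1 * q s + 200 * Ez * (K * \sum_(j in G) E (fun w => n j w ^+ 2)).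
Proof.
move=> dn; have mn j := dep_mb (dn j).
have := @weighted_decouple _ G zeta n DG dz z0 dn (phs s) 200^-1 _ (mphs s) (phs01 s).
rewrite invr_gt0 => /(_ (ltr0n _ 200)).
rewrite -/Ez => h.
have -> : 200 * Ez * (K * \sum_(j in G) E (fun w => n j w ^+ 2)) =
   Ez * (K * \sum_(j in G) E (fun w => n j w ^+ 2)) / 200^-1 by rewrite invrK; ring.
apply: le_trans h.
rewrite le_eqVlt; apply/orP; left; apply/eqP; congr (`|_|).
rewrite /q -ExZ; last by rewrite -/(phs s _); mbt.
rewrite -ExB; [|mbt|by rewrite -/(phs s _); mbt].
by apply: eq_Ex => w; rewrite sumrB /phs; ring.
Qed.

Let main_lower t :
  (11 / 16 - 200^-1) * q t - 200 * be * Ez <=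
  E (fun w => zeta w * phs t w * \sum_(j in G) xi j w * Yg j w).
Proof.
have dn j : dep X (nb 1 j) (fun w => xi j w * Yg j w) by apply: depM.
have := decouple t dn; rewrite ler_norml => /andP[+ _].
have h1 : 11 / 16 * q t <= (\sum_(j in G) E (fun w => xi j w * Yg j w)) * q t.
  by apply: ler_wpM2r; [exact: q_ge0|exact: xiY_mean].
have h2 : 200 * Ez * (K * \sum_(j in G) E (fun w => (xi j w * Yg j w) ^+ 2)) <= 200 * Ez * be.
  by apply: ler_wpM2l xiY_sqr; rewrite mulr_ge0 ?ler0n ?Ez0.
lra.
Qed.

Let upper_n0 t :
  E (fun w => zeta w * phs t w * \sum_(j in G) n0 j w) <= 50^-1 * q t + 1800 * be * Ez.
Proof.
have := decouple t dn0; rewrite ler_norml => /andP[_ +].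
have h1 : (\sum_(j in G) E (n0 j)) * q t <= 3 / 200 * q t.
  by apply: ler_wpM2r; [exact: q_ge0|exact: n0_mean].
have h2 : 200 * Ez * (K * \sum_(j in G) E (fun w => n0 j w ^+ 2)) <= 200 * Ez * (9 * be).
  by apply: ler_wpM2l n0_sqr; rewrite mulr_ge0 ?ler0n ?Ez0.
lra.
Qed.

(** The kernels sit at shifted levels, so [q t] alone cannot absorb them; this is where the a priori
    bound on all of [q] enters. A shift is at most 1/4, which changes the weight [1 + |t|] by less
    than a factor 2, hence [Q = 2 M (1 + |t|)]. *)
Let upper_nk M t : 0 <= M -> (forall s, q s <= M * (1 + `|s|)) ->
  3 * al * \sum_(k < kap)
    (E (fun w => zeta w * phs (t + k%:R * al) w * \sum_(j in G) nk k j w) +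
     E (fun w => zeta w * phs (t - k%:R * al) w * \sum_(j in G) nk k j w)) <=
  3 / 10 * M * (1 + `|t|) + 2400 * be * Ez.
Proof.
move=> M0 qM.
have [Q QE] : exists Q : R, Q = 2 * M * (1 + `|t|) by exists (2 * M * (1 + `|t|)).
pose a1 (k : nat) := \sum_(j in G) E (nk k j).
pose a2 (k : nat) := K * \sum_(j in G) E (fun w => nk k j w ^+ 2).
have Q0 : 0 <= Q by rewrite QE !mulr_ge0// addr_ge0.
have a10 k : 0 <= a1 k.
  apply: sumr_ge0 => j _; apply: Ex_ge0 => w.
  by have /andP[l0 _] := large_itv j w; rewrite /nk !mulr_ge0.
have qs (k : nat) (s : R) : (k < kap)%N -> `|s - t| <= k%:R * al -> q s <= Q.
  move=> /kap_le kk st; apply: le_trans (qM s) _.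
  have s1 : `|s| <= `|t| + 4^-1.
    have -> : s = t + (s - t) by ring.
    by apply: le_trans (ler_normD _ _) _; rewrite lerD2l (le_trans st).
  have -> : Q = M * (2 * (1 + `|t|)) by rewrite QE; ring.
  by rewrite ler_wpM2l//; have := normr_ge0 t; lra.
have one (k : nat) (s : R) : (k < kap)%N -> `|s - t| <= k%:R * al ->
    E (fun w => zeta w * phs s w * \sum_(j in G) nk k j w) <=
    (a1 k + 200^-1) * Q + 200 * Ez * a2 k.
  move=> kk st; have := decouple s (dnk k); rewrite ler_norml => /andP[_ +].
  have h : (a1 k + 200^-1) * q s <= (a1 k + 200^-1) * Q.
    by apply: ler_wpM2l; [rewrite addr_ge0 ?a10 ?invr_ge0 ?ler0n|exact: qs kk st].
  rewrite -/(a1 k) -/(a2 k); lra.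
have step : \sum_(k < kap)
    (E (fun w => zeta w * phs (t + k%:R * al) w * \sum_(j in G) nk k j w) +
     E (fun w => zeta w * phs (t - k%:R * al) w * \sum_(j in G) nk k j w)) <=
    \sum_(k < kap) (2 * Q * a1 k + Q / 100 + 400 * Ez * a2 k).
  apply: ler_sum => k _.
  have ka0 : 0 <= k%:R * al by apply: mulr_ge0 => //; exact: ltW al0.
  have n1 : `|t + k%:R * al - t| <= k%:R * al.
    have -> : t + k%:R * al - t = k%:R * al by ring.
    by rewrite ger0_norm.
  have n2 : `|t - k%:R * al - t| <= k%:R * al.
    have -> : t - k%:R * al - t = - (k%:R * al) by ring.
    by rewrite normrN ger0_norm.
  have := one k _ (ltn_ord k) n1; have := one k _ (ltn_ord k) n2; lra.
have al3 : 0 <= 3 * al by apply: mulr_ge0 => //; exact: ltW al0.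
apply: le_trans (ler_wpM2l al3 step) _.
pose s1 := \sum_(i < kap) a1 i; pose s2 := \sum_(i < kap) a2 i.
have -> : \sum_(k < kap) (2 * Q * a1 k + Q / 100 + 400 * Ez * a2 k) =
   2 * Q * s1 + kap%:R * (Q / 100) + 400 * Ez * s2.
  rewrite !big_split/= -!mulr_sumr sumr_const card_ord -[_ *+ kap]mulr_natl.
  by rewrite /s1 /s2 /a2 -mulr_sumr; ring.
have h1 : al * s1 <= 100^-1 by exact: nk_mean.
have h2 : al * s2 <= 2 * be by exact: nk_sqr.
have h3 := kap_al.
move: s1 s2 h1 h2 => s1 s2 h1 h2.
have -> : 3 * al * (2 * Q * s1 + kap%:R * (Q / 100) + 400 * Ez * s2) =
   6 * Q * (al * s1) + 3 / 100 * Q * (al * kap%:R) + 1200 * Ez * (al * s2) by ring.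
have g1 : 6 * Q * (al * s1) <= 6 * Q * 100^-1 by apply: ler_wpM2l h1; rewrite mulr_ge0 ?ler0n ?Q0.
have g2 : 3 / 100 * Q * (al * kap%:R) <= 3 / 100 * Q * 3.
  by apply: ler_wpM2l h3; rewrite mulr_ge0 ?Q0 ?divr_ge0 ?ler0n.
have g3 : 1200 * Ez * (al * s2) <= 1200 * Ez * (2 * be).
  by apply: ler_wpM2l h2; rewrite mulr_ge0 ?ler0n ?Ez0.
have -> : 3 / 10 * M * (1 + `|t|) = 3 / 20 * Q by rewrite QE; field.
apply: le_trans (lerD (lerD g1 g2) g3) _.
by rewrite le_eqVlt; apply/orP; left; apply/eqP; field.
Qed.

(** Write [hh(T)] as the increment sought, plus the drift of [psi(U)], plus the value with [nb 1 j]
    removed. The constant is 981 = 900 + 64 + 17, with 900 from [9/2 * al]. *)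
Let increments t :
  `|E (fun w => zeta w * \sum_(j in G) xi j w * (hh t (Ts w) - hh t (Ts w - Yg j w)))| <=
  (981 * be + 17 * be * `|t|) * Ez.
Proof.
have m1 : bmeas (fun w => hh t (Ts w)) by rewrite /hh; mbt.
have m2 j : bmeas (fun w => hh t (Ts w - Yg j w)) by rewrite /hh; mbt.
have m3 j : bmeas (fun w => hh t (level_gap a (~: nb 1 j)%SET w)) by rewrite /hh; mbt.
have e : E (fun w => zeta w * \sum_(j in G) xi j w * (hh t (Ts w) - hh t (Ts w - Yg j w))) =
  E (fun w => zeta w * Sg G w * hh t (Ts w)) -
  (\sum_(j in G) E (fun w => zeta w * xi j w * hh t (level_gap a (~: nb 1 j)%SET w)) +
   \sum_(j in G) E (fun w => zeta w * xi j w *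
     (hh t (Ts w - Yg j w) - hh t (level_gap a (~: nb 1 j)%SET w)))).
  rewrite -big_split/=.
  rewrite (eq_bigr (fun j => E (fun w => zeta w * xi j w * hh t (level_gap a (~: nb 1 j)%SET w) +
     zeta w * xi j w * (hh t (Ts w - Yg j w) - hh t (level_gap a (~: nb 1 j)%SET w))))); last first.
    by move=> j _; rewrite ExD; [|mbt|mbt].
  rewrite -Ex_sum; last mbt.
  rewrite -ExB; [|mbt|mbt].
  apply: eq_Ex => w; rewrite -[zeta w * Sg G w * _]mulrA /Sg mulr_suml.
  apply/eqP; rewrite eq_sym subr_eq eq_sym; apply/eqP.
  rewrite !mulr_sumr -big_split/=; apply: eq_bigr => j _; ring.
rewrite e; apply: le_trans (ler_normB _ _) _.
apply: (@le_trans _ _ (9 / 2 * al * Ez + (64 * be * Ez + 17 * be * (1 + `|t|) * Ez))).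
  apply: lerD; first exact: conc_total.
  apply: le_trans (ler_normD _ _) _; apply: lerD.
    by apply: le_trans (ler_norm_sum _ _ _) _; exact: conc_indep.
  by apply: le_trans (ler_norm_sum _ _ _) _; exact: conc_drift.
by rewrite /al; lra.
Qed.

Let conc_step M : 0 <= M -> (forall s, q s <= M * (1 + `|s|)) ->
  forall t, q t <= (8200 * be * Ez + M / 2) * (1 + `|t|).
Proof.
move=> M0 qM t.
have m1 : bmeas (fun w => hh t (Ts w)) by rewrite /hh; mbt.
have m2 j : bmeas (fun w => hh t (Ts w - Yg j w)) by rewrite /hh; mbt.
pose rem w := \sum_(k < kap) (zeta w * phs (t + k%:R * al) w * (\sum_(j in G) nk k j w) +
     zeta w * phs (t - k%:R * al) w * (\sum_(j in G) nk k j w)).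
have mrem : bmeas rem by rewrite /rem; mbt.
have low : E (fun w => zeta w * phs t w * \sum_(j in G) xi j w * Yg j w) -
   (E (fun w => zeta w * phs t w * \sum_(j in G) n0 j w) + 3 * al * E rem) <=
   E (fun w => zeta w * \sum_(j in G) xi j w * (hh t (Ts w) - hh t (Ts w - Yg j w))).
  rewrite -ExZ// -ExD; [|mbt|mbt]; rewrite -ExB; [|mbt|mbt].
  apply: Ex_le; [mbt|mbt|move=> w].
  have -> : zeta w * phs t w * (\sum_(j in G) xi j w * Yg j w) -
     (zeta w * phs t w * (\sum_(j in G) n0 j w) + 3 * al * rem w) =
     zeta w * (\sum_(j in G) (xi j w * Yg j w * phs t w - (n0 j w * phs t w +
       3 * al * \sum_(k < kap) nk k j w * (phs (t + k%:R * al) w + phs (t - k%:R * al) w)))).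
    rewrite sumrB mulrBr big_split/= mulrDr -mulr_suml -[X in _ - (X + _)]mulrA.
    rewrite -[X in _ = _ - (_ * X + _)]mulr_suml -mulr_sumr exchange_big/=.
    have -> : rem w = zeta w * (\sum_(k < kap) \sum_(j in G)
        nk k j w * (phs (t + k%:R * al) w + phs (t - k%:R * al) w)).
      rewrite /rem mulr_sumr; apply: eq_bigr => k _.
      by rewrite -mulr_suml; ring.
    by ring.
  rewrite ler_wpM2l//; apply: ler_sum => j _.
  have := remainder_pointwise t j w; rewrite ler_norml => /andP[+ _]; lra.
have remE : E rem = \sum_(k < kap)
    (E (fun w => zeta w * phs (t + k%:R * al) w * \sum_(j in G) nk k j w) +
     E (fun w => zeta w * phs (t - k%:R * al) w * \sum_(j in G) nk k j w)).
  rewrite /rem Ex_sum; last mbt.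
  by apply: eq_bigr => k _; rewrite ExD//; mbt.
have := upper_nk t M0 qM; rewrite -remE => r1.
have r2 := upper_n0 t; have r3 := main_lower t.
have := increments t; rewrite ler_norml => /andP[_ r4].
(* 53/80 = 11/16 - 1/200 - 1/50 and 5381 = 981 + 200 + 1800 + 2400. Dividing by 53/80 leaves a
   coefficient of [M] below 1/2, as the contraction requires. *)
have r5 : (53 / 80) * q t <= (5381 * be * Ez + 3 / 10 * M) * (1 + `|t|).
  have t0 : 0 <= be * Ez * `|t| by rewrite !mulr_ge0 ?Ez0 ?(ltW be_gt0).
  by have := Ez0; lra.
have bE : 0 <= be * Ez by rewrite mulr_ge0 ?Ez0 ?(ltW be_gt0).
have : (5381 * be * Ez + 3 / 10 * M) * (1 + `|t|) <=
   53 / 80 * (8200 * be * Ez + M / 2) * (1 + `|t|).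
  by rewrite ler_wpM2r ?addr_ge0//; lra.
lra.
Qed.

(** The bound is linear in the mean of [zeta] and uniform in [a]. The contraction starts from the
    crude bound [q <= E zeta], which holds since [phi <= 1]. *)
Lemma weighted_concentration t :
  E (fun w => zeta w * phi ((level_gap a [set: I]%SET w - t) / (200 * be))) <=
  16400 * be * Ez * (1 + `|t|).
Proof.
have bE : 0 <= 8200 * be * Ez by rewrite !mulr_ge0 ?ler0n ?Ez0 ?(ltW be_gt0).
have -> : 16400 * be * Ez = 2 * (8200 * be * Ez) by ring.
apply: (weighted_fixpoint (q := q) bE Ez0 _ conc_step) => s.
rewrite -[leLHS]mulr1; apply: ler_pM; [exact: q_ge0|by []| |by rewrite lerDl].
apply: Ex_le; [exact: (mbM mz (mphs s))|exact: mz|move=> w].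
by rewrite ler_piMr// phi_le1.
Qed.

End concentration.

(** * Concentration near the level, summed over the field *)

Let be0 : 0 <= be. Proof. exact: ltW. Qed.

Lemma xi_Bg2_Sg i :
  E (fun w => `|xi i w| * Bg i w ^+ 2 * `|Sg (~: nb 3 i)%SET w|) <=
  9 / 4 * E (fun w => `|xi i w| * Bg i w ^+ 2).
Proof.
rewrite (@Ex_far (nb 2 i) (~: nb 3 i)%SET (fun w => `|xi i w| * Bg i w ^+ 2)
  (fun w => `|Sg (~: nb 3 i)%SET w|)).
- rewrite mulrC ler_wpM2r//.
    by apply: Ex_ge0 => w; rewrite mulr_ge0// sqr_ge0.
  have h w : `|Sg [set: I]%SET w - Sg (~: nb 3 i)%SET w| <= 4^-1.
    by apply: Sg_near; exact: card_nb.
  by have := Ex_abs_Sg_near h; lra.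
- exact: far_nbC.
- apply: depM; first by apply: dep_norm; apply: dep_xi; exact: nb_self.
  by apply: depX; exact: dep_Bg.
- by apply: dep_norm; exact: dep_Sg.
Qed.

(** The common form of the third-order errors in Stein's equation. The sum off [nb 3 i] is
    independent of [nb 2 i], so its absolute value contributes only its mean, at most 9/4. *)
Lemma sum_xi_Bg2_affine (s : I -> T -> R) (a b : R) : 0 <= a -> 0 <= b ->
  (forall i, bmeas (s i)) ->
  (forall i w, s i w <= `|xi i w| * Bg i w ^+ 2 * (a * `|Sg (~: nb 3 i)%SET w| + b)) ->
  \sum_i E (s i) <= (9 / 4 * a + b) * be.
Proof.
move=> a0 b0 ms sle.
apply: (@le_trans _ _ (\sum_i (9 / 4 * a + b) * E (fun w => `|xi i w| * Bg i w ^+ 2))).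
  apply: ler_sum => i _.
  apply: (@le_trans _ _ (E (fun w => a * (`|xi i w| * Bg i w ^+ 2 * `|Sg (~: nb 3 i)%SET w|) +
      b * (`|xi i w| * Bg i w ^+ 2)))).
    apply: Ex_le; [exact: ms|mbt|move=> w].
    by apply: le_trans (sle i w) _; rewrite mulrDr; lra.
  rewrite ExD; [|mbt|mbt]; rewrite !ExZ; [|mbt|mbt].
  have := ler_wpM2l a0 (xi_Bg2_Sg i).
  by move: (E _) (E _) => A B h; lra.
by rewrite -mulr_sumr ler_wpM2l ?sum_xi_Bg2// addr_ge0// mulr_ge0.
Qed.

Lemma Ug_variance : E (fun w => (Ug [set: I]%SET w - E (Ug [set: I]%SET)) ^+ 2) <= be.
Proof.
have dn j : dep X (nb 1 j) (fun w => xi j w * Yg j w).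
  by apply: depM; [apply: dep_xi; exact: nb_self|exact: dep_Yg].
have := @weighted_variance finset.set0 [set: I]%SET (fun=> 1) (fun j w => xi j w * Yg j w)
  _ (dep_cst _ _ _) (fun=> ler01) dn.
rewrite Ex_cst mul1r => /(_ _)/le_trans h.
have : E (fun w => 1 * (\sum_(j in [set: I]%SET)
    (xi j w * Yg j w - E (fun w => xi j w * Yg j w))) ^+ 2) <= be.
  apply: h; first by move=> j b c _ _; rewrite finset.in_set0.
  apply: le_trans sum_xi2_Bg; rewrite ler_wpM2l ?(ltW K0')//.
  under eq_bigl do rewrite finset.in_setT.
  apply: ler_sum => j _; apply: Ex_le; [mbt|mbt|move=> w].
  rewrite exprMn real_normK ?num_real// ler_wpM2l ?sqr_ge0//.
  rewrite -real_normK ?num_real//; apply: le_trans (Yg_le_Bg j w).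
  rewrite expr2 ler_piMl// (le_trans (Yg_le_Bg j w))// (le_trans (Bg_le j w))//.
  by rewrite invf_le1// ler1n.
apply: le_trans; rewrite le_eqVlt; apply/orP; left; apply/eqP; apply: eq_Ex => w.
rewrite mul1r; congr (_ ^+ 2).
under [RHS]eq_bigl do rewrite finset.in_setT.
rewrite sumrB Ug_Yg; congr (_ - _).
by rewrite -Ex_sum; [apply: eq_Ex => v; exact: Ug_Yg|mbt].
Qed.

Definition Wg (w : T) : R := Sg [set: I]%SET w * (psi (Ug [set: I]%SET w))^-1.

Lemma mb_Wg : bmeas Wg. Proof. by rewrite /Wg; mbt. Qed.

Lemma Wg_le w : `|Wg w| <= 2 * `|Sg [set: I]%SET w|.
Proof. by rewrite normrM mulrC ler_wpM2r// invpsi_norm_le. Qed.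

Definition L1 : R := \sum_i E (fun w => `|xi i w * Yg i w|).

(** The radius is random, through [Y_i]. Cover the interval by levels [k * al] and put the indicator
    that the radius reaches level [k] into the weight [ze k i], which still depends on [nb 1 i]
    only. All levels satisfy [|s| <= 5], so the factor [1 + |s|] is at most 6, and 24 = 2 * 2 *
    6. *)
Lemma near_level z : \sum_i E (fun w => `|xi i w * Yg i w| *
    (`|level_gap z [set: I]%SET w| <= 4 * `|Yg i w| + 2 * (200 * be))%R%:R) <=
  24 * 16400 * be * (1 + 3 * L1).
Proof.
pose al := 200 * be; pose Ts := level_gap z [set: I]%SET.
have al0 : 0 < al by rewrite mulr_gt0 ?ltr0n.
have al2 : al <= 2 by rewrite /al; have := be_small; lra.
pose rho i w := 4 * `|Yg i w| + 2 * al.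
pose kap := (Num.truncn (al^-1 + 2)).+1.
have kapg : al^-1 + 2 < kap%:R by exact: truncnS_gt.
have ai0 : 0 <= al^-1 by rewrite invr_ge0 ltW.
have kaple (k : nat) : (k < kap)%N -> k%:R * al <= 5.
  rewrite ltnS => kk.
  have : k%:R <= al^-1 + 2.
    apply: (@le_trans _ _ (Num.truncn (al^-1 + 2))%:R); first by rewrite ler_nat.
    by rewrite truncn_le// addr_ge0.
  move/(ler_wpM2r (ltW al0)) => /le_trans; apply.
  by rewrite mulrDl mulVf ?gt_eqF//; lra.
pose ze (k : nat) i w := `|xi i w * Yg i w| * (k%:R * al <= rho i w)%R%:R.
have dze k i : dep X (nb 1 i) (ze k i).
  have dY : dep X (nb 1 i) (Yg i) by exact: dep_Yg.
  apply: depM.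
    by apply: dep_norm; apply: depM => //; apply: dep_xi; exact: nb_self.
  apply: dep_le; first exact: dep_cst.
  apply: depD; last exact: dep_cst.
  by apply: depM; [exact: dep_cst|exact: dep_norm].
have ze0 k i w : 0 <= ze k i w by rewrite /ze mulr_ge0.
have mze k i := dep_mb (dze k i).
have mTs : bmeas Ts by exact: mb_Tst.
have Y4 i w : `|Yg i w| <= 4^-1 by exact: le_trans (Yg_le_Bg i w) (Bg_le i w).
have pw i w : `|xi i w * Yg i w| * (`|Ts w| <= rho i w)%R%:R <=
   2 * \sum_(k < kap) (ze k i w * phi ((Ts w - k%:R * al) / al) +
                        ze k i w * phi ((Ts w - - (k%:R * al)) / al)).
  have -> : \sum_(k < kap) (ze k i w * phi ((Ts w - k%:R * al) / al) +
      ze k i w * phi ((Ts w - - (k%:R * al)) / al)) =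
      `|xi i w * Yg i w| * \sum_(k < kap) (k%:R <= rho i w / al)%R%:R *
        (phi (Ts w / al - k%:R) + phi (Ts w / al + k%:R)).
    rewrite mulr_sumr; apply: eq_bigr => k _.
    have -> : (Ts w - k%:R * al) / al = Ts w / al - k%:R by field; rewrite gt_eqF.
    have -> : (Ts w - - (k%:R * al)) / al = Ts w / al + k%:R by field; rewrite gt_eqF.
    by rewrite /ze ler_pdivlMr//; ring.
  rewrite mulrCA ler_wpM2l//; case: (leP `|Ts w| (rho i w)) => h; last first.
    rewrite mulr_ge0// sumr_ge0// => k _; rewrite mulr_ge0//.
    by rewrite addr_ge0// ltW// phi_gt0.
  apply: indic_le_phi.
    by rewrite normrM (gtr0_norm (_ : 0 < al^-1)) ?invr_gt0// ler_wpM2r.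
  apply: le_lt_trans kapg; rewrite /rho mulrDl mulfK ?gt_eqF// lerD2r.
  by rewrite ler_piMl//; have := Y4 i w; lra.
have one k i (s : R) : `|s| <= 5 ->
    E (fun w => ze k i w * phi ((Ts w - s) / al)) <= 6 * 16400 * be * E (ze k i).
  move=> s5; have := @weighted_concentration i (ze k i) z (dze k i) (ze0 k i) s.
  move=> /le_trans; apply.
  have Ez0 : 0 <= E (ze k i) by exact: Ex_ge0.
  have : 16400 * be * E (ze k i) * (1 + `|s|) <= 16400 * be * E (ze k i) * 6.
    by apply: ler_wpM2l; [rewrite !mulr_ge0 ?ler0n|lra].
  by move=> /le_trans; apply; lra.
apply: (@le_trans _ _ (\sum_i 24 * 16400 * be * E (fun w => \sum_(k < kap) ze k i w))).
  apply: ler_sum => i _.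
  apply: (@le_trans _ _ (E (fun w => 2 * \sum_(k < kap)
      (ze k i w * phi ((Ts w - k%:R * al) / al) +
       ze k i w * phi ((Ts w - - (k%:R * al)) / al))))).
    by apply: Ex_le; [rewrite /Ts; mbt|mbt|exact: pw].
  rewrite ExZ; last mbt.
  rewrite Ex_sum; last mbt.
  rewrite [in leRHS]Ex_sum; last by move=> k _; exact: mze.
  rewrite !mulr_sumr; apply: ler_sum => k _.
  rewrite ExD; [|mbt|mbt].
  have ka0 : 0 <= k%:R * al by rewrite mulr_ge0// ltW.
  have h1 := one k i (k%:R * al); have h2 := one k i (- (k%:R * al)).
  rewrite normrN ger0_norm// in h1 h2.
  have := h1 (kaple _ (ltn_ord k)); have := h2 (kaple _ (ltn_ord k)); lra.
rewrite -mulr_sumr; apply: ler_wpM2l; first by rewrite !mulr_ge0 ?ler0n.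
(* The number of levels is at most [4 |Y_i| / al + 3]: the first part gives a third-order sum over
   [al], below 1, the second gives [3 * L1]. *)
apply: (@le_trans _ _ (\sum_i (4 / al * E (fun w => `|xi i w| * Bg i w ^+ 2) +
    3 * E (fun w => `|xi i w * Yg i w|)))).
  apply: ler_sum => i _; rewrite -!ExZ; [|mbt|mbt]; rewrite -ExD; [|mbt|mbt].
  apply: Ex_le; [mbt|mbt|move=> w].
  rewrite /ze -mulr_sumr.
  have rh0 : 0 <= rho i w / al by rewrite divr_ge0 ?(ltW al0)// addr_ge0// mulr_ge0// ltW.
  have := @count_le R kap (rho i w / al) rh0.
  have -> : \sum_(k < kap) (k%:R <= rho i w / al)%R%:R =
      \sum_(k < kap) (k%:R * al <= rho i w)%R%:R :> R.
    by apply: eq_bigr => k _; rewrite ler_pdivlMr.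
  move=> c1; apply: le_trans (ler_wpM2l (normr_ge0 _) c1) _.
  have -> : rho i w / al + 1 = 4 / al * `|Yg i w| + 3.
    by rewrite /rho; field; rewrite gt_eqF.
  rewrite mulrDr [_ * 3]mulrC lerD2r mulrCA ler_wpM2l ?divr_ge0 ?(ltW al0)//.
  rewrite normrM -mulrA ler_wpM2l// -expr2 lerXn2r ?nnegrE ?Bg_ge0//.
  exact: Yg_le_Bg.
rewrite big_split/= -!mulr_sumr lerD2r.
apply: (@le_trans _ _ (4 / al * be)); first by rewrite ler_wpM2l ?divr_ge0 ?(ltW al0)// sum_xi_Bg2.
have -> : 4 / al * be = 50^-1 by rewrite /al; field; rewrite gt_eqF.
by rewrite invf_le1 ?ler1n ?ltr0n.
Qed.

(** * Normal approximation of the clamped statistic *)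

Section stein_bound.
Variables (z : R).
Let al := 200 * be.
Let al0 : 0 < al. Proof. by rewrite mulr_gt0 ?ltr0n. Qed.
Let rp := ramp z al.
Let c := gauss_mean rp.

Section with_solution.
Variable f : R -> R.
Let f' (w : R) : R := w * f w + (rp w - c).
Hypothesis df : forall w, is_derive w (1 : R) f (f' w).
Hypothesis f6 : forall w : R, `|f w| <= 6.
Hypothesis wf1 : forall w : R, `|w * f w| <= 1.

Let c01 : 0 <= c <= 1.
Proof.
apply/andP; split; [apply: gauss_mean_ge0|apply: gauss_mean_le1];
  do ?[exact: ramp_continuous|by move=> x; exact: ramp_itv].
Qed.

Let f'2 (w : R) : `|f' w| <= 2.
Proof.
have /andP[r0 r1] := @ramp_itv R z al w; have /andP[c0 c1] := c01.
have := wf1 w; rewrite !ler_norml /f' /rp; lra.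
Qed.

Let cf : continuous f.
Proof.
by move=> x; apply: differentiable_continuous; apply/derivable1_diffP; case: (df x).
Qed.

Let crp : continuous rp. Proof. exact: ramp_continuous. Qed.

Let cf' : continuous f'.
Proof.
move=> x; apply: cvgD; last by apply: cvgB; [exact: crp|exact: cvg_cst].
by apply: cvgM; [exact: cvg_id|exact: cf].
Qed.

Let f_lip (x y : R) : `|f x - f y| <= 2 * `|x - y|.
Proof. by have [u [_ ->]] := mean_value y x df; rewrite normrM ler_wpM2r. Qed.

Let mbf g : bmeas g -> bmeas (fun t : T => f (g t)).
Proof. by apply: mb_comp; [exact: cf|exact: f6]. Qed.

Let mbf' g : bmeas g -> bmeas (fun t : T => f' (g t)).
Proof. by apply: mb_comp; [exact: cf'|exact: f'2]. Qed.

Let mW : bmeas Wg. Proof. exact: mb_Wg. Qed.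

Let rho i w := 4 * `|Yg i w| + 2 * al.
Let ind i w := (`|level_gap z [set: I]%SET w| <= rho i w)%R%:R : R.
Let V w := psi (Ug [set: I]%SET w).
(** Chosen so that [S * gg S U = W f(W)]: numerator and normaliser are separate arguments and can be
    modified one at a time. *)
Let gg (s u : R) : R := f (s * (psi u)^-1) * (psi u)^-1.

Let gg_le (s u : R) : `|gg s u| <= 12.
Proof.
rewrite normrM; have := f6 (s * (psi u)^-1); have := @invpsi_norm_le R u.
by move=> a b; apply: le_trans (ler_pM _ _ b a) _ => //; rewrite -natrM.
Qed.

(** The ramp part of [f'] is not expanded at slope [1/al]: its increment is at most 1 and vanishes
    unless [w] is within [|y|] of the sloping interval. Only the probability of this event is
    needed. *)
Let f'_mod (w y : R) : `|y| <= 2^-1 ->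
  `|f' (w - y) - f' w| <= (6 + 2 * `|w|) * `|y| +
     ((z - `|y| <= w) && (w <= z + al + `|y|))%R%:R.
Proof.
move=> y2.
have -> : f' (w - y) - f' w = (- y * f (w - y) + w * (f (w - y) - f w)) + (rp (w - y) - rp w).
  by rewrite /f'; ring.
apply: le_trans (ler_normD _ _) _; apply: lerD.
  apply: le_trans (ler_normD _ _) _; rewrite !normrM normrN mulrDl.
  apply: lerD; first by rewrite mulrC ler_wpM2r.
  have := f_lip (w - y) w; have -> : w - y - w = - y by ring.
  by rewrite normrN => h; rewrite [2 * _]mulrC -mulrA ler_wpM2l.
have /andP[r0 r1] := @ramp_itv R z al w; have /andP[r2 r3] := @ramp_itv R z al (w - y).
have [h1|h1] := leP (z - `|y|) w; have [h2|h2] := leP w (z + al + `|y|) => /=.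
- by rewrite ler_norml /rp; lra.
- rewrite /rp !ramp_zero ?subrr ?normr0//; have := ler_norm y; have := normr_ge0 y; lra.
- rewrite /rp !ramp_one ?subrr ?normr0//; have := ler_norm (- y); rewrite normrN;
    have := normr_ge0 y; lra.
- rewrite /rp !ramp_one ?subrr ?normr0//; have := ler_norm (- y); rewrite normrN;
    have := normr_ge0 y; lra.
Qed.

(** Multiplying [|W - z| <= 2 |Y_i| + al] by [psi(U) <= 2] turns closeness of [W] to the ramp into
    closeness of [level_gap] to 0, the event treated in [near_level]. *)
Let f'_ind i w (y : R) : `|y| <= 2 * `|Yg i w| ->
  (((z - `|y| <= Wg w) && (Wg w <= z + al + `|y|))%R%:R : R) <= ind i w.
Proof.
move=> yY; rewrite /ind; case: (boolP (_ && _)) => [|_]; last by rewrite /= ler0n.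
move=> /andP[h1 h2].
have /andP[v1 v2] := @psi_itv R (Ug [set: I]%SET w).
have V0 : 0 < V w by rewrite /V; lra.
have -> : level_gap z [set: I]%SET w = V w * (Wg w - z).
  by rewrite /level_gap /Wg -/(V w); field; rewrite gt_eqF.
have a0 : 0 <= al by exact: ltW al0.
have dW : `|Wg w - z| <= 2 * `|Yg i w| + al by rewrite ler_norml; lra.
suff -> : `|V w * (Wg w - z)| <= rho i w by [].
rewrite normrM (gtr0_norm V0).
apply: le_trans (ler_pM (ltW V0) (normr_ge0 _) v2 dW) _; rewrite /rho; lra.
Qed.

(** With [U] frozen, the mean value theorem gives [f'] at a point within [2 |Y_i|] of [W]; [f'_mod]
    moves it to [W]. *)
Let taylor i w :
  `|xi i w * (gg (Sg [set: I]%SET w) (Ug [set: I]%SET w) -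
     gg (Sg [set: I]%SET w - Yg i w) (Ug [set: I]%SET w)) -
    xi i w * Yg i w * (V w ^- 2 * f' (Wg w))| <=
  `|xi i w| * Bg i w ^+ 2 * (48 + 32 * `|Sg [set: I]%SET w|) +
  4 * (`|xi i w * Yg i w| * ind i w).
Proof.
set S := Sg [set: I]%SET w; set Y := Yg i w; pose v := (V w)^-1.
have v2 : `|v| <= 2 by exact: invpsi_norm_le.
have WE : Wg w = S * v by [].
have [u [ub fu]] := mean_value (S * v - Y * v) (S * v) df.
pose y := Wg w - u.
have Y4 : `|Y| <= 4^-1 by exact: le_trans (Yg_le_Bg i w) (Bg_le i w).
have yv : `|y| <= `|Y * v|.
  rewrite /y WE; case: (ger0P (S * v - u)) => h1; case: (ger0P (Y * v)) => h2;
  by case: ub => /andP[]; lra.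
have Yv : `|Y * v| <= 2 * `|Y| by rewrite normrM mulrC ler_wpM2r.
have -> : xi i w * (gg S (Ug [set: I]%SET w) - gg (S - Y) (Ug [set: I]%SET w)) -
    xi i w * Y * (V w ^- 2 * f' (Wg w)) = xi i w * Y * v ^+ 2 * (f' u - f' (Wg w)).
  have -> : gg S (Ug [set: I]%SET w) - gg (S - Y) (Ug [set: I]%SET w) = v * (f' u * (Y * v)).
    rewrite /gg -/(V w) -/v -mulrBl mulrC mulrBl fu; congr (_ * (_ * _)); ring.
  by rewrite -exprVn -/v; ring.
have uE : u = Wg w - y by rewrite /y; ring.
rewrite uE !normrM.
have y2 : `|y| <= 2^-1 by lra.
have := f'_mod (Wg w) y2.
have := @f'_ind i w y (le_trans yv Yv).
set A := `|f' _ - _|; set J : R := (_ && _)%:R => JI AJ.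
have Wle : `|Wg w| <= 2 * `|S| by exact: Wg_le.
have A1 : A <= (12 + 8 * `|S|) * `|Y| + ind i w.
  apply: le_trans AJ _; apply: lerD => //.
  have -> : (12 + 8 * `|S|) * `|Y| = (6 + 4 * `|S|) * (2 * `|Y|) by ring.
  by apply: ler_pM; rewrite ?addr_ge0 ?mulr_ge0//; lra.
have vv : `|v| * `|v| <= 4.
  by apply: le_trans (ler_pM (normr_ge0 _) (normr_ge0 _) v2 v2) _; lra.
have x0 : 0 <= `|xi i w| * `|Y| by rewrite mulr_ge0.
apply: (@le_trans _ _ (`|xi i w| * `|Y| * 4 * ((12 + 8 * `|S|) * `|Y| + ind i w))).
  by apply: ler_pM; [rewrite !mulr_ge0|exact: normr_ge0|rewrite ler_wpM2l|exact: A1].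
have -> : `|xi i w| * `|Y| * 4 * ((12 + 8 * `|S|) * `|Y| + ind i w) =
  `|xi i w| * `|Y| ^+ 2 * (48 + 32 * `|S|) + 4 * (`|xi i w| * `|Y| * ind i w) by ring.
rewrite lerD2r ler_wpM2r ?addr_ge0 ?mulr_ge0// ler_wpM2l//.
by rewrite lerXn2r ?nnegrE ?Bg_ge0// Yg_le_Bg.
Qed.

Let S_le F w : `|Sg [set: I]%SET w - Sg F w| <= 4^-1 ->
  `|Sg [set: I]%SET w| <= `|Sg F w| + 4^-1.
Proof.
by move=> h; have := ler_normD (Sg [set: I]%SET w - Sg F w) (Sg F w); rewrite subrK; lra.
Qed.

Let near3 i w : `|Sg [set: I]%SET w - Sg (~: nb 3 i)%SET w| <= 4^-1.
Proof. by apply: Sg_near; exact: card_nb. Qed.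

Let mgg (s u : T -> R) : bmeas s -> bmeas u -> bmeas (fun w => gg (s w) (u w)).
Proof.
move=> ms mu; rewrite /gg; apply: mbM; last exact: mb_invpsi.
by apply: (@mbf (fun w => s w * (psi (u w))^-1)); mbt.
Qed.

Let mind i : bmeas (ind i).
Proof. by rewrite /ind /rho; mbt. Qed.

Let drift i w :
  `|xi i w * (gg (Sg [set: I]%SET w - Yg i w) (Ug [set: I]%SET w) -
     gg (Sg (~: nb 1 i)%SET w) (Ug (~: nb 1 i)%SET w))| <=
  `|xi i w| * Bg i w ^+ 2 * (32 * `|Sg (~: nb 3 i)%SET w| + 64).
Proof.
rewrite Sg_Yg normrM -mulrA ler_wpM2l//.
set s := Sg _ w; set v := (psi (Ug [set: I]%SET w))^-1; set v' := (psi (Ug (~: nb 1 i)%SET w))^-1.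
have -> : gg s (Ug [set: I]%SET w) - gg s (Ug (~: nb 1 i)%SET w) =
   (f (s * v) - f (s * v')) * v + f (s * v') * (v - v') by rewrite /gg -/v -/v'; ring.
have vle : `|v| <= 2 by exact: invpsi_norm_le.
have v'le : `|v'| <= 2 by exact: invpsi_norm_le.
have vv : `|v - v'| <= 8 * Bg i w ^+ 2.
  have /andP[a1 _] := @psi_itv R (Ug [set: I]%SET w).
  have /andP[b1 _] := @psi_itv R (Ug (~: nb 1 i)%SET w).
  have -> : v - v' = (psi (Ug (~: nb 1 i)%SET w) - psi (Ug [set: I]%SET w)) * (v * v').
    by rewrite /v /v'; field; rewrite !gt_eqF//; lra.
  have -> : 8 * Bg i w ^+ 2 = (2 * Bg i w ^+ 2) * (2 * 2) by ring.
  rewrite normrM normrM; apply: ler_pM; rewrite ?mulr_ge0//; last exact: ler_pM.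
  by rewrite distrC; apply: le_trans (psi_lip _ _) _; exact: Ug_near.
have s1 : `|s| <= `|Sg (~: nb 3 i)%SET w| + 2^-1.
  have n1 : `|Sg [set: I]%SET w - s| <= 4^-1 by apply: Sg_near; exact: card_nb.
  have := S_le (near3 i w).
  have -> : s = Sg [set: I]%SET w - (Sg [set: I]%SET w - s) by ring.
  by move=> h; apply: le_trans (ler_normB _ _) _; lra.
apply: le_trans (ler_normD _ _) _; rewrite !normrM.
have h1 : `|f (s * v) - f (s * v')| * `|v| <= 2 * (`|s| * `|v - v'|) * 2.
  by apply: ler_pM => //; rewrite -normrM mulrBr; exact: f_lip.
have h2 : `|f (s * v')| * `|v - v'| <= 6 * `|v - v'| by rewrite ler_wpM2r.
apply: le_trans (lerD h1 h2) _.
have -> : 2 * (`|s| * `|v - v'|) * 2 + 6 * `|v - v'| = `|v - v'| * (4 * `|s| + 6) by ring.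
have -> : Bg i w ^+ 2 * (32 * `|Sg (~: nb 3 i)%SET w| + 64) =
  8 * Bg i w ^+ 2 * (4 * `|Sg (~: nb 3 i)%SET w| + 8) by ring.
by apply: ler_pM => //; lra.
Qed.

(** [W f(W)] is the sum of [t1], where [xi_i] is independent of its cofactor, [t2], the drift of the
    normaliser, and [t3], the increment in [S]. The linear part [t4] of [t3] sums to
    [U psi(U)^-2 f'(W)], which nearly cancels [f'(W)]. *)
Lemma stein_with_solution :
  `|E (fun w => rp (Wg w)) - c| <= 600 * be +
    4 * \sum_i E (fun w => `|xi i w * Yg i w| * ind i w).
Proof.
pose s0 w := Sg [set: I]%SET w; pose u0 w := Ug [set: I]%SET w.
have ms0 : bmeas s0 by exact: mb_Sg.
have mu0 : bmeas u0 by exact: mb_Ug.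
pose t1 i w := xi i w * gg (Sg (~: nb 1 i)%SET w) (Ug (~: nb 1 i)%SET w).
pose t2 i w := xi i w * (gg (s0 w - Yg i w) (u0 w) -
  gg (Sg (~: nb 1 i)%SET w) (Ug (~: nb 1 i)%SET w)).
pose t3 i w := xi i w * (gg (s0 w) (u0 w) - gg (s0 w - Yg i w) (u0 w)).
pose t4 i w := xi i w * Yg i w * (V w ^- 2 * f' (Wg w)).
have mg1 i : bmeas (fun w => gg (Sg (~: nb 1 i)%SET w) (Ug (~: nb 1 i)%SET w)).
  by apply: mgg => //; mbt.
have mg2 i : bmeas (fun w => gg (s0 w - Yg i w) (u0 w)).
  by apply: (mgg (s := fun w => s0 w - Yg i w)) => //; mbt.
have mg3 : bmeas (fun w => gg (s0 w) (u0 w)) by exact: mgg.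
have mV : bmeas (fun w => V w ^- 2).
  rewrite (_ : (fun w => _) = (fun w => (psi (Ug [set: I]%SET w))^-1 ^+ 2)); first mbt.
  by apply/funext => w; rewrite /V exprVn.
have mf'W : bmeas (fun w => f' (Wg w)) by exact: mbf'.
have mt1 i : bmeas (t1 i) by rewrite /t1; mbt.
have mt2 i : bmeas (t2 i) by rewrite /t2; mbt.
have mt3 i : bmeas (t3 i) by rewrite /t3; mbt.
have mt4 i : bmeas (t4 i) by rewrite /t4; mbt.
have b1 : \sum_i `|E (t1 i)| <= 12 * (16 * be).
  apply: (@le_trans _ _ (\sum_i 12 * `|E (xi i)|)); last first.
    by rewrite -mulr_sumr ler_wpM2l ?ler0n.
  apply: ler_sum => i _.
  have -> : E (t1 i) = E (xi i) *
      E (fun w => gg (Sg (~: nb 1 i)%SET w) (Ug (~: nb 1 i)%SET w)).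
    apply: (@Ex_far (nb 0 i) (~: nb 1 i)%SET).
    - exact: far_nbC.
    - by apply: dep_xi; exact: nb_self.
    - have dv : dep X (~: nb 1 i)%SET (fun w => (psi (Ug (~: nb 1 i)%SET w))^-1).
        apply: (@dep_cont _ _ _ _ _ _ _ (fun u => (psi u)^-1) 2).
        + exact: invpsi_continuous.
        + exact: invpsi_norm_le.
        + exact: dep_Ug.
      apply: depM => //; apply: (@dep_cont _ _ _ _ _ _ _ f 6) => //.
      by apply: depM => //; exact: dep_Sg.
  rewrite normrM mulrC ler_wpM2r//.
  apply: le_trans (Ex_abs _ (mg1 i)) _; rewrite -[leRHS](Ex_cst P).
  by apply: Ex_le; [mbt|mbt|move=> w].
have b2 : \sum_i E (fun w => `|t2 i w|) <= (9 / 4 * 32 + 64) * be.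
  by apply: sum_xi_Bg2_affine => [||i|i w]; [exact: ler0n|exact: ler0n|mbt|exact: drift].
have b3 : \sum_i E (fun w => `|t3 i w - t4 i w|) <=
   (9 / 4 * 32 + 56) * be + 4 * \sum_i E (fun w => `|xi i w * Yg i w| * ind i w).
  apply: (@le_trans _ _ (\sum_i (E (fun w => `|xi i w| * Bg i w ^+ 2 *
      (32 * `|Sg (~: nb 3 i)%SET w| + 56)) + 4 * E (fun w => `|xi i w * Yg i w| * ind i w)))).
    apply: ler_sum => i _; rewrite -ExZ; last mbt; rewrite -ExD; [|mbt|mbt].
    apply: Ex_le; [mbt|mbt|move=> w].
    apply: le_trans (taylor i w) _; rewrite lerD2r ler_wpM2l ?mulr_ge0 ?Bg_ge0//.
    by have := S_le (near3 i w); lra.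
  rewrite big_split/= -mulr_sumr lerD2r.
  by apply: sum_xi_Bg2_affine => [||i|i w]; [exact: ler0n|exact: ler0n|mbt|].
(* [1 - U psi(U)^-2] vanishes unless [U] is clamped, and clamping costs at most the variance of
   [U]. *)
have b4 : E (fun w => `|f' (Wg w) - \sum_i t4 i w|) <= 16 * be.
  have e1 : `|E (Ug [set: I]%SET) - 1| <= 4^-1 by exact: EU1.
  apply: (@le_trans _ _ (E (fun w => 16 * (u0 w - E u0) ^+ 2))).
    apply: Ex_le; [mbt|mbt|move=> w].
    have -> : f' (Wg w) - \sum_i t4 i w = f' (Wg w) * (V w ^- 2 * (V w ^+ 2 - u0 w)).
      have /andP[v1 _] := @psi_itv R (Ug [set: I]%SET w).
      rewrite /t4 -mulr_suml -Ug_Yg -/(u0 w); field; rewrite gt_eqF// /V; lra.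
    rewrite [X in X <= _]normrM [X in _ * X <= _]normrM.
    have cl : `|V w ^+ 2 - u0 w| <= 2 * (u0 w - E u0) ^+ 2.
      by rewrite /V psi_sqr distrC; exact: clamp_dist_sq.
    have vi : `|V w ^- 2| <= 4.
      rewrite /V -exprVn normrX; have := @invpsi_norm_le R (Ug [set: I]%SET w) => h.
      have : `|(psi (Ug [set: I]%SET w))^-1| ^+ 2 <= 2 ^+ 2 by rewrite lerXn2r ?nnegrE.
      by move=> /le_trans; apply; lra.
    have -> : 16 * (u0 w - E u0) ^+ 2 = 2 * (4 * (2 * (u0 w - E u0) ^+ 2)) by ring.
    by apply: ler_pM => //; apply: ler_pM.
  by rewrite ExZ; [rewrite ler_wpM2l ?ler0n// Ug_variance|mbt].
have e : E (fun w => rp (Wg w)) - c =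
   E (fun w => f' (Wg w) - \sum_i t4 i w) -
   (\sum_i E (t1 i) + \sum_i E (t2 i) + \sum_i E (fun w => t3 i w - t4 i w)).
  have mrp : bmeas (fun w => rp (Wg w)).
    apply: (@mb_comp _ _ _ rp 1) => //.
    by move=> x; have /andP[r0 r1] := @ramp_itv R z al x; rewrite ger0_norm.
  rewrite -(Ex_cst P c) -ExB//; last exact: mb_cst.
  rewrite -!Ex_sum; [|mbt|mbt|mbt].
  rewrite -!ExD; [|mbt|mbt|mbt|mbt]; rewrite -ExB; [|mbt|mbt].
  apply: eq_Ex => w.
  have -> : rp (Wg w) - c = f' (Wg w) - Wg w * f (Wg w) by rewrite /f'; ring.
  have -> : Wg w * f (Wg w) = \sum_i (t1 i w + t2 i w + t3 i w).
    have -> : Wg w * f (Wg w) = s0 w * gg (s0 w) (u0 w) by rewrite /gg /Wg -/(s0 w); ring.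
    rewrite {1}/s0 /Sg mulr_suml; under eq_bigl do rewrite finset.in_setT.
    by apply: eq_bigr => i _; rewrite /t1 /t2 /t3; ring.
  by rewrite !big_split/= sumrN; ring.
rewrite e; apply: le_trans (ler_normB _ _) _.
have g0 : `|E (fun w => f' (Wg w) - \sum_i t4 i w)| <= 16 * be.
  by apply: le_trans b4; apply: Ex_abs; mbt.
have g1 : `|\sum_i E (t1 i)| <= 12 * (16 * be).
  by apply: le_trans b1; exact: ler_norm_sum.
have g2 : `|\sum_i E (t2 i)| <= (9 / 4 * 32 + 64) * be.
  apply: le_trans b2; apply: le_trans (ler_norm_sum _ _ _) _.
  by apply: ler_sum => i _; apply: Ex_abs.
have g3 : `|\sum_i E (fun w => t3 i w - t4 i w)| <=
   (9 / 4 * 32 + 56) * be + 4 * \sum_i E (fun w => `|xi i w * Yg i w| * ind i w).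
  apply: le_trans b3; apply: le_trans (ler_norm_sum _ _ _) _.
  by apply: ler_sum => i _; apply: Ex_abs; mbt.
apply: le_trans (lerD g0 (le_trans (ler_normD _ _) (lerD (le_trans (ler_normD _ _) (lerD g1 g2)) g3))) _.
have := be0; set RR := \sum_i _; lra.
Qed.

End with_solution.

Lemma stein_bound :
  `|E (fun w => rp (Wg w)) - c| <= 600 * be + 4 * (24 * 16400 * be * (1 + 3 * L1)).
Proof.
have [f [df f6 wf1]] := @stein_solution R rp (@ramp_continuous R z al) (@ramp_itv R z al).
apply: le_trans (stein_with_solution df f6 wf1) _.
by rewrite lerD2l ler_wpM2l ?ler0n// near_level.
Qed.

End stein_bound.

Let Id z w := (Wg w <= z)%R%:R : R.
Let err := 800 * be + 4 * (24 * 16400 * be * (1 + 3 * L1)).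

Let mId z : bmeas (Id z). Proof. by apply: mb_le; [exact: mb_Wg|exact: mb_cst]. Qed.

Let mramp z : bmeas (fun w => ramp z (200 * be) (Wg w)).
Proof.
have al0 : 0 < 200 * be by rewrite mulr_gt0 ?ltr0n.
apply: (@mb_comp _ _ _ (ramp z (200 * be)) 1); last exact: mb_Wg.
  exact: ramp_continuous.
by move=> x; have /andP[r0 r1] := @ramp_itv R z (200 * be) x; rewrite ger0_norm.
Qed.

(** The indicator lies between the ramps starting at [z - al] and at [z]; each moves [Phi] by at
    most [al = 200 be], whence 800 = 600 + 200. *)
Lemma kolmogorov_Wg z : `|E (Id z) - Phi z| <= err.
Proof.
have al0 : 0 < 200 * be by rewrite mulr_gt0 ?ltr0n.
have up : E (Id z) <= Phi z + err.
  have h1 : E (Id z) <= E (fun w => ramp z (200 * be) (Wg w)).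
    apply: Ex_le => // w; rewrite /Id; have [h|h] := leP (Wg w) z.
      by rewrite ramp_one.
    by have /andP[] := @ramp_itv R z (200 * be) (Wg w).
  have := stein_bound z; rewrite ler_norml => /andP[_ h2].
  have /andP[_ h3] := @gauss_mean_ramp R z _ al0.
  rewrite /err; lra.
have low : Phi z - err <= E (Id z).
  have h1 : E (fun w => ramp (z - 200 * be) (200 * be) (Wg w)) <= E (Id z).
    apply: Ex_le => // w; rewrite /Id; have [h|h] := leP (Wg w) z.
      by have /andP[] := @ramp_itv R (z - 200 * be) (200 * be) (Wg w).
    by rewrite ramp_zero//; lra.
  have := stein_bound (z - 200 * be); rewrite ler_norml => /andP[h2 _].
  have /andP[h3 _] := @gauss_mean_ramp R (z - 200 * be) _ al0.
  have := Phi_lip (z - 200 * be) z.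
  have -> : z - (z - 200 * be) = 200 * be by ring.
  rewrite (gtr0_norm al0) => h4; have := ler_norm (Phi z - Phi (z - 200 * be)).
  rewrite /err; lra.
by rewrite ler_norml; lra.
Qed.

Definition s2 : R := \sum_i E (fun w => xi i w ^+ 2).

Lemma s2_ge0 : 0 <= s2.
Proof. by apply: sumr_ge0 => i _; apply: Ex_ge0 => w; exact: sqr_ge0. Qed.

Lemma L1_le : L1 <= K * s2.
Proof.
pose a i := E (fun w => xi i w ^+ 2).
have a0 i : 0 <= a i by apply: Ex_ge0 => w; exact: sqr_ge0.
apply: (@le_trans _ _ (\sum_i \sum_(k in nb 1 i) 2^-1 * (a i + a k))).
  apply: ler_sum => i _.
  apply: (@le_trans _ _ (E (fun w => \sum_(k in nb 1 i) 2^-1 * (xi i w ^+ 2 + xi k w ^+ 2)))).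
    apply: Ex_le; [mbt|mbt|move=> w].
    rewrite normrM; apply: le_trans (ler_wpM2l (normr_ge0 _) (ler_norm_sum _ _ _)) _.
    rewrite mulr_sumr; apply: ler_sum => k _.
    rewrite -[xi i w ^+ 2]real_normK ?num_real// -[xi k w ^+ 2]real_normK ?num_real//.
    by have := sqr_ge0 (`|xi i w| - `|xi k w|); lra.
  rewrite Ex_sum; last mbt.
  apply: ler_sum => k _; rewrite ExZ; last mbt.
  by rewrite ExD; [|mbt|mbt].
have e1 : \sum_i \sum_(k in nb 1 i) a k <= K * \sum_i a i.
  have := @sum_nb_exchange 1 xpredT a isT a0.
  by under eq_bigr do (under eq_bigl do rewrite andbT).
have e2 : \sum_i \sum_(k in nb 1 i) a i <= K * \sum_i a i.
  rewrite mulr_sumr; apply: ler_sum => i _.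
  by rewrite sumr_const -mulr_natl ler_wpM2r// card_nb.
have -> : \sum_i \sum_(k in nb 1 i) 2^-1 * (a i + a k) =
   2^-1 * (\sum_i \sum_(k in nb 1 i) a i + \sum_i \sum_(k in nb 1 i) a k).
  rewrite -big_split/= mulr_sumr; apply: eq_bigr => i _.
  by rewrite -big_split/= mulr_sumr.
rewrite -/(\sum_i a i) in e1 e2 *; rewrite /s2 -/(a _); lra.
Qed.

(** * Centering *)

Section centering.
Variables (cc : I -> R) (rn : R).
Hypothesis cc_itv : forall j, 0 <= cc j <= K.
Hypothesis rn0 : 0 < rn.

(** With [cc j] the size of A_j, exchanging sums makes [Lam] the sum of all [Y_j]. For
    [rn ^+ 2 = n], [Sg * Lam / rn ^+ 2] is then the total centering n Xbar Ybar, and [Vc] is the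
    expression under the square root before taking its positive part. *)
Definition Lam (w : T) : R := \sum_j cc j * xi j w.
Definition Vc (w : T) : R :=
  Ug [set: I]%SET w - Sg [set: I]%SET w * Lam w / rn ^+ 2.

Let th := K * (1 + K * s2).
Let mLam : bmeas Lam. Proof. by rewrite /Lam; mbt. Qed.

Let th_ge : K <= th.
Proof. by rewrite ler_peMr ?(ltW K0')// lerDl mulr_ge0 ?s2_ge0// ltW. Qed.

Let Lam_sqr : E (fun w => Lam w ^+ 2) <= 2 * (K * th).
Proof.
have dn j : dep X (nb 1 j) (fun w => cc j * xi j w).
  by apply: depM; [exact: dep_cst|apply: dep_xi; exact: nb_self].
have v1 : E (fun w => (Lam w - E Lam) ^+ 2) <= K * (K ^+ 2 * s2).
  have := @weighted_variance finset.set0 [set: I]%SET (fun=> 1) (fun j w => cc j * xi j w)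
    _ (dep_cst _ _ _) (fun=> ler01) dn.
  rewrite Ex_cst mul1r => /(_ _)/le_trans h.
  have : E (fun w => 1 * (\sum_(j in [set: I]%SET)
      (cc j * xi j w - E (fun w => cc j * xi j w))) ^+ 2) <= K * (K ^+ 2 * s2).
    apply: h; first by move=> j b c _ _; rewrite finset.in_set0.
    rewrite ler_wpM2l ?(ltW K0')//; under eq_bigl do rewrite finset.in_setT.
    rewrite /s2 mulr_sumr; apply: ler_sum => j _; rewrite -ExZ; last mbt.
    apply: Ex_le; [mbt|mbt|move=> w].
    have /andP[c0 cK] := cc_itv j.
    by rewrite exprMn ler_wpM2r ?sqr_ge0// lerXn2r ?nnegrE// ltW.
  apply: le_trans; rewrite le_eqVlt; apply/orP; left; apply/eqP; apply: eq_Ex => w.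
  rewrite mul1r; congr (_ ^+ 2); under [RHS]eq_bigl do rewrite finset.in_setT.
  by rewrite sumrB /Lam Ex_sum//; mbt.
have m1 : `|E Lam| <= K.
  rewrite /Lam Ex_sum; last mbt.
  apply: le_trans (ler_norm_sum _ _ _) _.
  apply: (@le_trans _ _ (\sum_i K * `|E (xi i)|)).
    apply: ler_sum => i _; rewrite ExZ; last mbt.
    have /andP[c0 cK] := cc_itv i.
    by rewrite normrM ler_wpM2r// ger0_norm.
  rewrite -mulr_sumr ler_piMr ?(ltW K0')//.
  by apply: le_trans small_means _; have := be_small; lra.
have -> : E (fun w => Lam w ^+ 2) = E (fun w => (Lam w - E Lam) ^+ 2) + (E Lam) ^+ 2.
  rewrite -[X in _ = _ + X](Ex_cst P).
  transitivity (E (fun w => (Lam w - E Lam) ^+ 2 + (2 * E Lam * (Lam w - E Lam) + E Lam ^+ 2))).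
    by apply: eq_Ex => w; ring.
  rewrite ExD; [|mbt|mbt]; congr (_ + _).
  rewrite ExD; [|mbt|mbt]; rewrite ExZ; last mbt.
  by rewrite Ex_centered// mulr0 add0r.
have : (E Lam) ^+ 2 <= K ^+ 2.
  by rewrite -real_normK ?num_real// lerXn2r ?nnegrE// ltW.
have := s2_ge0; have K2 : 0 <= K ^+ 2 by exact: sqr_ge0.
have -> : 2 * (K * th) = 2 * K ^+ 2 + 2 * (K * (K ^+ 2 * s2)) by rewrite /th; ring.
have : 0 <= K * (K ^+ 2 * s2) by rewrite !mulr_ge0 ?s2_ge0// ltW.
lra.
Qed.

(** Young's inequality with weight [th]: the second moment of [S] costs [9/4 * th], that of [Lam] at
    most [2 K <= 2 th]. *)
Let SLam : E (fun w => `|Sg [set: I]%SET w * Lam w|) <= 3 * th.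
Proof.
have th0 : 0 < th by apply: lt_le_trans th_ge.
apply: (@le_trans _ _ (E (fun w => 2^-1 * (th * Sg [set: I]%SET w ^+ 2 + th^-1 * Lam w ^+ 2)))).
  apply: Ex_le; [mbt|mbt|move=> w].
  rewrite normrM -[Sg _ w ^+ 2]real_normK ?num_real// -[Lam w ^+ 2]real_normK ?num_real//.
  set a := `|_|; set b := `|_|.
  have := sqr_ge0 (th * a - b); have ti : 0 <= th^-1 by rewrite invr_ge0 ltW.
  move=> /(mulr_ge0 ti); have -> : th^-1 * (th * a - b) ^+ 2 =
    th * a ^+ 2 - 2 * (a * b) + th^-1 * b ^+ 2 by field; rewrite gt_eqF.
  lra.
rewrite ExZ; last mbt; rewrite ExD; [|mbt|mbt]; rewrite !ExZ; [|mbt|mbt].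
have h1 : th * E (fun w => Sg [set: I]%SET w ^+ 2) <= th * (9 / 4).
  by rewrite ler_wpM2l ?(ltW th0)// Ex_S2.
have h2 : th^-1 * E (fun w => Lam w ^+ 2) <= th^-1 * (2 * (K * th)).
  by rewrite ler_wpM2l ?invr_ge0 ?(ltW th0)// Lam_sqr.
have h3 : th^-1 * (2 * (K * th)) = 2 * K by field; rewrite gt_eqF.
by have := th_ge; lra.
Qed.

Variables (Wst bd : T -> R) (de z : R).
Hypothesis mbbd : bmeas bd.
Hypothesis bd0 : forall w, 0 <= bd w.
Hypothesis bdE : E bd <= de.
Hypothesis WstE : forall w, bd w < 1 -> 0 < Vc w ->
  Wst w = Sg [set: I]%SET w / Num.sqrt (Vc w).
Hypothesis mWst : bmeas (fun w => (Wst w <= z)%R%:R : R).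

Let eta := th / rn.
(** Each term is at least 1 on one bad event: [U] at distance 1/2 or more from its mean, a centering
    of size [eta] or more, a truncated summand when [bd] counts these. The mean of [dev] is thus a
    union bound that can be used pointwise. *)
Let dev w := 4 * (Ug [set: I]%SET w - E (Ug [set: I]%SET)) ^+ 2 +
  (`|Sg [set: I]%SET w * Lam w| / (rn ^+ 2 * eta) + bd w).

(** If [dev w >= 1] there is nothing to prove. Otherwise [psi] is the true square root of
    [U >= 1/4], and moving its argument by [eta] multiplies it by a factor in
    [1 - 4 eta, 1 + 4 eta]. This factor is transferred to [z], whose sign decides the direction. *)
Let sandwich w : 0 < eta -> eta <= 16^-1 ->
  [/\ (Wst w <= z)%R%:R <= Id (z * (1 + (if 0 <= z then 4 else - 4) * eta)) w + dev w &
      Id (z * (1 - (if 0 <= z then 4 else - 4) * eta)) w - dev w <= (Wst w <= z)%R%:R].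
Proof.
move=> e0 e16.
set u := Ug [set: I]%SET w; set S := Sg [set: I]%SET w.
have rn2 : 0 < rn ^+ 2 by rewrite exprn_gt0.
have d1 : 0 <= 4 * (u - E (Ug [set: I]%SET)) ^+ 2 by rewrite mulr_ge0// sqr_ge0.
have d2 : 0 <= `|S * Lam w| / (rn ^+ 2 * eta).
  by rewrite divr_ge0// mulr_ge0// ltW.
have d3 := bd0 w.
have bools (b c : bool) : (b%:R : R) <= 1 /\ 0 <= (c%:R : R).
  by case: b; case: c; split; rewrite ?lexx ?ler01.
have [big|small] := leP 1 (dev w).
  have [b1 b2] := bools (Wst w <= z) (Wst w <= z).
  have [b3 _] := bools (Wg w <= z * (1 - (if 0 <= z then 4 else - 4) * eta)) true.
  have [_ b4] := bools true (Wg w <= z * (1 + (if 0 <= z then 4 else - 4) * eta)).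
  by rewrite /Id; split; lra.
have small' : 4 * (u - E (Ug [set: I]%SET)) ^+ 2 +
  (`|S * Lam w| / (rn ^+ 2 * eta) + bd w) < 1 by exact: small.
have dev0 : 0 <= dev w by rewrite /dev -/u -/S; lra.
have := EU1; rewrite ler_norml => /andP[EUl EUr].
have uE : (u - E (Ug [set: I]%SET)) ^+ 2 < 4^-1 by lra.
have u1 : 4^-1 <= u by nra.
have u2 : u <= 4 by nra.
have sl : `|S * Lam w| / rn ^+ 2 <= eta.
  have : `|S * Lam w| / (rn ^+ 2 * eta) <= 1 by lra.
  have re0 : 0 < rn ^+ 2 * eta by exact: mulr_gt0.
  by rewrite (ler_pdivrMr _ _ re0) mul1r (ler_pdivrMr _ _ rn2) [eta * _]mulrC.
have Vb : u - eta <= Vc w <= u + eta.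
  rewrite /Vc -/u -/S.
  have : `|S * Lam w / rn ^+ 2| <= eta.
    by rewrite normrM [X in _ * X]ger0_norm// invr_ge0 ltW.
  by rewrite ler_norml; lra.
have /andP[V1 V2] := Vb.
have Vp : 0 < Vc w by lra.
have We := WstE (_ : bd w < 1) Vp; rewrite We; last lra.
rewrite -/S.
set v := Num.sqrt (Vc w).
have v0 : 0 < v by rewrite sqrtr_gt0.
have vv : v ^+ 2 = Vc w by rewrite sqr_sqrtr// ltW.
pose p := psi u.
have pp : p ^+ 2 = u by rewrite psi_sqr clamp_id// u1.
have /andP[p1 p2] := psi_itv u; rewrite -/p in p1 p2.
have p0 : 0 < p by lra.
have vu : v <= p * (1 + 4 * eta).
  rewrite -(ler_pXn2r (isT : (0 < 2)%N)) ?nnegrE ?(ltW v0)//; last by rewrite mulr_ge0; lra.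
  by rewrite vv exprMn pp; nra.
have vl : p * (1 - 4 * eta) <= v.
  rewrite -(ler_pXn2r (isT : (0 < 2)%N)) ?nnegrE ?(ltW v0)//; last by rewrite mulr_ge0; lra.
  have hq : 1 <= u * (8 - 16 * eta) by nra.
  by have := ler_wpM2l (ltW e0) hq; rewrite vv exprMn pp; lra.
have WgE : Wg w = S / p by [].
rewrite /Id WgE !ler_pdivrMr//.
have zz : (if 0 <= z then 4 else - 4) * z = 4 * `|z| :> R.
  by case: (lerP 0 z) => h; [rewrite ger0_norm|rewrite ltr0_norm//; ring].
have up : z * v <= z * (1 + (if 0 <= z then 4 else - 4) * eta) * p.
  case: (lerP 0 z) zz => h _.
    by rewrite -mulrA ler_wpM2l// mulrC.
  by rewrite -mulrA ler_wnM2l ?(ltW h)//; lra.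
have lo : z * (1 - (if 0 <= z then 4 else - 4) * eta) * p <= z * v.
  case: (lerP 0 z) zz => h _.
    by rewrite -mulrA ler_wpM2l// mulrC.
  by rewrite -mulrA ler_wnM2l ?(ltW h)//; lra.
split.
  have [h|h] := leP S (z * v); first by rewrite (le_trans h up) lerDl.
  by rewrite mulr0n addr_ge0// ler0n.
have [h|h] := leP S (z * (1 - (if 0 <= z then 4 else - 4) * eta) * p).
  by rewrite (le_trans h lo) gerBl.
by rewrite mulr0n lerBlDr addr_ge0// ler0n.
Qed.

Lemma truncated_clt : 0 <= de -> 0 <= E (fun w => (Wst w <= z)%R%:R) <= 1 -> 0 <= Phi z <= 1 ->
  `|E (fun w => (Wst w <= z)%R%:R) - Phi z| <=
  16 * (K * (1 + K * s2)) / rn + 100 * 16400 * be * (1 + 3 * (K * s2)) + de.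
Proof.
move=> de0 /andP[P0 P1] /andP[Q0 Q1].
have th0 : 0 < th by apply: lt_le_trans th_ge.
have e0 : 0 < eta by rewrite divr_gt0.
have -> : 16 * (K * (1 + K * s2)) / rn = 16 * eta by rewrite /eta /th; ring.
have Ks0 : 0 <= K * s2 by rewrite mulr_ge0 ?s2_ge0// ltW.
have Db : 0 <= 100 * 16400 * be * (1 + 3 * (K * s2)).
  by rewrite !mulr_ge0 ?ler0n ?(ltW be_gt0) ?addr_ge0 ?ler01 ?mulr_ge0 ?ler0n ?s2_ge0 ?(ltW K0').
(* For [eta > 1/16] the term [16 * eta] of the bound already exceeds 1. *)
have [e16|e16] := leP eta 16^-1; last by rewrite ler_norml; lra.
have mdev : bmeas dev by rewrite /dev; mbt.
have rn2 : 0 < rn ^+ 2 by rewrite exprn_gt0.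
have edev : E dev <= 4 * be + (3 * eta + de).
  rewrite /dev ExD; [|mbt|mbt]; rewrite ExZ; last mbt.
  rewrite ExD; [|mbt|mbt]; rewrite ExZr; last mbt.
  apply: lerD; first by rewrite ler_wpM2l ?ler0n// Ug_variance.
  have re0 : 0 < rn ^+ 2 * eta by exact: mulr_gt0.
  apply: lerD => //; rewrite (ler_pdivrMr _ _ re0).
  apply: le_trans SLam _.
  have -> : 3 * eta * (rn ^+ 2 * eta) = 3 * th * th by rewrite /eta; field; rewrite gt_eqF.
  by apply: ler_peMr; [rewrite mulr_ge0 ?ler0n ?(ltW th0)|exact: le_trans K1 th_ge].
pose sg : R := if 0 <= z then 4 else - 4.
have sge : `|sg * eta| <= 2^-1.
  rewrite normrM (gtr0_norm e0) /sg; case: ifP => _; rewrite ?normrN ger0_norm//; lra.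
have sge4 : `|sg * eta| <= 4 * eta.
  by rewrite normrM (gtr0_norm e0) /sg; case: ifP => _; rewrite ?normrN ger0_norm.
have k1 := kolmogorov_Wg (z * (1 + sg * eta)).
have k2 := kolmogorov_Wg (z * (1 + - (sg * eta))).
have p1 := Phi_scale z sge.
have p2 : `|Phi (z * (1 + - (sg * eta))) - Phi z| <= 2 * `|sg * eta|.
  by rewrite -[X in 2 * X]normrN; apply: Phi_scale; rewrite normrN.
have i1 : E (fun w => (Wst w <= z)%R%:R) <= E (Id (z * (1 + sg * eta))) + E dev.
  rewrite -ExD//; apply: Ex_le => //; first exact: mbD.
  by move=> w; have [] := sandwich w e0 e16.
have i2 : E (Id (z * (1 + - (sg * eta)))) - E dev <= E (fun w => (Wst w <= z)%R%:R).
  rewrite -ExB//; apply: Ex_le => //; first exact: mbB.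
  by move=> w; have [] := sandwich w e0 e16.
have eb : err + 4 * be <= 100 * 16400 * be * (1 + 3 * (K * s2)).
  have h : be * L1 <= be * (K * s2) by rewrite ler_wpM2l ?L1_le// ltW.
  have bs0 : 0 <= be * (K * s2) by rewrite mulr_ge0// ltW.
  by rewrite /err; have := be_gt0; lra.
have eta16 : 4 * eta * 2 + 3 * eta <= 16 * eta by lra.
move: k1; rewrite ler_norml => /andP[_ a2].
move: k2; rewrite ler_norml => /andP[b1 _].
move: p1; rewrite ler_norml => /andP[_ c2].
move: p2; rewrite ler_norml => /andP[d1 _].
by rewrite ler_norml; apply/andP; split; lra.
Qed.

End centering.

End local_dependence.

(** * Truncation of the original field *)

Section lattice_distance.
Variable d : nat.
Implicit Types i j k : 'rV[int]_d.

Lemma zdist_refl i : zdist i i = 0%N.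
Proof. by rewrite /zdist big1// => k _; rewrite subrr. Qed.

Lemma zdist_sym i j : zdist i j = zdist j i.
Proof. by rewrite /zdist; apply: eq_bigr => k _; rewrite distnC. Qed.

Lemma zdist_triangle i j k : (zdist i k <= zdist i j + zdist j k)%N.
Proof.
apply/bigmax_leqP => l _; apply: leq_trans (leqD_dist _ (j ord0 l) _) _.
by apply: leq_add; rewrite /zdist;
  exact: (leq_bigmax (F := fun l => absz _)).
Qed.

(** Coordinate differences shifted by [r] embed the ball into {0, ..., 2r}^d. *)
Lemma card_ball (J : {fset 'rV[int]_d}) (i : J) (r : nat) :
  (#|[set j : J | (zdist (val i) (val j) <= r)%N]%SET| <= (2 * r).+1 ^ d)%N.
Proof.
set A := [set j : J | _]%SET.
pose c (j : J) : {ffun 'I_d -> 'I_(2 * r).+1} :=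
  [ffun k => inord (absz (val j ord0 k - val i ord0 k + r%:Z))].
rewrite -[X in (_ <= X ^ _)%N]card_ord -[X in (_ <= _ ^ X)%N]card_ord -card_ffun.
have ci : {in A &, injective c}.
  move=> j l; rewrite !inE => jA lA e; apply: val_inj; apply/rowP => k.
  have b (s : J) : (zdist (val i) (val s) <= r)%N ->
      (`|val i ord0 k - val s ord0 k| <= r)%N.
    by move/bigmax_leqP => /(_ k isT).
  have := b _ jA; have := b _ lA; move: e => /ffunP /(_ k); rewrite !ffunE => /(congr1 val).
  move: (val i ord0 k) (val j ord0 k) (val l ord0 k) => a x y /= + la ja.
  by rewrite !inordK; [lia|lia|lia].
by rewrite -(card_in_imset ci); exact: max_card.
Qed.

End lattice_distance.

(** * Calculus of integrable functions *)

Section integrable.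
Context (R : realType) (disp : measure_display) (T : measurableType disp)
  (P : probability T R).
Local Notation E := (Ex P).
Implicit Types f g : T -> R.

Definition integ (f : T -> R) : Prop := P.-integrable setT (EFin \o f).

Lemma ig_mb f : bmeas f -> integ f. Proof. exact: mb_integrable. Qed.

Lemma igD f g : integ f -> integ g -> integ (fun t => f t + g t).
Proof. by move=> hf hg; exact: (integrableD measurableT hf hg). Qed.

Lemma igZ c f : integ f -> integ (fun t => c * f t).
Proof. by move=> hf; exact: (integrableZl measurableT c hf). Qed.

Lemma ig_sum (I : Type) (s : seq I) (p : pred I) (F : I -> T -> R) :
  (forall i, p i -> integ (F i)) -> integ (fun t => \sum_(i <- s | p i) F i t).
Proof.
move=> mF; elim: s => [|i s ih].
  by under eq_fun do rewrite big_nil; apply: ig_mb; exact: mb_cst.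
under eq_fun do rewrite big_cons.
by case: (boolP (p i)) => // pi; apply: igD => //; exact: mF.
Qed.

Lemma ig_le f g : measurable_fun setT f -> integ g -> (forall t, `|f t| <= g t) -> integ f.
Proof.
move=> mf ig_g fg; apply: (le_integrable measurableT _ _ ig_g).
  exact/measurable_EFinP.
by move=> t _; rewrite /= lee_fin (le_trans (fg t))// ler_norm.
Qed.

Lemma ig_Ex_le f g : integ f -> integ g -> (forall t, f t <= g t) -> E f <= E g.
Proof. by move=> hf hg fg; apply: le_Rintegral. Qed.

Lemma ig_ExD f g : integ f -> integ g -> E (fun t => f t + g t) = E f + E g.
Proof. by move=> hf hg; rewrite /Ex RintegralD. Qed.

Lemma ig_ExB f g : integ f -> integ g -> E (fun t => f t - g t) = E f - E g.
Proof. by move=> hf hg; rewrite /Ex RintegralB. Qed.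

Lemma ig_ExZ c f : integ f -> E (fun t => c * f t) = c * E f.
Proof. by move=> hf; rewrite /Ex RintegralZl. Qed.

Lemma ig_Ex_sum (I : Type) (s : seq I) (p : pred I) (F : I -> T -> R) :
  (forall i, p i -> integ (F i)) ->
  E (fun t => \sum_(i <- s | p i) F i t) = \sum_(i <- s | p i) E (F i).
Proof.
move=> mF; elim: s => [|i s ih].
  by rewrite big_nil; under eq_Ex do rewrite big_nil; rewrite Ex_cst.
under eq_Ex do rewrite big_cons.
rewrite big_cons -ih; case: (boolP (p i)) => // pi; rewrite ig_ExD//; first exact: mF.
exact: ig_sum.
Qed.

Lemma ig_Ex_abs f g : integ f -> integ g -> (forall t, `|f t| <= g t) -> `|E f| <= E g.
Proof.
move=> hf hg fg; rewrite ler_norml -mulN1r -ig_ExZ//; apply/andP; split.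
  by apply: ig_Ex_le => [||t]; [exact: igZ| |have := fg t; rewrite ler_norml; lra].
by apply: ig_Ex_le => // t; have := fg t; rewrite ler_norml; lra.
Qed.

Lemma fine_expectation (f : T -> R) : fine ('E_P[f])%E = E f.
Proof. by rewrite unlock. Qed.

End integrable.

(** * Arithmetic of the final bound *)

Section arithmetic.
Context (R : realFieldType) (c M q g b : R).
Hypotheses (c1 : 1 <= c) (M1 : 1 <= M) (q0 : 0 <= q) (g0 : 0 <= g) (b0 : 0 < b).

Let c_ge0 : 0 <= c. Proof. exact: le_trans c1. Qed.
Let M_ge0 : 0 <= M. Proof. exact: le_trans M1. Qed.
Let r := 1 + M * q.
Let r1 : 1 <= r. Proof. by rewrite lerDl mulr_ge0. Qed.
Let h := g + b.
Let h_ge0 : 0 <= h. Proof. by rewrite addr_ge0// ltW. Qed.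

Let pow_le i j : (i <= 4)%N -> (j <= 3)%N ->
  c ^+ i * M ^+ j * r * h <= c ^+ 4 * M ^+ 3 * r * h.
Proof.
move=> i4 j3; apply: ler_wpM2r => //; apply: ler_wpM2r; first exact: le_trans ler01 r1.
by apply: ler_pM; rewrite ?exprn_ge0// ler_weXn2l.
Qed.

(** The case where the smallness parameter [K^2 (gamma + n^(-1/2))] is at least 1/100 and the bound
    exceeds 1. Here [c] is 8^d, [M] is (m+1)^d, [q] is n^(1/3) gamma^(2/3), [g] is gamma and [b] is
    n^(-1/2). *)
Lemma trivial_bound : 100^-1 <= (c * M) ^+ 2 * h ->
  1 <= 1000 * 16400 * (c ^+ 4 * M ^+ 3 * r * h).
Proof.
move=> h1; have := pow_le (i := 2) (j := 2) isT isT.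
have e : (c * M) ^+ 2 * h <= c ^+ 2 * M ^+ 2 * r * h.
  by rewrite exprMn ler_wpM2r// ler_peMr// mulr_ge0// exprn_ge0.
move: (c ^+ 4 * M ^+ 3 * r * h) => y.
lra.
Qed.

(** [1 + 3 K s <= 6 c r] with [r = 1 + M q], so this factor costs no power of [M] beyond the one in
    [r]. Centering then needs [M], smoothing [M^2], and only the truncation term [K^3 g] needs
    [M^3]. *)
Lemma bound_arith s : 0 <= s -> s <= 2 * q ->
  16 * (c * M * (1 + c * M * s)) * b + 100 * 16400 * ((c * M) ^+ 2 * h) * (1 + 3 * (c * M * s))
    + 64 * (c * M) ^+ 3 * g <=
  1000 * 16400 * (c ^+ 4 * M ^+ 3 * r * h).
Proof.
move=> s0 s2; have cM : 0 <= c * M by exact: mulr_ge0.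
have Ks : c * M * s <= 2 * (c * (r - 1)).
  apply: le_trans (ler_wpM2l cM s2) _.
  by rewrite /r le_eqVlt; apply/orP; left; apply/eqP; ring.
have c1' := c1; have cr : 0 <= c * r by rewrite mulr_ge0// (le_trans _ r1).
have k1 : 1 + c * M * s <= 2 * (c * r) by lra.
have k2 : 1 + 3 * (c * M * s) <= 6 * (c * r) by lra.
have bh : b <= h by rewrite lerDr.
have gh : g <= h by rewrite lerDl ltW.
have t1 : c * M * (1 + c * M * s) * b <= 2 * (c ^+ 2 * M ^+ 1 * r * h).
  have -> : 2 * (c ^+ 2 * M ^+ 1 * r * h) = c * M * (2 * (c * r)) * h by ring.
  apply: ler_pM => //; [by rewrite mulr_ge0// addr_ge0// mulr_ge0|exact: ltW|].
  exact: ler_wpM2l.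
have t2 : (c * M) ^+ 2 * h * (1 + 3 * (c * M * s)) <= 6 * (c ^+ 3 * M ^+ 2 * r * h).
  have -> : 6 * (c ^+ 3 * M ^+ 2 * r * h) = (c * M) ^+ 2 * h * (6 * (c * r)) by ring.
  by apply: ler_wpM2l => //; rewrite mulr_ge0// exprn_ge0.
have t3 : (c * M) ^+ 3 * g <= c ^+ 3 * M ^+ 3 * r * h.
  rewrite exprMn; apply: ler_pM => //; first by rewrite mulr_ge0// exprn_ge0.
  by rewrite ler_peMr// mulr_ge0// exprn_ge0.
have := pow_le (i := 2) (j := 1) isT isT.
have := pow_le (i := 3) (j := 2) isT isT.
have := pow_le (i := 3) (j := 3) isT isT.
have y0 : 0 <= c ^+ 4 * M ^+ 3 * r * h.
  by rewrite mulr_ge0// mulr_ge0 ?(le_trans _ r1)// mulr_ge0// exprn_ge0.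
move: (c ^+ 4 * M ^+ 3 * r * h) y0 t1 t2 t3 => y y0.
move: (c ^+ 2 * M ^+ 1 * r * h) (c ^+ 3 * M ^+ 2 * r * h) (c ^+ 3 * M ^+ 3 * r * h).
move=> y1 y2 y3.
move=> *; lra.
Qed.

End arithmetic.

Lemma Phi_itv (R : realType) (z : R) : 0 <= Phi z <= 1.
Proof.
by rewrite -!lee_fin -std_normal_cdfE measure_ge0/= probability_le1.
Qed.

(** * The rescaled and truncated field *)

Section reduction.
Context (R : realType) (disp : measure_display) (T : measurableType disp)
  (P : probability T R) (d m : nat) (J : {fset 'rV[int]_d}) (X : J -> {RV P >-> R}).
Hypothesis J0 : J != fset0.
Hypothesis Xdep : m_dependent X m.

Local Notation E := (Ex P).
Local Notation integ := (integ P).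

Definition jdist (i j : J) : nat := zdist (val i) (val j).

Let jrefl i : jdist i i = 0%N. Proof. exact: zdist_refl. Qed.
Let jsym i j : jdist i j = jdist j i. Proof. exact: zdist_sym. Qed.
Let jtri i j k : (jdist i k <= jdist i j + jdist j k)%N.
Proof. exact: zdist_triangle. Qed.

Lemma jdist_indep (A B : {set J}) :
  (forall i j, i \in A -> j \in B -> (m < jdist i j)%N) ->
  independent_families X [set i | i \in A] [set i | i \in B].
Proof.
move=> AB; apply: Xdep.
apply: (@lt_le_trans _ _ (m.+1%:R : R)%:E); first by rewrite lte_fin ltr_nat.
apply: le_ereal_inf_tmp => _ [_ [i /= iA <-] [_ [j /= jB <-] <-]].
by rewrite lee_fin ler_nat; exact: AB.
Qed.

(** A ball of radius 4m has at most (8m + 1)^d points, and 8m + 1 <= 8 (m + 1); the product form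
    separates the dependence on [m]. *)
Definition Kd : R := (8 ^ d * m.+1 ^ d)%N%:R.

Lemma Kd_ge1 : 1 <= Kd.
Proof. by rewrite /Kd -expnMn ler1n expn_gt0. Qed.

Lemma card_nb4 i : #|nb jdist m 4 i|%:R <= Kd.
Proof.
rewrite ler_nat -expnMn; apply: leq_trans (card_ball i (4 * m)) _.
have h : ((2 * (4 * m)).+1 <= 8 * m.+1)%N by lia.
by elim: d => // k ih; rewrite !expnS leq_mul.
Qed.

Hypothesis X_mean : forall i, ('E_P[X i] = 0)%E.
Hypothesis X_third : forall i, ('E_P[fun t => (`|X i t| ^+ 3)%R] < +oo)%E.
Hypothesis sig0 : 0 < sigma2 X m.

Let sg := Num.sqrt (sigma2 X m).
Let sg0 : 0 < sg. Proof. by rewrite sqrtr_gt0. Qed.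
Let sg2 : sg ^+ 2 = sigma2 X m. Proof. by rewrite sqr_sqrtr// ltW. Qed.
Let K := Kd.
Let K1 : 1 <= K. Proof. exact: Kd_ge1. Qed.
Let K0 : 0 < K. Proof. exact: lt_le_trans K1. Qed.
Let ta := (4 * K)^-1.
Let ta0 : 0 < ta.
Proof. by rewrite invr_gt0; apply: mulr_gt0 => //; rewrite ltr0n. Qed.

Let x i t := X i t / sg.
Let a i t := `|x i t|.
Let keep i t := (a i t <= ta)%R%:R : R.
Let xi i t := x i t * keep i t.

Let a_ge0 i t : 0 <= a i t. Proof. exact: normr_ge0. Qed.

Let a3_ge0 i t : 0 <= a i t ^+ 3. Proof. exact: exprn_ge0. Qed.

Let aE i t : a i t = `|X i t| / sg.
Proof. by rewrite /a /x normrM normfV (gtr0_norm sg0). Qed.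

Let mx i : measurable_fun setT (x i).
Proof. by apply: measurable_funM => //; exact: measurable_cst. Qed.

Let ma i : measurable_fun setT (a i).
Proof. exact: measurableT_comp. Qed.

Let ig_cube i : integ (fun t => a i t ^+ 3).
Proof.
apply/integrableP; split.
  by apply/measurable_EFinP; apply: measurable_funX.
have e : (\int[P]_t `|(a i t ^+ 3)%:E|)%E =
    ((sg ^- 3)%:E * \int[P]_t (`|X i t| ^+ 3)%:E)%E.
  rewrite -ge0_integralZl//.
  - apply: eq_integral => t _; rewrite /= -EFinM; congr (_%:E).
    by rewrite ger0_norm ?exprn_ge0// aE exprMn mulrC exprVn.
  - by apply/measurable_EFinP; apply: measurable_funX; exact: measurableT_comp.
  - by rewrite lee_fin invr_ge0 exprn_ge0// ltW.
rewrite /= in e *; rewrite e.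
have := X_third i; rewrite unlock => h.
by rewrite lte_mul_pinfty// lee_fin invr_ge0 exprn_ge0// ltW.
Qed.

Let g3 i := E (fun t => a i t ^+ 3).
Let ga := \sum_i g3 i.

Let g3_ge0 i : 0 <= g3 i. Proof. exact: Ex_ge0. Qed.

Lemma gammaE : gamma X m = ga.
Proof.
rewrite /gamma /ga -/sg mulr_suml; apply: eq_bigr => i _.
rewrite fine_expectation /g3.
have sg3 : 0 < sg ^+ 3 by rewrite exprn_gt0.
have ic : integ (fun t => `|X i t| ^+ 3).
  rewrite (_ : (fun t => _) = (fun t => sg ^+ 3 * a i t ^+ 3)); first exact: igZ (ig_cube i).
  by apply/funext => t; rewrite aE exprMn exprVn mulrCA mulfV ?mulr1// gt_eqF.
rewrite mulrC -ig_ExZ//; apply: eq_Ex => t.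
by rewrite aE exprMn exprVn mulrC.
Qed.

Let igx i : integ (x i).
Proof.
have h : integ (fun t => 1 + a i t ^+ 3) by apply: igD (ig_cube i); apply: ig_mb; exact: mb_cst.
apply: (ig_le (mx i) h).
move=> t; rewrite -/(a i t); have : 0 <= a i t by exact: normr_ge0.
set b := a i t => b0; have [b1|b1] := leP b 1.
  by rewrite (le_trans b1)// lerDl exprn_ge0.
have : b <= b ^+ 3 by rewrite -[leLHS]expr1 ler_weXn2l// ltW.
lra.
Qed.

Let Ex0 i : E (x i) = 0.
Proof.
have -> : E (x i) = sg^-1 * E (X i).
  rewrite -ig_ExZ; first by apply: eq_Ex => t; rewrite mulrC.
  rewrite /integ (_ : EFin \o _ = EFin \o (fun t => sg * x i t)); first exact: igZ (igx i).
  by apply/funext => t /=; rewrite /x mulrC divfK// gt_eqF.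
by rewrite -fine_expectation X_mean/= mulr0.
Qed.

Let keep_itv i t : 0 <= keep i t <= 1.
Proof. by rewrite /keep; case: (_ <= ta); rewrite ?lexx ?ler01. Qed.

Let dxi i : dep X [set i]%SET (xi i).
Proof.
pose F (y : R) := (y / sg) * (`|y / sg| <= ta)%R%:R.
apply: (@dep_comp _ _ _ _ _ _ _ F ta) => //.
  have m1 : measurable_fun setT (fun y : R => y / sg).
    by apply: measurable_funM => //; exact: measurable_cst.
  apply: measurable_funM => //.
  rewrite (_ : (fun y => _) = (fun y : R => if `|y / sg| <= ta then 1 else 0)); last first.
    by apply/funext => y; case: ifP.
  apply: measurable_fun_ifT => //; apply: measurable_fun_ler => //.
  exact: measurableT_comp.
move=> y; rewrite /F normrM; case: (leP `|y / sg| ta) => h; first by rewrite normr1 mulr1.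
by rewrite normr0 mulr0 ltW.
Qed.

Let mxi i : bmeas (xi i). Proof. exact: dep_mb (dxi i). Qed.

Let dkeep i : dep X [set i]%SET (keep i).
Proof.
apply: (@dep_comp _ _ _ _ _ _ _ (fun y => (`|y / sg| <= ta)%R%:R) 1) => //.
  rewrite (_ : (fun y => _) = (fun y : R => if `|y / sg| <= ta then 1 else 0)); last first.
    by apply/funext => y; case: ifP.
  have m1 : measurable_fun setT (fun y : R => y / sg).
    by apply: measurable_funM => //; exact: measurable_cst.
  by apply: measurable_fun_ifT => //; apply: measurable_fun_ler => //; exact: measurableT_comp.
by move=> y; case: (_ <= ta); rewrite ?normr1 ?normr0.
Qed.

Let mkeep i : bmeas (keep i). Proof. exact: dep_mb (dkeep i). Qed.

Let xi_le i t : `|xi i t| <= ta.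
Proof.
rewrite /xi /keep normrM -/(a i t); case: (leP (a i t) ta) => h.
  by rewrite normr1 mulr1.
by rewrite normr0 mulr0 ltW.
Qed.

Let xi_le_a i t : `|xi i t| <= a i t.
Proof.
have /andP[k0 k1] := keep_itv i t.
by rewrite /xi normrM (ger0_norm k0) ler_piMr.
Qed.

Let xi_cube i : E (fun t => `|xi i t| ^+ 3) <= g3 i.
Proof.
apply: ig_Ex_le (ig_cube i) _; first by apply: ig_mb; apply: mbX; exact: mb_norm.
by move=> t; rewrite lerXn2r ?nnegrE// /a.
Qed.

Let drop_itv i t : 0 <= 1 - keep i t <= 1.
Proof. by have := keep_itv i t; lra. Qed.

Let drop_cube i t : (1 - keep i t) * ta ^+ 3 <= a i t ^+ 3.
Proof.
have /andP[d0 d1] := drop_itv i t.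
rewrite /keep in d0 d1 *; case: (leP (a i t) ta) d0 d1 => h _ _.
  by rewrite subrr mul0r.
by rewrite subr0 mul1r lerXn2r ?nnegrE// ltW.
Qed.

(** Markov's inequality for the third moment at level [ta], with [ta^-3 = 64 K^3]. *)
Let drop_prob : E (fun t => \sum_i (1 - keep i t)) <= 64 * K ^+ 3 * ga.
Proof.
have md i : bmeas (fun t => 1 - keep i t) by apply: mbB => //; exact: mb_cst.
rewrite Ex_sum// mulr_sumr; apply: ler_sum => i _.
rewrite -(ig_ExZ _ (ig_cube i)); apply: ig_Ex_le (igZ _ (ig_cube i)) _ => [|t]; first exact: ig_mb.
have -> : 64 * K ^+ 3 = (ta ^+ 3)^-1 by rewrite /ta -exprVn invrK; ring.
by rewrite mulrC ler_pdivlMr ?exprn_gt0.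
Qed.

(** As [x i] is centred, the mean of [xi i] is minus that of the removed part, and
    [|x| <= ta^-2 |x|^3] where [|x| > ta]. *)
Let xi_mean : \sum_i `|E (xi i)| <= 16 * (K ^+ 2 * ga).
Proof.
rewrite !mulr_sumr; apply: ler_sum => i _.
have -> : E (xi i) = - E (fun t => x i t - xi i t).
  rewrite (ig_ExB (igx i) (ig_mb P (mxi i))) Ex0; ring.
rewrite normrN.
have igd : integ (fun t => x i t - xi i t).
  apply: igD (igx i) _; apply: ig_mb; exact: mbN (mxi i).
have pw t : `|x i t - xi i t| <= 16 * K ^+ 2 * a i t ^+ 3.
  have -> : x i t - xi i t = x i t * (1 - keep i t) by rewrite /xi; ring.
  have -> : 16 * K ^+ 2 = (ta ^+ 2)^-1 by rewrite /ta -exprVn invrK; ring.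
  have /andP[d0 d1] := drop_itv i t.
  rewrite normrM (ger0_norm d0) -/(a i t) mulrC [leRHS]mulrC ler_pdivlMr ?exprn_gt0//.
  rewrite /keep; case: (leP (a i t) ta) => h; first by rewrite subrr !mul0r exprn_ge0.
  rewrite subr0 mul1r [leRHS]exprS; apply: ler_wpM2l => //.
  by apply: lerXn2r (ltW h); rewrite nnegrE// ltW.
have iga : integ (fun t => 16 * K ^+ 2 * a i t ^+ 3) by exact: igZ.
rewrite mulrA -(ig_ExZ _ (ig_cube i)); exact: ig_Ex_abs.
Qed.

Let xi_keep i t : a i t <= ta -> xi i t = x i t.
Proof. by move=> h; rewrite /xi /keep h mulr1. Qed.

(** The product changes only if one factor exceeds [ta]; then the larger of the two does, and
    [|x_i x_l| ta] is at most its cube. *)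
Let trunc_prod i l t :
  `|x i t * x l t - xi i t * xi l t| <= 4 * K * (a i t ^+ 3 + a l t ^+ 3).
Proof.
have aux (p q : R) : 0 <= p -> 0 <= q -> (ta < p) || (ta < q) -> p * q * ta <= p ^+ 3 + q ^+ 3.
  move=> p0 q0 h; have [pq|/ltW qp] := leP p q.
    have tq : ta <= q by case/orP: h => /ltW h//; exact: le_trans pq.
    apply: (@le_trans _ _ (q ^+ 3)); last by rewrite lerDr exprn_ge0.
    by rewrite !exprS mulr1 mulrA; do 2 (apply: ler_pM => //; rewrite ?mulr_ge0 ?(ltW ta0)//).
  have tp : ta <= p by case/orP: h => /ltW h//; exact: le_trans qp.
  apply: (@le_trans _ _ (p ^+ 3)); last by rewrite lerDl exprn_ge0.
  by rewrite !exprS mulr1 mulrA; do 2 (apply: ler_pM => //; rewrite ?mulr_ge0 ?(ltW ta0)//).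
have -> : 4 * K = ta^-1 by rewrite /ta invrK.
rewrite [leRHS]mulrC ler_pdivlMr//; case: (boolP ((ta < a i t) || (ta < a l t))) => h; last first.
  move: h; rewrite negb_or -!leNgt => /andP[hi hl].
  by rewrite !xi_keep// subrr normr0 mul0r addr_ge0.
apply: le_trans (aux _ _ (a_ge0 i t) (a_ge0 l t) h).
rewrite ler_pM2r// {}/xi; have /andP[i0 i1] := keep_itv i t; have /andP[l0 l1] := keep_itv l t.
rewrite (_ : _ - _ = x i t * x l t * (1 - keep i t * keep l t)); last by ring.
rewrite normrM normrM -/(a i t) -/(a l t) ler_piMr ?mulr_ge0//.
have := mulr_ge0 i0 l0; have : keep i t * keep l t <= 1 by exact: mulr_ile1.
by rewrite ler_norml; lra.
Qed.

Let ig_trunc_prod i l : integ (fun t => x i t * x l t - xi i t * xi l t).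
Proof.
have h : integ (fun t => 4 * K * (a i t ^+ 3 + a l t ^+ 3)).
  by apply: igZ; apply: igD; exact: ig_cube.
apply: ig_le h (trunc_prod i l).
by apply: measurable_funB; apply: measurable_funM => //; [case: (mxi i)|case: (mxi l)].
Qed.

(** The truncated product is bounded and the difference is dominated by cubes, so third moments
    suffice directly. *)
Let ig_prod i l : integ (fun t => x i t * x l t).
Proof.
have h := igD (ig_trunc_prod i l) (ig_mb P (mbM (mxi i) (mxi l))).
by apply: etrans h; congr (integrable _ _ (EFin \o _)); apply/funext => t; rewrite subrK.
Qed.

Let prod_mean i l :
  `|E (fun t => x i t * x l t) - E (fun t => xi i t * xi l t)| <= 4 * K * (g3 i + g3 l).
Proof.
rewrite -(ig_ExB (ig_prod i l) (ig_mb P (mbM (mxi i) (mxi l)))).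
rewrite -(ig_ExD (ig_cube i) (ig_cube l)) -(ig_ExZ _ (igD (ig_cube i) (ig_cube l))).
by apply: ig_Ex_abs (trunc_prod i l) => //; apply: igZ; apply: igD; exact: ig_cube.
Qed.

Let nbhdE i t : nbhd_sum X m i t = \sum_(l in nb jdist m 1 i) X l t.
Proof. by apply: eq_bigl => l; rewrite inE mul1n. Qed.

Let sgx i t : X i t = sg * x i t.
Proof. by rewrite /x mulrC divfK// gt_eqF. Qed.

Let prod_sum : \sum_i \sum_(l in nb jdist m 1 i) E (fun t => x i t * x l t) = 1.
Proof.
apply: (@mulfI _ (sg ^+ 2)); first by rewrite expf_neq0// gt_eqF.
rewrite mulr1 mulr_sumr [RHS]sg2 /sigma2; apply: eq_bigr => i _.
rewrite fine_expectation -ig_Ex_sum; last by move=> l _; exact: ig_prod.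
rewrite -ig_ExZ; last by apply: ig_sum => l _; exact: ig_prod.
apply: eq_Ex => t; rewrite nbhdE sgx !mulr_sumr; apply: eq_bigr => l _.
by rewrite sgx; ring.
Qed.

Let U_mean : `|E (Ug jdist m xi [set: J]%SET) - 1| <= 8 * (K ^+ 2 * ga).
Proof.
have -> : E (Ug jdist m xi [set: J]%SET) =
    \sum_i \sum_(l in nb jdist m 1 i) E (fun t => xi i t * xi l t).
  rewrite /Ug Ex_sum; last by move=> i _; apply: mb_sum => l _; exact: mbM.
  rewrite big_mkcond; apply: eq_bigr => i _; rewrite finset.in_setT.
  rewrite Ex_sum; last by move=> l _; exact: mbM.
  by apply: eq_bigl => l; rewrite finset.in_setT andbT.
rewrite distrC -[X in `|X - _|]prod_sum -sumrB (le_trans (ler_norm_sum _ _ _))//.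
apply: (@le_trans _ _ (\sum_i \sum_(l in nb jdist m 1 i) 4 * K * (g3 i + g3 l))).
  apply: ler_sum => i _; rewrite -sumrB (le_trans (ler_norm_sum _ _ _))//.
  by apply: ler_sum => l _; exact: prod_mean.
have e1 : \sum_i \sum_(l in nb jdist m 1 i) g3 i <= K * ga.
  rewrite mulr_sumr; apply: ler_sum => i _; rewrite sumr_const -mulr_natl ler_wpM2r//.
  exact: (card_nb jrefl jsym jtri card_nb4).
have e2 : \sum_i \sum_(l in nb jdist m 1 i) g3 l <= K * ga.
  have := sum_nb_exchange jrefl jsym jtri card_nb4 (r := 1) xpredT isT g3_ge0.
  by apply: le_trans; rewrite le_eqVlt; apply/orP; left; apply/eqP; apply: eq_bigr => i _;
    apply: eq_bigl => l; rewrite andbT.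
under eq_bigr do rewrite -mulr_sumr big_split.
rewrite -mulr_sumr big_split/=.
have -> : 8 * (K ^+ 2 * ga) = 4 * K * (K * ga + K * ga) by ring.
by apply: ler_wpM2l; [rewrite mulr_ge0// ltW|exact: lerD].
Qed.

(** Pointwise [y^2 <= th y^3 + th^-2], according to whether [th y >= 1]. The free parameter replaces
    Hölder's inequality. *)
Let second_moment th : 0 < th ->
  \sum_i E (fun t => xi i t ^+ 2) <= th * ga + #|` J|%:R * th ^- 2.
Proof.
move=> th0; have -> : #|` J|%:R * th ^- 2 = \sum_(i : J) th ^- 2 :> R.
  by rewrite sumr_const -[RHS]mulr_natl cardfE.
rewrite mulr_sumr -big_split; apply: ler_sum => i _ /=.
have i1 : integ (fun t => a i t ^+ 3) by exact: ig_cube.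
have i2 : integ (fun=> th ^- 2) by apply: ig_mb; exact: mb_cst.
have h : integ (fun t => th * a i t ^+ 3 + th ^- 2).
  by apply: igD => //; exact: igZ.
have -> : th * g3 i + th ^- 2 = E (fun t => th * a i t ^+ 3 + th ^- 2).
  by rewrite (ig_ExD (igZ th i1) i2) Ex_cst (ig_ExZ _ i1).
apply: ig_Ex_le h _; first by apply: ig_mb; exact: mbX.
move=> t; have : xi i t ^+ 2 <= a i t ^+ 2.
  by rewrite -normrX normrX -(real_normK (num_real (xi i t))) lerXn2r// nnegrE.
move/le_trans; apply; have [h1|/ltW h1] := leP 1 (th * a i t).
  rewrite -[leLHS]addr0 lerD ?invr_ge0 ?exprn_ge0 ?(ltW th0)//.
  by rewrite [X in th * X]exprS mulrA ler_peMl// sqr_ge0.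
rewrite -[leLHS]add0r lerD ?mulr_ge0 ?(ltW th0)//.
rewrite -div1r ler_pdivlMr ?exprn_gt0// -exprMn mulrC.
by rewrite exprn_ile1// mulr_ge0// ltW.
Qed.

Let n : R := #|` J|%:R.
Let n0 : 0 < n. Proof. by rewrite ltr0n cardfs_gt0. Qed.
Let rn := Num.sqrt n.
Let rn0 : 0 < rn. Proof. by rewrite sqrtr_gt0. Qed.
Let rn2 : rn ^+ 2 = n. Proof. by rewrite sqr_sqrtr// ltW. Qed.
Let q := n `^ (3^-1) * ga `^ (2 / 3).
Let ga_ge0 : 0 <= ga. Proof. by apply: sumr_ge0 => i _; exact: g3_ge0. Qed.
Let q_ge0 : 0 <= q. Proof. by rewrite mulr_ge0// powR_ge0. Qed.

Let s2_ge0 : 0 <= \sum_i E (fun t => xi i t ^+ 2).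
Proof. by apply: sumr_ge0 => i _; apply: Ex_ge0 => t; exact: sqr_ge0. Qed.

Let s2_le : \sum_i E (fun t => xi i t ^+ 2) <= 2 * q.
Proof.
move: ga_ge0; rewrite le_eqVlt => /predU1P[g0|g0].
  (* If gamma vanishes, [second_moment] bounds the sum [s] by [n / th^2] for every [th]; the choice
     [th = 1 + n / s] contradicts [s > 0]. *)
  rewrite /q -g0 powR0 ?mulr0; last by rewrite mulf_neq0// ?invr_eq0// pnatr_eq0.
  have := second_moment; rewrite -g0; have := s2_ge0.
  move: (\sum_i _) => s; rewrite le_eqVlt => /predU1P[<-//|s0] h.
  have ns : 0 < n / s by rewrite divr_gt0.
  have t1 : 1 <= 1 + n / s by rewrite lerDl ltW.
  have t0 : 0 < 1 + n / s by exact: lt_le_trans t1.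
  have := h _ t0; rewrite mulr0 add0r ler_pdivlMr ?exprn_gt0//.
  have : 1 + n / s <= (1 + n / s) ^+ 2 by rewrite expr2 ler_peMl// ltW.
  rewrite -(ler_pM2l s0); have -> : s * (1 + n / s) = s + n by field; rewrite gt_eqF.
  rewrite -/n; lra.
(* The choice [th = v / u = (n / gamma)^(1/3)] makes both terms of [second_moment] equal to
   [v u^2 = q]. *)
pose u := ga `^ (3^-1); pose v := n `^ (3^-1).
have u0 : 0 < u by exact: powR_gt0.
have v0 : 0 < v by exact: powR_gt0.
have cube (y : R) : 0 <= y -> (y `^ (3^-1)) ^+ 3 = y.
  by move=> y0; rewrite -powR_mulrn ?powR_ge0// -powRrM mulVf ?powRr1// pnatr_eq0.
have -> : q = v * u ^+ 2.
  by rewrite /q -/v -powR_mulrn ?powR_ge0// -powRrM [3^-1 * _]mulrC.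
have := second_moment (divr_gt0 v0 u0).
have -> : ga = u ^+ 3 by rewrite cube.
have -> : #|` J|%:R = v ^+ 3 by rewrite cube// ltW.
move/le_trans; apply; rewrite le_eqVlt; apply/orP; left; apply/eqP.
by field; rewrite !gt_eqF.
Qed.

Let cc i : R := #|nb jdist m 1 i|%:R.

Let cc_itv i : 0 <= cc i <= K.
Proof. by rewrite ler0n; exact: (card_nb jrefl jsym jtri card_nb4). Qed.

Let bd t := \sum_i (1 - keep i t).

Let mbd : bmeas bd.
Proof. by apply: mb_sum => i _; apply: mbB => //; exact: mb_cst. Qed.

Let bd_ge0 t : 0 <= bd t.
Proof. by apply: sumr_ge0 => i _; case/andP: (drop_itv i t). Qed.

(** [bd] counts the truncated indices, so a value below 1 means that there are none. *)
Let all_kept t : bd t < 1 -> forall i, xi i t = x i t.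
Proof.
move=> b1 i; apply: xi_keep; rewrite leNgt; apply/negP => h.
have k0 : keep i t = 0 by rewrite /keep leNgt h.
move: b1; apply/negP; rewrite -leNgt /bd (bigD1 i)//= k0 subr0 lerDl.
by apply: sumr_ge0 => j _; case/andP: (drop_itv j t).
Qed.

Section kept.
Variable t : T.
Hypothesis kept : forall i, xi i t = x i t.

Let XE i : X i t = sg * xi i t. Proof. by rewrite kept sgx. Qed.

Let SE : Ssum X t = sg * Sg xi [set: J]%SET t.
Proof.
rewrite /Ssum /Sg mulr_sumr; apply: eq_big => [i|i _]; first by rewrite finset.in_setT.
exact: XE.
Qed.

Let NE : \sum_j nbhd_sum X m j t = sg * Lam xi cc t.
Proof.
under eq_bigr do rewrite nbhdE.
rewrite (exchange_big_dep xpredT)//= /Lam mulr_sumr; apply: eq_bigr => l _.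
rewrite sumr_const -mulr_natl XE mulrCA /cc; congr (_ * (_ *+ _ * _)); apply: eq_card => j.
by transitivity (l \in nb jdist m 1 j) => //; rewrite !inE jsym.
Qed.

Let VE : \sum_i (X i t * nbhd_sum X m i t - Xbar X t * Ybar X m t) =
  sg ^+ 2 * Vc jdist m xi cc rn t.
Proof.
rewrite sumrB sumr_const -mulr_natl /Xbar /Ybar NE SE /Vc mulrBr; congr (_ - _).
  rewrite /Ug mulr_sumr; apply: eq_big => [i|i _]; first by rewrite finset.in_setT.
  rewrite nbhdE XE !mulr_sumr; apply: eq_big => [l|l _].
    by rewrite finset.in_setT andbT.
  by rewrite XE; ring.
rewrite rn2 -/n (_ : #|_| = #|` J|); last by rewrite cardfE; apply: eq_card.
by rewrite -/n; field; rewrite gt_eqF.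
Qed.

Lemma Wstat_kept : 0 < Vc jdist m xi cc rn t ->
  Wstat X m t = Sg xi [set: J]%SET t / Num.sqrt (Vc jdist m xi cc rn t).
Proof.
move=> V0; have s2V : 0 < sg ^+ 2 * Vc jdist m xi cc rn t by rewrite mulr_gt0// exprn_gt0.
have vE : Vnorm X m t = sg * Num.sqrt (Vc jdist m xi cc rn t).
  rewrite /Vnorm VE max_l; last exact: ltW.
  by rewrite sqrtrM ?sqrtr_sqr ?gtr0_norm// exprn_ge0// ltW.
have v0 : 0 < Num.sqrt (Vc jdist m xi cc rn t) by rewrite sqrtr_gt0.
rewrite /Wstat vE mulf_eq0 !gt_eqF//= SE; field.
by rewrite !gt_eqF.
Qed.

End kept.

Lemma measurable_nbhd_sum i : measurable_fun setT (nbhd_sum X m i).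
Proof.
rewrite /nbhd_sum; under eq_fun do rewrite -big_filter.
by apply: measurable_sum => j.
Qed.

Lemma measurable_Ssum : measurable_fun setT (Ssum X).
Proof. by apply: measurable_sum => j. Qed.

Lemma measurable_Vnorm : measurable_fun setT (Vnorm X m).
Proof.
have ms : measurable_fun setT (@Num.sqrt R).
  by apply: continuous_measurable_fun; exact: sqrt_continuous.
apply: (measurableT_comp ms); apply: measurable_maxr; last exact: measurable_cst.
apply: measurable_sum => i; apply: measurable_funB.
  by apply: measurable_funM => //; exact: measurable_nbhd_sum.
apply: measurable_funM; apply: measurable_funM; try exact: measurable_cst.
  exact: measurable_Ssum.
by apply: measurable_sum => j; exact: measurable_nbhd_sum.
Qed.

Lemma measurable_Wstat_le z : measurable_fun setT (fun t => (Wstat X m t <= z)%R).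
Proof.
rewrite (_ : (fun t => _) = (fun t => if Vnorm X m t == 0 then (0 <= z)%R
    else (Ssum X t <= z * Vnorm X m t)%R)).
  apply: measurable_fun_ifT.
  - by apply: measurable_fun_eqr; [exact: measurable_Vnorm|exact: measurable_cst].
  - exact: measurable_cst.
  - apply: measurable_fun_ler; first exact: measurable_Ssum.
    by apply: measurable_funM; [exact: measurable_cst|exact: measurable_Vnorm].
apply/funext => t; rewrite /Wstat; case: eqP => // /eqP V0.
by rewrite ler_pdivrMr// lt_neqAle eq_sym V0 sqrtr_ge0.
Qed.

Let ind z t : R := (Wstat X m t <= z)%R%:R.

Let ind_itv z t : 0 <= ind z t <= 1.
Proof. by rewrite /ind; case: (_ <= z); rewrite ?lexx ?ler01. Qed.

Let mind z : bmeas (ind z).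
Proof.
split; last by exists 1 => t; have /andP[i0 i1] := ind_itv z t; rewrite ger0_norm.
rewrite (_ : ind z = (fun t => if (Wstat X m t <= z)%R then 1 else 0)); last first.
  by apply/funext => t; rewrite /ind; case: (_ <= z).
by apply: measurable_fun_ifT => //; exact: measurable_Wstat_le.
Qed.

Let Eind_itv z : 0 <= E (ind z) <= 1.
Proof.
apply/andP; split; first by apply: Ex_ge0 => t; case/andP: (ind_itv z t).
rewrite -(Ex_cst P 1); apply: Ex_le => //; first exact: mb_cst.
by move=> t; case/andP: (ind_itv z t).
Qed.

Lemma prob_Wstat z : P [set t | Wstat X m t <= z]%R = (E (ind z))%:E.
Proof.
have mA : measurable [set t | Wstat X m t <= z]%R.
  have := measurable_Wstat_le z measurableT (I : measurable [set true]).
  by rewrite setTI; congr measurable; apply/seteqP; split.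
rewrite (_ : ind z = \1_[set t | Wstat X m t <= z]%R); last first.
  apply/funext => t; rewrite indicE /ind.
  by case: (boolP (_ <= z)) => h; [rewrite mem_set|rewrite memNset//; exact/negP].
rewrite Ex_indic// fineK// ge0_fin_numE// (le_lt_trans (probability_le1 _ _)) ?ltry//.
Qed.

Let c : R := 8 ^+ d.
Let M : R := m.+1%:R ^+ d.
Let c1 : 1 <= c. Proof. by rewrite exprn_ege1// ler1n. Qed.
Let M1 : 1 <= M. Proof. by rewrite exprn_ege1// ler1n. Qed.
Let KE : K = c * M. Proof. by rewrite /K /Kd natrM !natrX. Qed.

Lemma self_normalized_clt z :
  `|E (ind z) - Phi z| <=
  1000 * 16400 * (c ^+ 4 * M ^+ 3 * (1 + M * q) * (ga + rn^-1)).
Proof.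
have b0 : 0 < rn^-1 by rewrite invr_gt0.
have [p0 p1] := andP (Eind_itv z); have [f0 f1] := andP (Phi_itv z).
(* The summand [rn^-1] makes the ramp width positive without any lower bound on gamma, and it
   belongs to the final bound in any case. *)
pose be := K ^+ 2 * (ga + rn^-1).
have K2 : 1 <= K ^+ 2 by rewrite exprn_ege1.
have be0 : 0 < be by rewrite mulr_gt0 ?ltr_wpDl// (lt_le_trans _ K2).
have gabe : K ^+ 2 * ga <= be by rewrite ler_pM2l ?(lt_le_trans _ K2)// lerDl ltW.
have [bes|/ltW bel] := leP be 100^-1; last first.
  apply: le_trans (trivial_bound c1 M1 q_ge0 ga_ge0 b0 _); last by rewrite -KE.
  by rewrite ler_norml; lra.
have third : K ^+ 2 * \sum_i E (fun t => `|xi i t| ^+ 3) <= be.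
  apply: le_trans gabe; rewrite ler_pM2l ?(lt_le_trans _ K2)//.
  by apply: ler_sum => i _; exact: xi_cube.
have means : \sum_i `|E (xi i)| <= 16 * be.
  by apply: le_trans xi_mean _; rewrite ler_pM2l ?ltr0n.
have EU : `|E (Ug jdist m xi [set: J]%SET) - 1| <= 4^-1.
  by apply: le_trans U_mean _; lra.
have K3 : 0 <= 64 * K ^+ 3 * ga.
  by apply: mulr_ge0 => //; apply: mulr_ge0; rewrite ?ler0n// exprn_ge0// ltW.
have := truncated_clt jrefl jsym jtri jdist_indep dxi K1 card_nb4 xi_le bes be0 third means EU
  cc_itv rn0 mbd bd_ge0 drop_prob (fun t h => Wstat_kept (all_kept h)) (mind z) K3
  (Eind_itv z) (Phi_itv z).
move/le_trans; apply.
have := bound_arith c1 M1 q_ge0 ga_ge0 b0 s2_ge0 s2_le.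
by rewrite /be KE.
Qed.

End reduction.

Theorem theorem3p1 (R : realType) (d : nat) (hd : (1 <= d)%N) :
  exists C : R, 0 < C /\
  forall (disp : measure_display) (T : measurableType disp)
    (P : probability T R) (m : nat) (J : {fset 'rV[int]_d})
    (X : J -> {RV P >-> R}),
    J != fset0 ->
    m_dependent X m ->
    (forall i : J, ('E_P[X i] = 0)%E) ->
    (forall i : J, ('E_P[fun t => (`|X i t| ^+ 3)%R] < +oo)%E) ->
    0 < sigma2 X m ->
    (ereal_sup [set `|P [set t | Wstat X m t <= z]%R - std_normal_cdf z|
                 | z in [set: R]]
     <= (C * (m.+1)%:R ^+ (3 * d)
         * (1 + (m.+1)%:R ^+ d * #|` J|%:R `^ (3%:R^-1)
              * gamma X m `^ (2%:R / 3%:R))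
         * (gamma X m + #|` J|%:R `^ (- (2%:R^-1))))%R%:E)%E.
Proof.
(* 16400 is the constant of [weighted_concentration], and [8 ^+ d] is the ratio between [Kd] and
   (m+1)^d. *)
exists (1000 * 16400 * (8 ^+ d) ^+ 4); split.
  by apply: mulr_gt0; [apply: mulr_gt0; rewrite ltr0n|rewrite !exprn_gt0// ltr0n].
move=> disp T P m J X J0 Xdep X_mean X_third sig0.
apply: ge_ereal_sup => _ [z _ <-].
rewrite prob_Wstat std_normal_cdfE -EFinB abse_EFin lee_fin.
apply: le_trans (self_normalized_clt J0 Xdep X_mean X_third sig0 z) _.
rewrite -(gammaE X_third sig0) powRN powR12_sqrt ?ler0n// mulnC exprM.
by rewrite le_eqVlt; apply/orP; left; apply/eqP; rewrite !mulrA.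
Qed.
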